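(* Let $n\ge5k$. For $i\in\{1,2,3\}$ let $X_i$ be respectively Poisson with parameter $\lambda>0$, pseudo-binomial with parameters $\check\alpha>0$, $\check p\in(0,1)$, and negative binomial with parameters $\hat\alpha>0$, $\hat p\in(0,1)$. In each part below assume ${\mathbb E}(X_i)={\mathbb E}\big(S_{k_1,k_2}^n\big)$ for the relevant $i$ and put $\varphi=\mathrm{Var}(X_i)-\mathrm{Var}\big(S_{k_1,k_2}^n\big)$. Then: (i) $d_{TV}\left(X_1,S_{k_1,k_2}^n\right)\le\dfrac{1}{\max(1,\lambda)}\left\{2(2+qp)h_1(n,k,p)a(p)^3+|\varphi|\right\}$. (ii) $d_{TV}\left(X_2,S_{k_1,k_2}^n\right)\le\dfrac{1}{\lfloor\check\alpha\rfloor\check p\check q}\left\{2(2+qp)a(p)^2\big(h_1(n,k,p)a(p)+\check p\,h_2(n,k,p)\big)+|\varphi|\right\}$. (iii) $d_{TV}\left(X_3,S_{k_1,k_2}^n\right)\le\dfrac{1}{\hat\alpha\hat q}\left\{2(2+qp)a(p)^2\big(\hat p\,h_1(n,k,p)a(p)+\hat q\,h_2(n,k,p)\big)+\hat p|\varphi|\right\}$.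
   Context: Runs. Fix integers $k_1,k_2\ge1$ and put $k=k_1+k_2$. Let $\eta_1,\dots,\eta_n$ be independent Bernoulli trials with ${\mathbb P}(\eta_i=1)=p=1-q=1-{\mathbb P}(\eta_i=0)$, $0<p<1$, and set $\eta_0=1$. For $1\le l\le n-k$ let $${\mathbb I}_l=\eta_{l-1}\Big[\prod_{i=1}^{k_1}(1-\eta_{l+i-1})\prod_{j=1}^{k_2}\eta_{l+k_1+j-1}\Big](1-\eta_{l+k}),\qquad S_{k_1,k_2}^n=\sum_{l=1}^{n-k}{\mathbb I}_l .$$ Write $a(p)=q^{k_1}p^{k_2}$. Approximating laws. ${\mathbb P}(X_1=m)=e^{-\lambda}\lambda^m/m!$, $m\ge0$; ${\mathbb P}(X_2=m)=\frac1R\binom{\check\alpha}{m}\check p^m\check q^{\check\alpha-m}$, $m=0,1,\dots,\lfloor\check\alpha\rfloor$, with $R=\sum_{m=0}^{\lfloor\check\alpha\rfloor}\binom{\check\alpha}{m}\check p^m\check q^{\check\alpha-m}$; ${\mathbb P}(X_3=m)=\binom{\hat\alpha+m-1}{m}\hat p^{\hat\alpha}\hat q^m$, $m\ge0$; here $\check q=1-\check p$, $\hat q=1-\hat p$, and $\check\alpha,\hat\alpha$ need not be integers (generalized binomial coefficients). The paper treats these as discrete Gibbs measures ${\mathbb P}(Z=m)=\frac1\beta e^{U(m)}w^m/m!$ with $e^{U(m+1)-U(m)}=a+bm$, for which it uses ${\mathbb E}(Z)=\frac{wa}{1-wb}$ and $\mathrm{Var}(Z)=\frac{wa}{(1-wb)^2}$,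 where $(w,a,b)=(\lambda,1,0)$ for $X_1$, $(\check p/\check q,\check\alpha,-1)$ for $X_2$, $(\hat q,\hat\alpha,1)$ for $X_3$. $d_{TV}(X,Y)=\sup_{A\subseteq{\mathbb Z}}|{\mathbb P}(X\in A)-{\mathbb P}(Y\in A)|$. Constants. $\delta^*=1+q+qp$, $\delta=2+\delta^*(k+2)$, $\delta_1=\delta^*\big(5k+6+\frac{3k^2+11k+10}{2}\delta^*\big)$, $\delta_2=\delta^*\big(3+\frac{4k+7}{2}\delta^*\big)$, $c_{n,k}^{(1)}=(n-2k-2)(k+1)+\frac{(k+1)^{n-k+1}}{(k+2)^{n-k-1}}$, $c_{n,k}^{(2)}=n-3k+k\big(\frac{k+1}{k+2}\big)^{n-2k}$, $c_{n,k}^{(3)}=n-5k+k(nk+6k+4-k^2)\frac{(k+1)^{n-3k-1}}{(k+2)^{n-3k+1}}$, $c_{n,k}^{(4)}=n(3k+1)-(11k^2+9k+2)+(2nk+k^2+7k+2)\big(\frac{k+1}{k+2}\big)^{n-2k}$, $c_{n,k}^{(5)}=n(2k+3)-6k^2-16k-10+(2n+2k+5)\frac{(k+1)^{n-k}}{(k+2)^{n-k-1}}$, $$h_1(n,k,p)=(n-k)(4+\delta_1)+\delta_2c_{n,k}^{(1)}+\delta c_{n,k}^{(2)}+c_{n,k}^{(3)}+\delta^*c_{n,k}^{(4)}+\frac{{\delta^*}^2}{2}c_{n,k}^{(5)},$$ $$h_2(n,k,p)=(n-k)\delta+\delta^*c_{n,k}^{(1)}+c_{n,k}^{(2)}.$$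 *)

(* Defs.v *)
From mathcomp Require Export all_boot all_order all_algebra.
From mathcomp Require Export all_classical all_reals all_analysis.

Set Implicit Arguments.
Unset Strict Implicit.
Unset Printing Implicit Defensive.

Import Order.TTheory GRing.Theory Num.Theory.
Import numFieldNormedType.Exports.

Local Open Scope classical_set_scope.
Local Open Scope ring_scope.

(* Independence is mutual: the product rule is required for every finite
   subfamily of the variables indexed by D. *)
Definition mutually_independent (R : realType) (d : measure_display)
    (T : measurableType d) (P : probability T R)
    (D : set nat) (X : nat -> {RV P >-> R}) : Prop :=
  forall (s : seq nat) (B : nat -> set R),
    uniq s -> [set` s] `<=` D -> (forall i, measurable (B i)) ->
    P (\bigcap_(i in [set` s]) (X i @^-1` B i)) =
    (\prod_(i <- s) P (X i @^-1` B i))%E.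

(* The trials are eta 1, ..., eta n; eta 0 is the constant 1, and the values
   of eta beyond n are unconstrained. *)
Definition bernoulli_trials (R : realType) (d : measure_display)
    (T : measurableType d) (P : probability T R)
    (n : nat) (p : R) (eta : nat -> {RV P >-> R}) : Prop :=
  [/\ forall t, eta 0%N t = 1,
      forall i, (1 <= i <= n)%N ->
        P (eta i @^-1` [set 1]) = p%:E /\ P (eta i @^-1` [set 0]) = (1 - p)%:E
    & mutually_independent [set i | (1 <= i <= n)%N] eta].

Definition run_indicator (R : realType) (T : Type) (k1 k2 : nat)
    (eta : nat -> T -> R) (l : nat) (t : T) : R :=
  eta (l - 1)%N t *
  (\prod_(1 <= i < k1.+1) (1 - eta (l + i - 1)%N t) *
   \prod_(1 <= j < k2.+1) eta (l + k1 + j - 1)%N t) *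
  (1 - eta (l + (k1 + k2))%N t).

Definition run_count (R : realType) (T : Type) (k1 k2 n : nat)
    (eta : nat -> T -> R) (t : T) : R :=
  \sum_(1 <= l < (n - (k1 + k2)).+1) run_indicator k1 k2 eta l t.

(* X and Y may live on different probability spaces. *)
Definition dTV (R : realType) (d d' : measure_display)
    (T : measurableType d) (T' : measurableType d')
    (P : probability T R) (Q : probability T' R)
    (X : T -> R) (Y : T' -> R) : \bar R :=
  ereal_sup [set `|P (X @^-1` [set z%:~R | z in A])
                   - Q (Y @^-1` [set z%:~R | z in A])|%E | A in [set: set int]].

Definition has_pmf (R : realType) (d : measure_display)
    (T : measurableType d) (P : probability T R)
    (X : {RV P >-> R}) (f : nat -> R) : Prop :=
  forall m : nat, P (X @^-1` [set m%:R]) = (f m)%:E.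

Definition gbinom (R : realType) (x : R) (m : nat) : R :=
  (\prod_(i < m) (x - i%:R)) / m`!%:R.

(* For alpha >= 0, Num.truncn alpha is the floor of alpha, as a nat. *)
Definition pseudo_binomial_weight (R : realType) (alpha p : R) (m : nat) : R :=
  gbinom alpha m * p ^+ m * (1 - p) `^ (alpha - m%:R).

Definition pseudo_binomial_pmf (R : realType) (alpha p : R) (m : nat) : R :=
  if (m <= Num.truncn alpha)%N then
    pseudo_binomial_weight alpha p m /
    \sum_(0 <= j < (Num.truncn alpha).+1) pseudo_binomial_weight alpha p j
  else 0.

(* alpha need not be an integer, and p is the parameter raised to the power
   alpha. *)
Definition negative_binomial_pmf (R : realType) (alpha p : R) (m : nat) : R :=
  gbinom (alpha + m%:R - 1) m * p `^ alpha * (1 - p) ^+ m.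

Definition a_run (R : realType) (k1 k2 : nat) (p : R) : R :=
  (1 - p) ^+ k1 * p ^+ k2.

Definition delta_star (R : realType) (p : R) : R :=
  1 + (1 - p) + (1 - p) * p.

Definition delta (R : realType) (k : nat) (p : R) : R :=
  2 + delta_star p * (k%:R + 2).

Definition delta1 (R : realType) (k : nat) (p : R) : R :=
  delta_star p *
  (5 * k%:R + 6 + (3 * k%:R ^+ 2 + 11 * k%:R + 10) / 2 * delta_star p).

Definition delta2 (R : realType) (k : nat) (p : R) : R :=
  delta_star p * (3 + (4 * k%:R + 7) / 2 * delta_star p).

(* In c1 ... c5 the subtractions in exponents are truncated subtractions on
   nat; they are exact for k >= 2 and n >= 5 k.  All other subtractions are
   in R. *)
Definition c1 (R : realType) (n k : nat) : R :=
  (n%:R - 2 * k%:R - 2) * (k%:R + 1)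
  + (k%:R + 1) ^+ (n - k + 1) / (k%:R + 2) ^+ (n - k - 1).

Definition c2 (R : realType) (n k : nat) : R :=
  n%:R - 3 * k%:R + k%:R * ((k%:R + 1) / (k%:R + 2)) ^+ (n - 2 * k).

Definition c3 (R : realType) (n k : nat) : R :=
  n%:R - 5 * k%:R
  + k%:R * (n%:R * k%:R + 6 * k%:R + 4 - k%:R ^+ 2)
    * ((k%:R + 1) ^+ (n - 3 * k - 1) / (k%:R + 2) ^+ (n - 3 * k + 1)).

Definition c4 (R : realType) (n k : nat) : R :=
  n%:R * (3 * k%:R + 1) - (11 * k%:R ^+ 2 + 9 * k%:R + 2)
  + (2 * n%:R * k%:R + k%:R ^+ 2 + 7 * k%:R + 2)
    * ((k%:R + 1) / (k%:R + 2)) ^+ (n - 2 * k).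

Definition c5 (R : realType) (n k : nat) : R :=
  n%:R * (2 * k%:R + 3) - 6 * k%:R ^+ 2 - 16 * k%:R - 10
  + (2 * n%:R + 2 * k%:R + 5)
    * ((k%:R + 1) ^+ (n - k) / (k%:R + 2) ^+ (n - k - 1)).

Definition h1 (R : realType) (n k : nat) (p : R) : R :=
  (n%:R - k%:R) * (4 + delta1 k p) + delta2 k p * c1 R n k
  + delta k p * c2 R n k + c3 R n k + delta_star p * c4 R n k
  + delta_star p ^+ 2 / 2 * c5 R n k.

Definition h2 (R : realType) (n k : nat) (p : R) : R :=
  (n%:R - k%:R) * delta k p + delta_star p * c1 R n k + c2 R n k.

(* Main.v *)
Require Import Defs.
From mathcomp Require Import ring lra zify measurable_realfun.

Set Implicit Arguments.
Unset Strict Implicit.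
Unset Printing Implicit Defensive.

Import Order.TTheory GRing.Theory Num.Theory.
Import numFieldNormedType.Exports.

Local Open Scope classical_set_scope.
Local Open Scope ring_scope.

(** Write I_l for the indicator of an occurrence at l, S for the number of
    occurrences, mu and v for its mean and variance, D f for the difference
    f (j + 1) - f j.

    _Local structure._ An occurrence at l is the word 1 0^k1 1^k2 0 read from
    l - 1. Two distinct occurrences are either exactly k places apart, and then
    share the letters 1 0, or at least k + 2 places apart, and then read
    disjoint sets of trials ([isrun_compat]). Hence the inner words 0^k1 1^k2
    of distinct occurrences never overlap, and a product of r distinct
    indicators has expectation at most a^r ([E_run], [E_run2], [E_run3]);
    moreover, among the places within k + 1 of l only l - k and l + k can
    accompany I_l.

    _Expansions._ Split S into the places near l and the sum W of the others,
    which is independent of I_l, and expand around W. Since the terms of the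
    first order carry products of two indicators, replacing D f (W + 1) by
    D f (S + 1) in them costs a product of three. Summing over l,
<<
      E[mu f(S+1) - S f(S)] = (mu - v) E[D f(S+1)] + O(n a^3) |D^2 f|,
      E[S D f(S)]           =       mu E[D f(S+1)] + O(n a^2) |D^2 f|
>>
    ([expand_run], [decouple_run]), with explicit constants that h1 and h2
    dominate ([h1_ge], [h2_ge]).

    _Stein equations._ Each approximating law Q is the stationary law of a chain
    with birth rates b and death rates d, and for a set A there is f with
    b j f(j+1) - d j f(j) = 1_A(j) - Q(A). The difference D f is at most 1 / b
    and at most 1 / d ([bd_difference]); this gives the prefactors of the three
    bounds, and |D^2 f| is at most twice |D f|. For the Poisson and negative
    binomial laws the operator is (1 - B) (mu f(j+1) - j f(j)) + B j D f(j), so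
    that the two expansions leave (mu - (1 - B) v) E[D f(S+1)], that is
    (1 - B) (Var X - v) E[D f(S+1)] ([linear_stein_bound],
    [linear_rate_bound]).

    _The pseudo-binomial law._ When alpha is not an integer the chain has to be
    cut at N, the integer part of alpha. With e = (alpha - N) p Q(N), the mean
    of Q is alpha p - e and its variance is q mu - e (N - mu) ([pb_mean],
    [pb_var]), the expectation of the operator contains a term e E[f(S+1)], and
    S may exceed N. The solution is continued beyond N by a line of maximal
    slope ([pb_solution]). Then e E[f(S+1)] is at most e (N - mu) |D f|, which
    is what the correction of the variance provides when v > q mu. Beyond
    N this keeps one of the two inequalities that the Stein equation combines;
    at N it fails, by an amount that contributes a small multiple of
    P(S = N) - Q(N). This is a part of the distance to be bounded, and
    it is absorbed because |D f| is at most 1 / (alpha p q), which is smaller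
    than the prefactor 1 / (N p q) ([pb_tail_bound]). When v < q mu the
    parameter p is so small that e is a term of the second order ([pb_top]).
    The absorption needs p <= q; for larger p the bound exceeds 1
    ([pb_large_p]). The case N = 1 is that of a Bernoulli law ([pb_bernoulli]).

    _Passage to the random variables._ Means, variances and probabilities are
    series in the point masses ([integral_nat]) as soon as these sum to 1; for
    the negative binomial law this is the binomial series
    ([nb_partial_cvg]). The recursion b j Q(j) = d (j + 1) Q(j + 1) yields the
    moments. The law of S is obtained by conditioning on one trial at a time
    ([run_count_cyl]). *)

(** * Expectations under independent coin flips *)

Definition upd (w : nat -> bool) (i : nat) (b : bool) : nat -> bool :=
  fun j => if j == i then b else w j.

(** Averaging over one coin after the other, rather than integrating over a
    product space, turns independence into a statement on the coins that a
    function reads. *)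
Fixpoint flipE (R : realType) (p : R) (s : seq nat)
    (g : (nat -> bool) -> R) (w : nat -> bool) : R :=
  if s is i :: s' then
    p * flipE p s' g (upd w i true) + (1 - p) * flipE p s' g (upd w i false)
  else g w.

Definition reads (R : Type) (D : pred nat) (g : (nat -> bool) -> R) : Prop :=
  forall w w', (forall i, D i -> w i = w' i) -> g w = g w'.

Section FlipE.
Variables (R : realType) (p : R).
Hypothesis hp : 0 <= p <= 1.
Implicit Types (s : seq nat) (g h : (nat -> bool) -> R) (w : nat -> bool).

Lemma eq_flipE s g h w : g =1 h -> flipE p s g w = flipE p s h w.
Proof. by move=> gh; elim: s w => [|i s IH] w /=; rewrite ?gh ?IH. Qed.

Lemma flipE_cst s c w : flipE p s (fun=> c) w = c.
Proof. by elim: s w => [//|i s IH] w /=; rewrite !IH; ring. Qed.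

Lemma flipED s g h w :
  flipE p s (fun v => g v + h v) w = flipE p s g w + flipE p s h w.
Proof. by elim: s w => [//|i s IH] w /=; rewrite !IH; ring. Qed.

Lemma flipEZ s c g w : flipE p s (fun v => c * g v) w = c * flipE p s g w.
Proof. by elim: s w => [//|i s IH] w /=; rewrite !IH; ring. Qed.

Lemma flipEN s g w : flipE p s (fun v => - g v) w = - flipE p s g w.
Proof. by elim: s w => [//|i s IH] w /=; rewrite !IH; ring. Qed.

Lemma flipEB s g h w :
  flipE p s (fun v => g v - h v) w = flipE p s g w - flipE p s h w.
Proof. by rewrite flipED flipEN. Qed.

Lemma flipE_sum (I : Type) (r : seq I) (P : pred I)
    (G : I -> (nat -> bool) -> R) s w :
  flipE p s (fun v => \sum_(i <- r | P i) G i v) w =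
  \sum_(i <- r | P i) flipE p s (G i) w.
Proof.
elim: r => [|x r IH].
  by rewrite big_nil -[RHS](flipE_cst s 0 w); apply: eq_flipE => v; rewrite big_nil.
rewrite big_cons -IH; case: (boolP (P x)) => Px.
  by rewrite -flipED; apply: eq_flipE => v; rewrite big_cons Px.
by apply: eq_flipE => v; rewrite big_cons (negbTE Px).
Qed.

Lemma ler_flipE s g h w :
  (forall v, g v <= h v) -> flipE p s g w <= flipE p s h w.
Proof.
move=> gh; elim: s w => [|i s IH] w //=.
by case/andP: hp => p0 p1; apply: lerD; apply: ler_wpM2l => //; rewrite subr_ge0.
Qed.

Lemma flipE_ge0 s g w : (forall v, 0 <= g v) -> 0 <= flipE p s g w.
Proof. by move=> g0; rewrite -(flipE_cst s 0 w); exact: ler_flipE. Qed.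

Lemma ler_norm_flipE s g h w :
  (forall v, `|g v| <= h v) -> `|flipE p s g w| <= flipE p s h w.
Proof.
move=> gh; rewrite ler_norml -flipEN; apply/andP; split; apply: ler_flipE => v;
  by move: (gh v); rewrite ler_norml => /andP[].
Qed.

Lemma reads_flipE D s g : reads D g -> reads D (flipE p s g).
Proof.
move=> Dg; elim: s => [|i s IH] w w' ww' //=; first exact: Dg.
by congr (_ * _ + _ * _); apply: IH => j Dj; rewrite /upd; case: eqP => // _;
  exact: ww'.
Qed.

(** Coins are flipped one at a time, and at each flip one of the two factors
    does not see the result: the product rule follows coin by coin. *)
Lemma flipEM D s g h w : reads D g -> reads (predC D) h ->
  flipE p s (fun v => g v * h v) w = flipE p s g w * flipE p s h w.
Proof.
move=> Dg Dh; elim: s w => [//|i s IH] w /=; rewrite !IH.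
have upd_agree (C : pred nat) b : ~~ C i -> forall j, C j -> upd w i b j = w j.
  by move=> Ci j Cj; rewrite /upd; case: eqP Cj Ci => // -> ->.
case: (boolP (D i)) => Di.
  have Hh b : flipE p s h (upd w i b) = flipE p s h w.
    by apply: (reads_flipE s Dh) => j; apply: upd_agree; rewrite /= negbK.
  by rewrite !Hh; ring.
have Hg b : flipE p s g (upd w i b) = flipE p s g w.
  by apply: (reads_flipE s Dg); exact: upd_agree.
by rewrite !Hg; ring.
Qed.

End FlipE.

Lemma reads_sub (R : Type) (D D' : pred nat) (g : (nat -> bool) -> R) :
  (forall i, D i -> D' i) -> reads D g -> reads D' g.
Proof. by move=> DD' Dg w w' ww'; apply: Dg => i /DD'; exact: ww'. Qed.

Lemma reads_cst (R : Type) (D : pred nat) (c : R) : reads D (fun=> c).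
Proof. by []. Qed.

Lemma reads_comp (R R' : Type) (f : R -> R') (D : pred nat)
    (g : (nat -> bool) -> R) : reads D g -> reads D (fun w => f (g w)).
Proof. by move=> Dg w w' ww'; rewrite (Dg _ _ ww'). Qed.

Lemma reads_op (R R' R'' : Type) (f : R -> R' -> R'') (D : pred nat)
    (g : (nat -> bool) -> R) (h : (nat -> bool) -> R') :
  reads D g -> reads D h -> reads D (fun w => f (g w) (h w)).
Proof. by move=> Dg Dh w w' ww'; rewrite (Dg _ _ ww') (Dh _ _ ww'). Qed.

(** * Words of coin values *)

Fixpoint word (w : nat -> bool) (l : nat) (c : seq bool) : bool :=
  if c is b :: c' then (w l == b) && word w l.+1 c' else true.

Lemma wordP w l c :
  reflect (forall t, (t < size c)%N -> w (l + t)%N = nth false c t) (word w l c).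
Proof.
elim: c l => [|b c IH] l /=; first by left.
apply: (iffP andP) => [[/eqP wl /IH H] [|t] lt|H]; first by rewrite addn0.
  by rewrite -addSnnS H.
split; first by move: (H 0%N isT); rewrite addn0 /= => ->.
by apply/IH => t lt; rewrite addSnnS; exact: H.
Qed.

Lemma reads_word l c :
  reads [pred i | (l <= i < l + size c)%N] (fun w => word w l c).
Proof.
move=> w w' ww'; apply/wordP/wordP => H t lt; rewrite -H //; first rewrite ww' //.
  by rewrite /=; lia.
by rewrite ww' //=; lia.
Qed.

Lemma word_cat w l c c' : word w l (c ++ c') = word w l c && word w (l + size c) c'.
Proof.
elim: c l => [|b c IH] l /=; first by rewrite addn0.
by rewrite IH -andbA addSnnS.
Qed.

Definition bweight (R : realType) (p : R) (b : bool) : R := if b then p else 1 - p.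

Section WordProbability.
Variables (R : realType) (p : R) (s : seq nat) (w0 : nat -> bool).
Hypothesis us : uniq s.

Lemma flipE_coin i b : i \in s ->
  flipE p s (fun w => (w i == b)%:R) w0 = bweight p b.
Proof.
elim: s us w0 => [//|j s' IH] /= /andP[js us'] w; rewrite inE.
case: eqP => [-> _|ij /= is']; last by rewrite !IH // /bweight; ring.
have H c : flipE p s' (fun v => (v j == b)%:R) (upd w j c) = (c == b)%:R.
  transitivity (flipE p s' (fun=> (c == b)%:R) w); last exact: flipE_cst.
  have: forall v : nat -> bool, v j = c ->
      flipE p s' (fun v => (v j == b)%:R) v = (c == b)%:R.
    elim: {us' IH} s' js => [_ v /= -> //|i' s' IH]; rewrite inE negb_or.
    case/andP=> ji js' v vj /=; rewrite !IH //; first by ring.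
      by rewrite /upd (negbTE ji).
    by rewrite /upd (negbTE ji).
  by move=> ->; rewrite ?flipE_cst // /upd eqxx.
by rewrite !H /bweight; case: (b) => /=; ring.
Qed.

Lemma flipE_word l c : (forall i, (l <= i < l + size c)%N -> i \in s) ->
  flipE p s (fun w => (word w l c)%:R) w0 = \prod_(b <- c) bweight p b.
Proof.
elim: c l => [|b c IH] l Hs /=; first by rewrite big_nil flipE_cst.
rewrite big_cons -(IH l.+1) => [|i Hi]; last by apply: Hs; rewrite /=; lia.
rewrite -(flipE_coin b (i := l)); last by apply: Hs; rewrite /=; lia.
under eq_flipE do rewrite -mulnb natrM.
apply: (@flipEM _ _ (pred1 l)) => [w w' ww'|]; first by rewrite ww' /=.
apply: (reads_comp (fun b : bool => b%:R)).
by apply: reads_sub (@reads_word l.+1 c) => i /=; case: eqP; lia.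
Qed.

End WordProbability.

(** * Occurrences of the run *)

Definition core_word (k1 k2 : nat) : seq bool := nseq k1 false ++ nseq k2 true.

Definition run_word (k1 k2 : nat) : seq bool :=
  true :: rcons (core_word k1 k2) false.

(** The value [false] outside 1..m makes the place 0, and with it every
    truncated difference of places, harmless. *)
Definition isrun (k1 k2 m j : nat) (w : nat -> bool) : bool :=
  (1 <= j <= m)%N && word w j.-1 (run_word k1 k2).

Definition run_cnt (k1 k2 m : nat) (C : pred nat) (w : nat -> bool) : nat :=
  \sum_(j < m.+1 | C j) isrun k1 k2 m j w.

Lemma size_core k1 k2 : size (core_word k1 k2) = (k1 + k2)%N.
Proof. by rewrite size_cat !size_nseq. Qed.

Lemma size_run k1 k2 : size (run_word k1 k2) = (k1 + k2).+2.
Proof. by rewrite /= size_rcons size_core. Qed.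

Lemma nth_run_word k1 k2 t : nth false (run_word k1 k2) t =
  (t == 0)%N || (k1 < t <= k1 + k2)%N.
Proof.
case: t => [//|t] /=; rewrite nth_rcons nth_cat !nth_nseq size_core !size_nseq.
rewrite !if_same.
case: (ltnP t) => h1; case: (ltnP t k1) => h2; try case: (ltnP (t - k1)) => h3; lia.
Qed.

Lemma leq_bool (b b' : bool) : (b -> b') -> (b <= b')%N.
Proof. by case: b; case: b' => // /(_ isT). Qed.

Lemma sum_interval_le m a b :
  (\sum_(j < m.+1) ((a <= j < b)%N : nat) <= b - a)%N.
Proof.
suff H M : (\sum_(j < M) ((a <= j < b)%N : nat) <= minn M b - a)%N.
  by apply: leq_trans (H _) _; rewrite leq_sub2r // geq_minr.
elim: M => [|M IH]; first by rewrite big_ord0.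
rewrite big_ord_recr /=; apply: leq_trans (leq_add IH (leqnn _)) _.
by case: (boolP (a <= M < b)%N) => H /=; move: H; lia.
Qed.

Section Neighbours.
Variables (k1 k2 m : nat).
Let k := (k1 + k2)%N.


Definition near (i j : nat) : bool := (i <= j + k + 1)%N && (j <= i + k + 1)%N.
Definition adj (i j : nat) : bool := (j == i + k)%N || (i == j + k)%N.
Definition compat (i j : nat) : bool := ~~ near i j || adj i j.
Definition block (j : nat) : pred nat := [pred i | (j.-1 <= i <= j + k)%N].

Lemma near_refl l : near l l.
Proof. by rewrite /near -addnA leq_addr. Qed.

Lemma far_block l j i : ~~ near l j -> block j i -> ~~ block l i.
Proof. by rewrite /near /block /=; lia. Qed.

Lemma sum_near_le l : (\sum_(j < m.+1) (near l j : nat) <= 2 * k + 3)%N.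
Proof.
apply: leq_trans (_ : _ <= \sum_(j < m.+1) ((l - k.+1 <= j < l + k.+2)%N : nat))%N _.
  by apply: leq_sum => j _; apply: leq_bool; rewrite /near; lia.
by apply: leq_trans (sum_interval_le _ _ _) _; lia.
Qed.

Lemma sum_near2_le l i :
  (\sum_(j < m.+1) (near l j || near i j : nat) <= 4 * k + 6)%N.
Proof.
apply: leq_trans (_ : _ <= \sum_(j < m.+1) ((near l j : nat) + near i j))%N _.
  by apply: leq_sum => j _; case: near; case: near.
rewrite big_split /=; apply: leq_trans (leq_add (sum_near_le l) (sum_near_le i)) _.
lia.
Qed.

Lemma sum_adj_le l : (\sum_(j < m.+1) (adj l j : nat) <= 2)%N.
Proof.
apply: leq_trans (_ : _ <= \sum_(j < m.+1)
   (((l + k <= j < l + k + 1)%N : nat) + ((l - k <= j < l - k + 1)%N : nat)))%N _.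
  apply: leq_sum => j _; rewrite /adj.
  case: eqP => [->|_] /=; [by rewrite leqnn addn1 ltnSn|
    apply: leq_trans (leq_addl _ _); apply: leq_bool; lia].
rewrite big_split /=.
by apply: leq_trans (leq_add (sum_interval_le _ _ _) (sum_interval_le _ _ _)) _; lia.
Qed.

End Neighbours.

Section Runs.
Variables (k1 k2 m : nat).
Let k := (k1 + k2)%N.
Local Notation r := (isrun k1 k2 m).
Local Notation cnt := (run_cnt k1 k2 m).
Local Notation near := (near k1 k2).
Local Notation adj := (adj k1 k2).
Local Notation compat := (compat k1 k2).
Local Notation block := (block k1 k2).

Lemma isrun_core j w : r j w -> word w j (core_word k1 k2).
Proof.
case/andP=> /andP[j1 _]; rewrite /run_word -rcons_cons -cats1 word_cat.
by case/andP; rewrite /= prednK // => /andP[_].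
Qed.

Lemma isrun_at j w t : r j w -> (t <= k.+1)%N ->
  w (j.-1 + t)%N = (t == 0)%N || (k1 < t <= k)%N.
Proof.
case/andP=> _ /wordP H tk; rewrite H ?nth_run_word // size_run -/k; lia.
Qed.

Lemma reads_isrun j : reads (block j) (fun w => r j w).
Proof.
rewrite /isrun; case: (posnP j) => [-> //|j0] w w' ww'.
congr (_ && _); apply: (reads_word (l := j.-1) (c := run_word k1 k2)) => i Hi.
apply: ww'; move: Hi; rewrite /block /= size_rcons size_core -/k; lia.
Qed.

Lemma reads_isrunR (R : pzSemiRingType) j :
  reads (block j) (fun w => (r j w)%:R : R).
Proof. exact: (reads_comp (fun b : bool => b%:R : R) (@reads_isrun j)). Qed.

Lemma reads_cnt (D C : pred nat) :
  (forall j i, C j -> block j i -> D i) -> reads D (cnt C).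
Proof.
move=> CD w w' ww'; apply: eq_bigr => j Cj; congr nat_of_bool.
by apply: reads_isrun => i bi; apply: ww'; exact: CD Cj bi.
Qed.

Lemma eq_cnt C C' w : C =1 C' -> cnt C w = cnt C' w.
Proof. by move=> CC'; apply: eq_bigl => j; rewrite CC'. Qed.

Lemma cntID (B C : pred nat) w :
  cnt C w = (cnt [pred j | C j && B j] w + cnt [pred j | C j && ~~ B j] w)%N.
Proof. by rewrite /cnt (bigID (fun j : 'I__ => B j)). Qed.

Lemma isrun0 w : r 0 w = false. Proof. by []. Qed.

Lemma cnt_pred1 l w : cnt (pred1 l) w = r l w.
Proof.
rewrite /cnt; case: (ltnP l m.+1) => lm.
  by rewrite (big_pred1 (Ordinal lm)) // => j; rewrite /= -val_eqE.
rewrite big1 => [|j /= /eqP jl]; last by move: (ltn_ord j); rewrite jl; lia.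
by rewrite /isrun [(l <= m)%N]leqNgt lm andbF.
Qed.

Hypotheses (hk1 : (1 <= k1)%N) (hk2 : (1 <= k2)%N).

Lemma isrun_true j w t : r j w -> (t == 0)%N || (k1 < t <= k)%N ->
  w (j.-1 + t)%N = true.
Proof. by move=> rj ht; rewrite (isrun_at rj) ?ht //; lia. Qed.

Lemma isrun_false j w t : r j w -> (1 <= t <= k1)%N || (t == k.+1) ->
  w (j.-1 + t)%N = false.
Proof.
move=> rj ht; rewrite (isrun_at rj); last lia.
by apply/negbTE; rewrite negb_or; lia.
Qed.

Lemma isrun_gap i j w : r i w -> r j w -> (i < j)%N ->
  j = (i + k)%N \/ (i + k + 1 < j)%N.
Proof.
move=> ri rj ij.
have i1 : (1 <= i)%N by case/andP: (ri) => /andP[].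
have [jk|] := ltnP (i + k + 1) j; first by right.
move=> jk; left; apply/eqP; apply/negPn/negP => jne.
have rj0 : w (j.-1 + 0)%N = true by exact: isrun_true rj _.
have rj1 : w (j.-1 + 1)%N = false by apply: isrun_false rj _; lia.
have [jk1|jk1] := leqP j (i + k1).
  have : w (i.-1 + (j - i))%N = false by apply: isrun_false ri _; lia.
  by rewrite (_ : (i.-1 + (j - i) = j.-1 + 0)%N) ?rj0 //; lia.
have [jlk|jlk] := ltnP j (i + k).
  have : w (i.-1 + (j - i).+1)%N = true by apply: isrun_true ri _; lia.
  by rewrite (_ : (i.-1 + (j - i).+1 = j.-1 + 1)%N) ?rj1 //; lia.
have : w (i.-1 + (j - i))%N = false by apply: isrun_false ri _; lia.
by rewrite (_ : (i.-1 + (j - i) = j.-1 + 0)%N) ?rj0 //; lia.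
Qed.

(** Two overlapping occurrences share exactly the letters 1 0. *)
Lemma isrun_compat (i j : nat) w : i != j -> r i w -> r j w -> compat i j.
Proof.
move=> ij ri rj; rewrite /compat /near /adj.
case: (ltngtP i j) ij => // ij _.
  by case: (isrun_gap ri rj ij); lia.
by case: (isrun_gap rj ri ij); lia.
Qed.

End Runs.

(** * Moments of the run indicators *)

Lemma prod_nseq (R : comPzSemiRingType) (T : Type) (c : T) (F : T -> R) n :
  \prod_(b <- nseq n c) F b = F c ^+ n.
Proof. by elim: n => [|n IH] /=; rewrite ?big_nil // big_cons IH exprS. Qed.

Lemma prod_core (R : realType) (p : R) k1 k2 :
  \prod_(b <- core_word k1 k2) bweight p b = a_run k1 k2 p.
Proof. by rewrite big_cat /= !prod_nseq. Qed.

Lemma ler_sum_weight (R : realFieldType) m (C b : pred nat) (F : nat -> R) B c :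
  0 <= c -> (\sum_(j < m.+1) (b j : nat) <= B)%N ->
  (forall j, C j -> F j <= (b j : nat)%:R * c) ->
  \sum_(j < m.+1 | C j) F j <= B%:R * c.
Proof.
move=> c0 bB Fb; apply: le_trans (_ : _ <= \sum_(j < m.+1) (b j : nat)%:R * c) _.
  rewrite big_mkcond; apply: ler_sum => j _.
  by case: (boolP (C j)) => [/Fb //|_]; rewrite mulr_ge0.
by rewrite -mulr_suml -natr_sum ler_wpM2r // (ler_nat R).
Qed.

Section RunMoments.
Variables (R : realType) (p : R) (k1 k2 m n : nat).
Hypotheses (hk1 : (1 <= k1)%N) (hk2 : (1 <= k2)%N) (hp : 0 < p < 1).
Hypothesis hmn : (m + (k1 + k2) <= n)%N.
Let k := (k1 + k2)%N.
Let a : R := a_run k1 k2 p.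
Let hp' : 0 <= p <= 1.
Proof. by case/andP: hp => /ltW -> /ltW ->. Qed.
Local Notation E g := (flipE p (iota 1 n) g (fun=> true)).
Local Notation r := (isrun k1 k2 m).
Local Notation cnt := (run_cnt k1 k2 m).
Local Notation near := (near k1 k2).
Local Notation adj := (adj k1 k2).
Local Notation compat := (compat k1 k2).
Local Notation block := (block k1 k2).
Local Notation core j := (fun w => (word w j (core_word k1 k2))%:R : R).

Lemma a_gt0 : 0 < a.
Proof. by case/andP: hp => p0 p1; rewrite mulr_gt0 // exprn_gt0 // subr_gt0. Qed.

Lemma E_core_mul i g : (1 <= i <= m)%N ->
  reads [pred t | ~~ (i <= t < i + k)%N] g ->
  E (fun w => core i w * g w) = a * E g.
Proof.
move=> im Hg.
rewrite (@flipEM _ _ [pred t | (i <= t < i + k)%N]) //; last first.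
  apply: (reads_comp (fun b : bool => b%:R)).
  by have := @reads_word i (core_word k1 k2); rewrite size_core.
rewrite flipE_word ?iota_uniq ?prod_core // => t.
by rewrite size_core mem_iota; lia.
Qed.

Definition apart (i j : nat) : bool := (i + k <= j)%N || (j + k <= i)%N.

Lemma apart_block i j t : apart i j -> (j <= t < j + k)%N -> ~~ (i <= t < i + k)%N.
Proof. by rewrite /apart; lia. Qed.

Lemma reads_core j :
  reads [pred t | (j <= t < j + k)%N] (core j).
Proof.
apply: (reads_comp (fun b : bool => b%:R)).
by have := @reads_word j (core_word k1 k2); rewrite size_core.
Qed.

Lemma run_le_core j w : (r j w)%:R <= core j w.
Proof. by case: (boolP (r j w)) => [/isrun_core ->|_] //; case: word. Qed.

Lemma compat_apart (i j : nat) : i != j -> compat i j -> apart i j.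
Proof. by rewrite /compat /near /adj /apart /k; lia. Qed.

(** A run contains its inner word, whose k letters have probability a. *)
Lemma E_run j : E (fun w => (r j w)%:R) <= a.
Proof.
case: (boolP (1 <= j <= m)%N) => [jm|jm]; last first.
  rewrite (@eq_flipE _ _ _ _ (fun=> 0)) ?flipE_cst ?(ltW a_gt0) // => w.
  by rewrite /isrun (negbTE jm).
apply: le_trans (ler_flipE hp' _ _ (run_le_core j)) _.
rewrite (@eq_flipE _ _ _ _ (fun w => core j w * 1)) => [|w]; last by rewrite mulr1.
by rewrite E_core_mul // flipE_cst mulr1.
Qed.

Lemma E_run_ge0 j : 0 <= E (fun w => (r j w)%:R).
Proof. exact: flipE_ge0. Qed.

Lemma isrun_out j w : ~~ (1 <= j <= m)%N -> r j w = false.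
Proof. by rewrite /isrun => /negbTE ->. Qed.

Lemma E_run2 (i j : nat) : i != j ->
  E (fun w => (r i w)%:R * (r j w)%:R) <= (compat i j)%:R * a ^+ 2.
Proof.
move=> ij; have a0 := ltW a_gt0.
have zero : (forall w, r i w && r j w = false) ->
    E (fun w => (r i w)%:R * (r j w)%:R) <= (compat i j)%:R * a ^+ 2.
  move=> H; rewrite (@eq_flipE _ _ _ _ (fun=> 0)) ?flipE_cst.
    by rewrite mulr_ge0 // exprn_ge0.
  by move=> w; rewrite -natrM mulnb H.
case: (boolP (1 <= i <= m)%N) => [im|im]; last by apply: zero => w; rewrite isrun_out.
case: (boolP (1 <= j <= m)%N) => [jm|jm].
  case: (boolP (compat i j)) => [cij|cij] in zero *; last first.
    apply: zero => w; apply/negbTE; apply/negP => /andP[ri rj].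
    by move: cij; rewrite (isrun_compat hk1 hk2 ij ri rj).
  rewrite mul1r.
  apply: le_trans (_ : _ <= E (fun w => core i w * (core j w * 1))) _.
    by apply: ler_flipE => // w; rewrite mulr1 ler_pM ?run_le_core.
  rewrite E_core_mul //.
    by rewrite E_core_mul // flipE_cst mulr1 expr2.
  apply: reads_op; last exact: reads_cst.
  apply: reads_sub (@reads_core j) => t.
  exact: apart_block (compat_apart ij cij).
by apply: zero => w; rewrite andbC isrun_out.
Qed.

Lemma E_run3 (l i j : nat) : l != i -> l != j -> i != j ->
  E (fun w => (r l w)%:R * ((r i w)%:R * (r j w)%:R)) <=
  ([&& compat l i, compat l j & compat i j])%:R * a ^+ 3.
Proof.
move=> li lj ij; have a0 := ltW a_gt0.
set c := [&& _, _ & _].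
have zero : (forall w, [&& r l w, r i w & r j w] = false) ->
    E (fun w => (r l w)%:R * ((r i w)%:R * (r j w)%:R)) <= c%:R * a ^+ 3.
  move=> H; rewrite (@eq_flipE _ _ _ _ (fun=> 0)) ?flipE_cst.
    by rewrite mulr_ge0 // exprn_ge0.
  by move=> w; rewrite -!natrM !mulnb H.
case: (boolP (1 <= l <= m)%N) => [lm|lm]; last by apply: zero => w; rewrite isrun_out.
case: (boolP (1 <= i <= m)%N) => [im|im]; last first.
  by apply: zero => w; rewrite (isrun_out _ im) andbF.
case: (boolP (1 <= j <= m)%N) => [jm|jm]; last first.
  by apply: zero => w; rewrite (isrun_out _ jm) !andbF.
case/orP: (orbN c) => [/and3P[cli clj cij]|cij]; last first.
  apply: zero => w; apply/negbTE; apply/negP => /and3P[rl ri rj].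
  by move: cij; rewrite /c !(@isrun_compat _ _ m hk1 hk2 _ _ w).
rewrite /c cli clj cij mul1r.
apply: le_trans (_ : _ <= E (fun w => core l w * (core i w * (core j w * 1)))) _.
  by apply: ler_flipE => // w; rewrite mulr1 !ler_pM ?mulr_ge0 ?run_le_core.
rewrite E_core_mul //.
  rewrite E_core_mul //; last first.
    apply: reads_op; last exact: reads_cst.
  apply: reads_sub (@reads_core j) => t.
    exact: apart_block (compat_apart ij cij).
  by rewrite E_core_mul // flipE_cst mulr1 exprS expr2.
apply: reads_op.
  apply: reads_sub (@reads_core i) => t; exact: apart_block (compat_apart li cli).
apply: reads_op; last exact: reads_cst.
  apply: reads_sub (@reads_core j) => t.
exact: apart_block (compat_apart lj clj).
Qed.

Lemma E_run_interior j : (2 <= j <= m)%N ->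
  E (fun w => (r j w)%:R) = p * (1 - p) * a.
Proof.
move=> jm; rewrite (@eq_flipE _ _ _ _ (fun w => (word w j.-1 (run_word k1 k2))%:R)).
  rewrite flipE_word ?iota_uniq // => [|t].
    rewrite /run_word big_cons -cats1 big_cat /= prod_core big_seq1 /bweight.
    by rewrite -/a; ring.
  by rewrite size_run mem_iota; lia.
by move=> w; rewrite /isrun; case: (boolP (1 <= j <= m)%N) => //; lia.
Qed.

Lemma E_run_quarter j : (j != 1)%N -> E (fun w => (r j w)%:R) <= a / 4.
Proof.
move=> j1; have a0 := a_gt0.
case: (boolP (2 <= j <= m)%N) => [jm|jm].
  rewrite E_run_interior // mulrC ler_pM2l //.
  by have := sqr_ge0 (p - 1 / 2); nra.
rewrite (@eq_flipE _ _ _ _ (fun=> 0)) ?flipE_cst; last first.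
  by move=> w; rewrite isrun_out //; lia.
by rewrite divr_ge0 // ltW.
Qed.

(** The letter before the first place is not random; every other place has
    probability p q a <= a / 4, so that only one term of the sum costs a. *)
Lemma sum_E_run (C : pred nat) c : (\sum_(j < m.+1) (C j : nat) <= c)%N ->
  \sum_(j < m.+1 | C j) E (fun w => (r j w)%:R) <= a * (c%:R + 3) / 4.
Proof.
move=> Cc; have a0 := ltW a_gt0.
have step (j : 'I_m.+1) : true -> (if C j then E (fun w => (r j w)%:R) else 0) <=
    (C j : nat)%:R * (a / 4) + ((1 <= j < 2)%N : nat)%:R * (3 * a / 4).
  have a3 : 0 <= 3 * a / 4 by lra.
  move=> _; case: (C j); last by rewrite mul0r add0r mulr_ge0 ?ler0n.
  case: (eqVneq (j : nat) 1%N) => [->|j1].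
    by apply: le_trans (E_run 1) _; rewrite /=; lra.
  apply: le_trans (E_run_quarter j1) _.
  by rewrite mul1r lerDl mulr_ge0 ?ler0n.
rewrite big_mkcond; apply: le_trans (ler_sum _ step) _.
rewrite big_split /= -!mulr_suml -!natr_sum.
have h1 : ((\sum_(i < m.+1) (C i : nat))%N%:R : R) <= c%:R by rewrite (ler_nat R).
have h2 : ((\sum_(i < m.+1) ((1 <= i < 2)%N : nat))%N%:R : R) <= 1.
  by have := sum_interval_le m 1 2; rewrite -(ler_nat R).
nra.
Qed.

Lemma E_cnt g (C : pred nat) :
  E (fun w => g w * (cnt C w)%:R) =
  \sum_(j < m.+1 | C j) E (fun w => g w * (r j w)%:R).
Proof.
rewrite -flipE_sum; apply: eq_flipE => w.
by rewrite /run_cnt natr_sum mulr_sumr.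
Qed.

Lemma E_cnt1 (C : pred nat) :
  E (fun w => (cnt C w)%:R) = \sum_(j < m.+1 | C j) E (fun w => (r j w)%:R).
Proof. by rewrite -flipE_sum; apply: eq_flipE => w; rewrite natr_sum. Qed.

Lemma E_cnt_le (C : pred nat) c : (\sum_(j < m.+1) (C j : nat) <= c)%N ->
  E (fun w => (cnt C w)%:R) <= a * (c%:R + 3) / 4.
Proof. by move=> Cc; rewrite E_cnt1; exact: sum_E_run. Qed.

Local Notation S := (cnt predT).
Local Notation pr j := (E (fun w => (r j w)%:R)).

(** * Expansions of the run count *)

Section Decoupling.
Variables (h : nat -> R) (D2 : R).
Hypothesis hD : forall i, `|h i.+2 - 2 * h i.+1 + h i| <= D2.
Let dh i := h i.+1 - h i.

Lemma D2_ge0 : 0 <= D2. Proof. exact: le_trans (hD 0). Qed.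

Lemma diff_lipschitz i x : `|dh (i + x)%N - dh i| <= D2 * x%:R.
Proof.
elim: x => [|x IH]; first by rewrite addn0 subrr normr0 mulr0.
have := hD (i + x); rewrite addnS /dh.
have -> : h (i + x).+2 - h (i + x).+1 - (h i.+1 - h i) =
   (h (i + x).+2 - 2 * h (i + x).+1 + h (i + x)%N) + (dh (i + x)%N - dh i).
  by rewrite /dh; ring.
move=> H; apply: le_trans (ler_normD _ _) _.
by rewrite -[x.+1%:R]natr1 mulrDr mulr1 addrC; exact: lerD.
Qed.

Lemma taylor2 i x :
  `|h (i + x)%N - h i - x%:R * dh i| <= D2 * (x%:R * (x%:R - 1) / 2).
Proof.
elim: x => [|x IH]; first by rewrite addn0 subrr mul0r subrr normr0 !mul0r mulr0.
have -> : h (i + x.+1)%N - h i - x.+1%:R * dh i =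
    (h (i + x)%N - h i - x%:R * dh i) + (dh (i + x)%N - dh i).
  by rewrite addnS -[x.+1%:R]natr1 /dh; ring.
apply: le_trans (ler_normD _ _) _.
apply: le_trans (lerD IH (diff_lipschitz i x)) _.
by rewrite -[x.+1%:R]natr1 le_eqVlt; apply/orP; left; apply/eqP; field.
Qed.

(** Removing from the count the places that Z can see makes the two factors
    independent; the price is one second difference per removed run. *)
Lemma decouple (Z : (nat -> bool) -> R) (D C C' : pred nat) :
  (forall w, 0 <= Z w) -> reads D Z ->
  (forall j i, C j -> block j i -> ~~ D i) -> (forall j, C j -> C' j) ->
  `|E (fun w => Z w * dh (cnt C' w)) - E Z * E (fun w => dh (S w))| <=
  D2 * (E (fun w => Z w * (cnt [pred j | C' j && ~~ C j] w)%:R) +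
        E Z * E (fun w => (cnt [pred j | ~~ C j] w)%:R)).
Proof.
move=> Z0 DZ CD CC'.
have indep : E (fun w => Z w * dh (cnt C w)) = E Z * E (fun w => dh (cnt C w)).
  by apply: (@flipEM _ _ D) => //; apply: (reads_comp dh); exact: reads_cnt.
have -> : E (fun w => Z w * dh (cnt C' w)) - E Z * E (fun w => dh (S w)) =
   E (fun w => Z w * (dh (cnt C' w) - dh (cnt C w))) +
   E Z * - E (fun w => dh (S w) - dh (cnt C w)).
  have -> : E (fun w => Z w * (dh (cnt C' w) - dh (cnt C w))) =
      E (fun w => Z w * dh (cnt C' w)) - E (fun w => Z w * dh (cnt C w)).
    by rewrite -flipEB; apply: eq_flipE => w; rewrite mulrBr.
  by rewrite flipEB indep; ring.
apply: le_trans (ler_normD _ _) _; rewrite mulrDr; apply: lerD.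
  rewrite -flipEZ; apply: ler_norm_flipE => // w.
  rewrite normrM (ger0_norm (Z0 w)) mulrCA; apply: ler_wpM2l => //.
  rewrite (cntID k1 k2 m C C').
  rewrite (@eq_cnt _ _ _ [pred j | C' j && C j] C) => [|j].
    exact: diff_lipschitz.
  by rewrite /=; case: (boolP (C j)) => [/CC' ->|]; rewrite ?andbF.
have EZ0 : 0 <= E Z by exact: flipE_ge0.
rewrite normrM (ger0_norm EZ0) mulrCA; apply: ler_wpM2l => //.
rewrite normrN -flipEZ; apply: ler_norm_flipE => // w.
by rewrite (cntID k1 k2 m C predT); exact: diff_lipschitz.
Qed.

End Decoupling.
Lemma near_compat l j : near l j -> compat l j = adj l j.
Proof. by rewrite /compat => ->. Qed.

Lemma E_run2_near (l j : nat) : j != l -> near l j ->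
  E (fun w => (r l w)%:R * (r j w)%:R) <= (adj l j : nat)%:R * a ^+ 2.
Proof.
by move=> jl nlj; rewrite -near_compat //; apply: E_run2; rewrite eq_sym.
Qed.

Lemma E_run_cnt_near l :
  E (fun w => (r l w)%:R * (cnt [pred j | (j != l) && near l j] w)%:R) <=
  2 * a ^+ 2.
Proof.
rewrite E_cnt; apply: (@ler_sum_weight _ m [pred j | (j != l) && near l j] (adj l)
  (fun j => E (fun w => (r l w)%:R * (r j w)%:R))) => [||j /= /andP[jl nlj]].
- by rewrite exprn_ge0 // (ltW a_gt0).
- exact: sum_adj_le.
- exact: E_run2_near.
Qed.

Lemma E_run_cnt_far l j : near l j ->
  E (fun w => (r j w)%:R * (cnt [pred i | ~~ near l i && near j i] w)%:R) <=
  2 * a ^+ 2.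
Proof.
move=> nlj; rewrite E_cnt.
apply: (@ler_sum_weight _ m [pred i | ~~ near l i && near j i] (adj j)
  (fun i => E (fun w => (r j w)%:R * (r i w)%:R))) => [||i /= /andP[fli nji]].
- by rewrite exprn_ge0 // (ltW a_gt0).
- exact: sum_adj_le.
- by apply: E_run2_near => //; apply: contraNneq fli => ->.
Qed.

Lemma E_run2_cnt_far (l j : nat) : j != l -> near l j ->
  E (fun w => ((r l w)%:R * (r j w)%:R) *
              (cnt [pred i | ~~ near l i && near j i] w)%:R) <=
  (adj l j : nat)%:R * (2 * a ^+ 3).
Proof.
move=> jl nlj; have a3 : 0 <= a ^+ 3 by rewrite exprn_ge0 // (ltW a_gt0).
rewrite E_cnt [leRHS]mulrCA.
apply: (@ler_sum_weight _ m [pred i | ~~ near l i && near j i] (adj j)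
  (fun i => E (fun w => (r l w)%:R * (r j w)%:R * (r i w)%:R))) => [||i /= /andP[fli nji]].
- by rewrite mulr_ge0.
- exact: sum_adj_le.
rewrite (@eq_flipE _ _ _ _
  (fun w => (r l w)%:R * ((r j w)%:R * (r i w)%:R))) => [|w]; last by rewrite mulrA.
have il : l != i by apply: contraNneq fli => <-; exact: near_refl.
have ij : j != i by apply: contraNneq fli => <-.
apply: le_trans (E_run3 _ il ij) _; first by rewrite eq_sym.
rewrite (near_compat nlj) (near_compat nji) -/a; move: a3 => /=.
by case: adj; case: adj; case: compat => /=; lra.
Qed.

Lemma cnt_sqr (C : pred nat) w :
  (cnt C w)%:R * ((cnt C w)%:R - 1) =
  \sum_(i < m.+1 | C i) \sum_(j < m.+1 | C j && (j != i))
     (r i w)%:R * (r j w)%:R :> R.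
Proof.
have cE : (cnt C w)%:R = \sum_(i < m.+1 | C i) (r i w)%:R :> R by rewrite natr_sum.
rewrite mulrBr mulr1 {1 3}cE mulr_suml -sumrB.
apply: eq_bigr => i Ci; rewrite cE (bigD1 i) //= mulrDr mulr_sumr.
by rewrite -natrM mulnb andbb addrC addKr.
Qed.

Lemma E_run_cnt_near_sqr l :
  E (fun w => (r l w)%:R * ((cnt [pred j | (j != l) && near l j] w)%:R *
               ((cnt [pred j | (j != l) && near l j] w)%:R - 1) / 2)) <=
  2 * a ^+ 3.
Proof.
have a3 : 0 <= a ^+ 3 by rewrite exprn_ge0 // (ltW a_gt0).
rewrite (@eq_flipE _ _ _ _ (fun w => 2^-1 *
    \sum_(i < m.+1 | (i != l :> nat) && near l i)
    \sum_(j < m.+1 | ((j != l :> nat) && near l j) && (j != i))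
     (r l w)%:R * ((r i w)%:R * (r j w)%:R))); last first.
  move=> w; rewrite cnt_sqr mulrA mulrC; congr (_ * _).
  by rewrite mulr_sumr; apply: eq_bigr => i _; rewrite mulr_sumr.
rewrite flipEZ flipE_sum.
have -> : 2 * a ^+ 3 = 2^-1 * (2 * (2 * a ^+ 3)) by field.
rewrite ler_wpM2l ?invr_ge0 //.
apply: (@ler_sum_weight _ m [pred i | (i != l) && near l i] (adj l)
  (fun i => E (fun w => \sum_(j < m.+1 | ((j != l :> nat) && near l j) && (j != i :> nat))
     (r l w)%:R * ((r i w)%:R * (r j w)%:R)))) => [||i /= /andP[il nli]].
- by rewrite mulr_ge0.
- exact: sum_adj_le.
rewrite flipE_sum [leRHS]mulrCA.
apply: (@ler_sum_weight _ m [pred j | ((j != l) && near l j) && (j != i)] (adj l)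
  (fun j => E (fun w => (r l w)%:R * ((r i w)%:R * (r j w)%:R)))) =>
  [||j /= /andP[/andP[jl nlj] ji]].
- by rewrite mulr_ge0.
- exact: sum_adj_le.
apply: le_trans (E_run3 _ _ _) _; rewrite 1?eq_sym //.
rewrite (near_compat nli) (near_compat nlj) -/a; move: a3 => /=.
by case: adj; case: adj; case: compat => /=; lra.
Qed.

Lemma E_cnt_near_sqr l :
  E (fun w => (cnt (near l) w)%:R * ((cnt (near l) w)%:R - 1) / 2) <=
  (2 * k%:R + 3) ^+ 2 / 2 * a ^+ 2.
Proof.
have a2 : 0 <= a ^+ 2 by rewrite exprn_ge0 // (ltW a_gt0).
rewrite (@eq_flipE _ _ _ _ (fun w => 2^-1 *
    \sum_(i < m.+1 | near l i) \sum_(j < m.+1 | near l j && (j != i))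
     (r i w)%:R * (r j w)%:R)) => [|w]; last by rewrite cnt_sqr mulrC.
rewrite flipEZ flipE_sum.
have -> : (2 * k%:R + 3) ^+ 2 / 2 * a ^+ 2 =
  2^-1 * ((2 * k + 3)%N%:R * ((2 * k + 3)%N%:R * a ^+ 2)).
  by rewrite natrD natrM; field.
rewrite ler_wpM2l ?invr_ge0 //.
apply: (@ler_sum_weight _ m (near l) (near l)
  (fun i => E (fun w => \sum_(j < m.+1 | near l j && (j != i :> nat))
     ((r i w)%:R * (r j w)%:R)))) => [||i nli].
- by rewrite mulr_ge0.
- exact: sum_near_le.
rewrite flipE_sum nli mul1r.
apply: (@ler_sum_weight _ m [pred j | near l j && (j != i)] (near l)
  (fun j => E (fun w => (r i w)%:R * (r j w)%:R))) => [||j /= /andP[nlj ji]].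
- by [].
- exact: sum_near_le.
rewrite nlj mul1r; apply: le_trans (E_run2 _) _; first by rewrite eq_sym.
by case: compat; rewrite ?mul1r ?mul0r.
Qed.

Lemma E_cnt_near_le l : E (fun w => (cnt (near l) w)%:R) <= a * (k%:R + 3) / 2.
Proof.
apply: le_trans (E_cnt_le (sum_near_le k1 k2 m l)) _.
by rewrite -/k natrD natrM le_eqVlt; apply/orP; left; apply/eqP; field.
Qed.

Lemma E_cnt_near2_le l j (C : pred nat) :
  (forall i, C i -> near l i || near j i) ->
  E (fun w => (cnt C w)%:R) <= a * (4 * k%:R + 9) / 4.
Proof.
move=> HC; have -> : 4 * k%:R + 9 = (4 * k + 6)%N%:R + 3 :> R.
  by rewrite natrD natrM; ring.
apply: E_cnt_le; apply: leq_trans (sum_near2_le k1 k2 m l j).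
by apply: leq_sum => i _; apply: leq_bool; exact: HC.
Qed.

Section Expansion.
Variables (h : nat -> R) (D2 : R).
Hypothesis hD : forall i, `|h i.+2 - 2 * h i.+1 + h i| <= D2.
Let dh i := h i.+1 - h i.
Let D20 : 0 <= D2 := D2_ge0 hD.

(** The occurrences near l that accompany an occurrence at l have expectation at
    most 2 a ^ 2; without it they have expectation of the order of a. *)
Lemma decouple_run l :
  `|E (fun w => (r l w)%:R * dh (cnt (predC1 l) w)) -
    pr l * E (fun w => dh (S w))| <= D2 * (a ^+ 2 * (k%:R + 7) / 2).
Proof.
apply: le_trans (@decouple _ _ hD _ (block l) [pred j | ~~ near l j] (predC1 l) _ _ _ _) _.
- by [].
- exact: reads_isrunR.
- by move=> j i /= /far_block; apply.
- by move=> j /=; apply: contraNneq => ->; exact: near_refl.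
apply: ler_wpM2l => //.
rewrite (@eq_flipE _ _ _ _
  (fun w => (r l w)%:R * (cnt [pred j | (j != l) && near l j] w)%:R)); last first.
  by move=> w; congr (_ * _%:R); apply: eq_cnt => j /=; rewrite negbK.
rewrite (@eq_flipE _ _ _ (fun w => (cnt [pred j | ~~ ~~ near l j] w)%:R)
  (fun w => (cnt (near l) w)%:R)); last first.
  by move=> w; congr (_%:R); apply: eq_cnt => j /=; rewrite negbK.
apply: le_trans (lerD (E_run_cnt_near l) (ler_pM _ _ (E_run l) (E_cnt_near_le l))) _.
- exact: E_run_ge0.
- exact: flipE_ge0.
by rewrite -/a le_eqVlt; apply/orP; left; apply/eqP; field.
Qed.

(** The four summands bound, in units of a ^ 3 times a second difference, the
    errors of the four steps in the proof of [expand_run]. *)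
Definition kappa1 : R :=
  2 + (2 * k%:R + 3) ^+ 2 / 2 + (4 * k%:R + 6 + (k%:R + 3) * (4 * k%:R + 9) / 8)
  + (4 + (4 * k%:R + 9) / 2).

(** Expanding both h (S) and h (S - I_l) around the count W of the places far
    from l cancels the terms in h (W); the coefficients of the first differences
    add up, over l, to the mean minus the variance. *)
Lemma expand_run l :
  `|pr l * E (fun w => h (S w)) - E (fun w => (r l w)%:R * h (cnt (predC1 l) w)) -
    (\sum_(j < m.+1 | near l j) pr l * pr j -
     \sum_(j < m.+1 | (j != l :> nat) && near l j)
        E (fun w => (r l w)%:R * (r j w)%:R)) * E (fun w => dh (S w))| <=
  D2 * (kappa1 * a ^+ 3).
Proof.
have a0 : 0 <= a := ltW a_gt0.
pose W := cnt [pred j | ~~ near l j]; pose Y := cnt (near l).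
pose X := cnt [pred j | (j != l) && near l j].
have TWX w : cnt (predC1 l) w = (W w + X w)%N.
  rewrite (cntID _ _ _ [pred j | ~~ near l j]); congr (_ + _)%N; apply: eq_cnt => j /=.
    by rewrite andbC; case: (boolP (near l j)) => //= f; apply: contraNneq f => ->;
      exact: near_refl.
  by rewrite negbK.
have SWY w : S w = (W w + Y w)%N.
  rewrite (cntID _ _ _ [pred j | ~~ near l j]); congr (_ + _)%N; apply: eq_cnt => j /=.
  by rewrite negbK.
have readsW g : reads (predC (block l)) (fun w => g (W w) : R).
  apply: (reads_comp g); apply: reads_cnt => j i /=; exact: far_block.
(* second-order Taylor expansions of h at W, given and not given I_l *)
have e1 : `|E (fun w => (r l w)%:R * h (cnt (predC1 l) w)) -
   pr l * E (fun w => h (W w)) - E (fun w => (r l w)%:R * ((X w)%:R * dh (W w)))| <=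
   D2 * (2 * a ^+ 3).
  have <- : E (fun w => (r l w)%:R * h (W w)) = pr l * E (fun w => h (W w)).
    by apply: (@flipEM _ _ (block l)) => //; exact: reads_isrunR.
  rewrite -!flipEB; apply: le_trans (ler_wpM2l D20 (E_run_cnt_near_sqr l)).
  rewrite -flipEZ; apply: ler_norm_flipE => // w.
  rewrite -!mulrBr normrM [`|_%:R|]ger0_norm // mulrCA ler_wpM2l // TWX.
  exact: (taylor2 hD).
have e2 : `|E (fun w => h (S w)) - E (fun w => h (W w)) -
    E (fun w => (Y w)%:R * dh (W w))| <= D2 * ((2 * k%:R + 3) ^+ 2 / 2 * a ^+ 2).
  rewrite -!flipEB; apply: le_trans (ler_wpM2l D20 (E_cnt_near_sqr l)).
  rewrite -flipEZ; apply: ler_norm_flipE => // w.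
  by rewrite SWY; exact: (taylor2 hD).
have k90 : 0 <= a * (4 * k%:R + 9) / 4.
  by apply: divr_ge0 => //; apply: mulr_ge0 => //; apply: addr_ge0 => //; apply: mulr_ge0.
have far2 j (C : pred nat) : (forall i, C i -> near l i || near j i) ->
   E (fun w => (cnt C w)%:R) <= a * (4 * k%:R + 9) / 4.
  exact: E_cnt_near2_le.
have dec Z j : (forall w, 0 <= Z w) ->
    reads [pred i | block l i || block j i] Z ->
    `|E (fun w => Z w * dh (W w)) - E Z * E (fun w => dh (S w))| <=
    D2 * (E (fun w => Z w * (cnt [pred i | ~~ near l i && near j i] w)%:R) +
          E Z * (a * (4 * k%:R + 9) / 4)).
  move=> Z0 DZ.
  apply: le_trans (@decouple _ _ hD Z _ [pred i | ~~ near l i && ~~ near j i]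
    [pred i | ~~ near l i] Z0 DZ _ _) _.
  - move=> i t /= /andP[fl fj] bt.
    by rewrite negb_or (far_block fl bt) (far_block fj bt).
  - by move=> i /= /andP[].
  apply: ler_wpM2l => //; apply: lerD.
    rewrite le_eqVlt; apply/orP; left; apply/eqP; apply: eq_flipE => w.
    by congr (_ * _%:R); apply: eq_cnt => i /=; case: near; case: near.
  apply: ler_wpM2l; first exact: flipE_ge0.
  by apply: (far2 j) => i /=; rewrite negb_and !negbK.
(* in the first-order terms each product of indicators is decoupled in turn *)
have e3 : `|E (fun w => (Y w)%:R * dh (W w)) -
    (\sum_(j < m.+1 | near l j) pr j) * E (fun w => dh (S w))| <=
    D2 * ((4 * k%:R + 6 + (k%:R + 3) * (4 * k%:R + 9) / 8) * a ^+ 2).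
  have -> : E (fun w => (Y w)%:R * dh (W w)) =
      \sum_(j < m.+1 | near l j) E (fun w => (r j w)%:R * dh (W w)).
    by rewrite -flipE_sum; apply: eq_flipE => w; rewrite natr_sum mulr_suml.
  rewrite mulr_suml -sumrB; apply: le_trans (ler_norm_sum _ _ _) _.
  apply: le_trans (_ : _ <= \sum_(j < m.+1 | near l j)
     D2 * (2 * a ^+ 2 + pr j * (a * (4 * k%:R + 9) / 4))) _.
    apply: ler_sum => j nlj; apply: le_trans (dec (fun w => (r j w)%:R) j _ _) _.
    - by [].
    - by apply: reads_sub (@reads_isrunR k1 k2 m R j) => i /= ->; rewrite orbT.
    by rewrite ler_wpM2l // lerD2r; exact: E_run_cnt_far.
  have sY := E_cnt_near_le l; rewrite E_cnt1 in sY.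
  rewrite -mulr_sumr ler_wpM2l // big_split /= -[X in _ + X]mulr_suml.
  have h1 : \sum_(j < m.+1 | near l j) 2 * a ^+ 2 <= (2 * k + 3)%N%:R * (2 * a ^+ 2).
    apply: (@ler_sum_weight _ m (near l) (near l) (fun=> 2 * a ^+ 2)).
    - by rewrite mulr_ge0 // exprn_ge0.
    - exact: sum_near_le.
    - by move=> j ->; rewrite mul1r.
  apply: le_trans (lerD h1 (ler_wpM2r _ sY)) _.
    exact: k90.
  by rewrite -/a natrD natrM le_eqVlt; apply/orP; left; apply/eqP; field.
have e4 : `|E (fun w => (r l w)%:R * ((X w)%:R * dh (W w))) -
    (\sum_(j < m.+1 | (j != l :> nat) && near l j)
        E (fun w => (r l w)%:R * (r j w)%:R)) * E (fun w => dh (S w))| <=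
    D2 * ((4 + (4 * k%:R + 9) / 2) * a ^+ 3).
  have -> : E (fun w => (r l w)%:R * ((X w)%:R * dh (W w))) =
      \sum_(j < m.+1 | (j != l :> nat) && near l j)
        E (fun w => ((r l w)%:R * (r j w)%:R) * dh (W w)).
    rewrite -flipE_sum; apply: eq_flipE => w; rewrite natr_sum mulr_suml mulr_sumr.
    by apply: eq_bigr => j _; rewrite mulrA.
  rewrite mulr_suml -sumrB; apply: le_trans (ler_norm_sum _ _ _) _.
  apply: le_trans (_ : _ <=
      2%:R * (D2 * (2 * a ^+ 3 + a ^+ 2 * (a * (4 * k%:R + 9) / 4)))) _; last first.
    by rewrite le_eqVlt; apply/orP; left; apply/eqP; field.
  apply: (@ler_sum_weight _ m [pred j | (j != l) && near l j] (adj l) (fun j =>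
     `|E (fun w => ((r l w)%:R * (r j w)%:R) * dh (W w)) -
       E (fun w => (r l w)%:R * (r j w)%:R) * E (fun w => dh (S w))|)).
  - by rewrite mulr_ge0 // addr_ge0 // mulr_ge0 // exprn_ge0.
  - exact: sum_adj_le.
  move=> j /= /andP[jl nlj].
  apply: le_trans (dec (fun w => (r l w)%:R * (r j w)%:R) j _ _) _.
  - by move=> w; rewrite mulr_ge0.
  - apply: reads_op; first by apply: reads_sub (@reads_isrunR k1 k2 m R l) => i /= ->.
    by apply: reads_sub (@reads_isrunR k1 k2 m R j) => i /= ->; rewrite orbT.
  rewrite [leRHS]mulrCA ler_wpM2l // [leRHS]mulrDr; apply: lerD; first exact: E_run2_cnt_far.
  by rewrite [leRHS]mulrA ler_wpM2r //; exact: E_run2_near.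
set A := E (fun w => h (S w)) in e2 *; set B := E (fun w => h (W w)) in e1 e2.
set U := E _ in e1 *; set V := E (fun w => _ * (_ * _)) in e1 e4.
set G := E (fun w => dh (S w)) in e3 e4 *.
set Q := E (fun w => (Y w)%:R * _) in e2 e3.
set s1 := \sum_(j < _ | _) _ in e3; set s2 := \sum_(j < _ | _) _ in e4 *.
rewrite -mulr_sumr -/s1.
have -> : pr l * A - U - (pr l * s1 - s2) * G =
  pr l * (A - B - Q) + pr l * (Q - s1 * G) - (U - pr l * B - V) - (V - s2 * G) by ring.
have p0 : 0 <= pr l by exact: E_run_ge0.
have pa : pr l <= a by exact: E_run.
have t2 : `|pr l * (A - B - Q)| <= D2 * ((2 * k%:R + 3) ^+ 2 / 2 * a ^+ 3).
  rewrite normrM (ger0_norm p0); apply: le_trans (ler_pM p0 _ pa e2) _ => //.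
  by rewrite le_eqVlt; apply/orP; left; apply/eqP; field.
have t3 : `|pr l * (Q - s1 * G)| <=
  D2 * ((4 * k%:R + 6 + (k%:R + 3) * (4 * k%:R + 9) / 8) * a ^+ 3).
  rewrite normrM (ger0_norm p0); apply: le_trans (ler_pM p0 _ pa e3) _ => //.
  by rewrite le_eqVlt; apply/orP; left; apply/eqP; field.
apply: le_trans (ler_normB _ _) _.
apply: le_trans (lerD (ler_normB _ _) e4) _.
apply: le_trans (lerD (lerD (ler_normD _ _) e1) (lexx _)) _.
apply: le_trans (lerD (lerD (lerD t2 t3) (lexx _)) (lexx _)) _.
by rewrite /kappa1 le_eqVlt; apply/orP; left; apply/eqP; field.
Qed.

End Expansion.
End RunMoments.

(** * Mean, variance and expansions of the run count *)

Definition run_law (R : realType) (p : R) (k1 k2 n j : nat) : R :=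
  flipE p (iota 1 n)
    (fun w => (run_cnt k1 k2 (n - (k1 + k2)) predT w == j)%:R) (fun=> true).

Definition lawE (R : realType) (N : nat) (s g : nat -> R) : R :=
  \sum_(j < N) g j * s j.

Definition law_mean (R : realType) (N : nat) (s : nat -> R) : R :=
  lawE N s (fun j => j%:R).

Definition law_var (R : realType) (N : nat) (s : nat -> R) : R :=
  lawE N s (fun j => j%:R ^+ 2) - law_mean N s ^+ 2.

Section RunLaw.
Variables (R : realType) (p : R) (k1 k2 n : nat).
Hypotheses (hk1 : (1 <= k1)%N) (hk2 : (1 <= k2)%N) (hp : 0 < p < 1).
Hypothesis hkn : (k1 + k2 <= n)%N.
Let k := (k1 + k2)%N.
Let m := (n - k)%N.
Let a : R := a_run k1 k2 p.
Let hmn : (m + k <= n)%N. Proof. by rewrite subnK. Qed.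
Let hp' : 0 <= p <= 1.
Proof. by case/andP: hp => /ltW -> /ltW ->. Qed.
Local Notation E g := (flipE p (iota 1 n) g (fun=> true)).
Local Notation r := (isrun k1 k2 m).
Local Notation cnt := (run_cnt k1 k2 m).
Local Notation near := (near k1 k2).
Local Notation S := (cnt predT).
Local Notation pr j := (E (fun w => (r j w)%:R)).
Local Notation s := (run_law p k1 k2 n).
Local Notation L := (lawE m.+1 s).
Local Notation mu := (law_mean m.+1 s).
Local Notation v := (law_var m.+1 s).

Lemma run_cnt_lt w : (S w < m.+1)%N.
Proof.
rewrite ltnS /run_cnt big_ord_recl isrun0 add0n.
apply: leq_trans (_ : _ <= \sum_(i < m) 1)%N _; last by rewrite sum1_card card_ord.
by apply: leq_sum => i _; exact: leq_b1.
Qed.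

Lemma lawE_run g : L g = E (fun w => g (S w)).
Proof.
rewrite (@eq_flipE _ _ _ _ (fun w => \sum_(j < m.+1) g j * (S w == j)%:R)).
  by rewrite flipE_sum; apply: eq_bigr => j _; rewrite flipEZ.
move=> w; rewrite (bigD1 (Ordinal (run_cnt_lt w))) //= eqxx mulr1 big1 ?addr0 // => j.
by rewrite -val_eqE /= eq_sym => /negbTE ->; rewrite mulr0.
Qed.

Lemma run_law_ge0 j : 0 <= s j.
Proof. exact: flipE_ge0. Qed.

Lemma sum_run_law : \sum_(j < m.+1) s j = 1.
Proof.
have := lawE_run (fun=> 1); rewrite flipE_cst => <-.
by apply: eq_bigr => j _; rewrite mul1r.
Qed.

Lemma run_meanE : mu = \sum_(l < m.+1) pr l.
Proof. by rewrite /law_mean lawE_run (E_cnt1 p k1 k2 m n predT). Qed.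

Lemma S_pred1 l w : S w = (r l w + cnt (predC1 l) w)%N.
Proof.
rewrite (cntID k1 k2 m (pred1 l)); congr (_ + _)%N.
by rewrite -(cnt_pred1 k1 k2 m); apply: eq_cnt.
Qed.

(** On I_l = 1 the other places count S - 1 runs. *)
Lemma lawE_size_bias g :
  L (fun j => j%:R * g j.-1) =
  \sum_(l < m.+1) E (fun w => (r l w)%:R * g (cnt (predC1 (l : nat)) w)).
Proof.
rewrite lawE_run -flipE_sum; apply: eq_flipE => w.
rewrite {1}/run_cnt natr_sum mulr_suml; apply: eq_bigr => l _.
by rewrite (S_pred1 l); case: (r l w) => /=; rewrite ?mul0r.
Qed.

(** Places that are not near contribute nothing to the variance. *)
Lemma run_varE : mu - v = \sum_(l < m.+1)
  (\sum_(j < m.+1 | near l j) pr l * pr j -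
   \sum_(j < m.+1 | (j != l :> nat) && near l j)
      E (fun w => (r l w)%:R * (r j w)%:R)).
Proof.
have sq : L (fun j => j%:R ^+ 2) = \sum_(l < m.+1) E (fun w => (r l w)%:R * (S w)%:R).
  rewrite lawE_run -flipE_sum; apply: eq_flipE => w.
  by rewrite expr2 {1}/run_cnt natr_sum mulr_suml.
rewrite /law_var opprB addrA sq expr2 {1 2}run_meanE mulr_suml -big_split -sumrB /=.
apply: eq_bigr => [[l lm] _] /=.
pose W := cnt [pred j | ~~ near l j]; pose Y := cnt (near l).
pose X := cnt [pred j | (j != l) && near l j].
have SWY w : S w = (W w + Y w)%N.
  rewrite (cntID _ _ _ [pred j | ~~ near l j]); congr (_ + _)%N; apply: eq_cnt => j /=.
  by rewrite negbK.
have YX w : Y w = (r l w + X w)%N.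
  rewrite /Y (cntID _ _ _ (pred1 l)) -(cnt_pred1 k1 k2 m); congr (_ + _)%N.
    by apply: eq_cnt => j /=; case: (eqVneq j l) => [->|_]; rewrite ?near_refl ?andbF.
  by apply: eq_cnt => j /=; rewrite andbC.
have muE : mu = E (fun w => (W w)%:R) + \sum_(j < m.+1 | near l j) pr j.
  rewrite -(E_cnt1 p k1 k2 m n (near l)) -flipED /law_mean lawE_run.
  by apply: eq_flipE => w; rewrite SWY natrD.
have rS : E (fun w => (r l w)%:R * (S w)%:R) =
    pr l + pr l * E (fun w => (W w)%:R) +
    \sum_(j < m.+1 | (j != l :> nat) && near l j)
      E (fun w => (r l w)%:R * (r j w)%:R).
  rewrite -(E_cnt p k1 k2 m n (fun w => (r l w)%:R) [pred j | (j != l) && near l j]).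
  rewrite -(@flipEM _ _ (block k1 k2 l)); last 2 first.
  - exact: reads_isrunR.
  - apply: (reads_comp (fun i : nat => i%:R)); apply: reads_cnt => j i /=.
    exact: far_block.
  rewrite -!flipED; apply: eq_flipE => w.
  by rewrite SWY YX; case: (r l w) => /=; rewrite ?natrD; ring.
by rewrite rS muE -mulr_sumr; ring.
Qed.

Lemma sum_places (F : nat -> R) c : 0 <= c -> F 0%N = 0 ->
  (forall l, `|F l| <= c) -> `|\sum_(l < m.+1) F l| <= m%:R * c.
Proof.
move=> c0 F0 Fc; rewrite big_ord_recl /= F0 add0r.
apply: le_trans (ler_norm_sum _ _ _) _.
apply: le_trans (_ : _ <= \sum_(i < m) c) _; first exact: ler_sum.
by rewrite sumr_const card_ord mulr_natl.
Qed.

Lemma isrun0E (g : (nat -> bool) -> R) : E (fun w => (r 0 w)%:R * g w) = 0.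
Proof.
by rewrite (@eq_flipE _ _ _ _ (fun=> 0)) ?flipE_cst // => w; rewrite mul0r.
Qed.

Lemma run0E : pr 0 = 0.
Proof. exact: flipE_cst. Qed.

Lemma place0 : \sum_(j < m.+1 | near 0 j) pr 0 * pr j -
     \sum_(j < m.+1 | (j != 0 :> nat) && near 0 j)
        E (fun w => (r 0 w)%:R * (r j w)%:R) = 0.
Proof.
rewrite [X in X - _]big1 => [|j _]; last by rewrite run0E mul0r.
by rewrite big1 ?subrr // => j _; exact: isrun0E.
Qed.

Section Bounds.
Variables (h : nat -> R) (D2 : R).
Hypothesis hD : forall i, `|h i.+2 - 2 * h i.+1 + h i| <= D2.
Let dh i := h i.+1 - h i.

Lemma run_stein_expansion :
  `|mu * L h - L (fun j => j%:R * h j.-1) - (mu - v) * L dh| <=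
  D2 * (m%:R * (kappa1 R k1 k2 * a ^+ 3)).
Proof.
rewrite lawE_size_bias !lawE_run run_varE run_meanE !mulr_suml -!sumrB [leRHS]mulrCA.
apply: (@sum_places (fun l => pr l * E (fun w => h (S w)) -
   E (fun w => (r l w)%:R * h (cnt (predC1 l) w)) -
    (\sum_(j < m.+1 | near l j) pr l * pr j -
     \sum_(j < m.+1 | (j != l :> nat) && near l j)
        E (fun w => (r l w)%:R * (r j w)%:R)) * E (fun w => dh (S w)))).
- exact: le_trans (normr_ge0 _) (expand_run hk1 hk2 hp hmn hD 0).
- by rewrite isrun0E place0 run0E !mul0r !subrr.
- by move=> l; exact: expand_run.
Qed.

Lemma run_size_bias_expansion :
  `|L (fun j => j%:R * dh j.-1) - mu * L dh| <=
  D2 * (m%:R * (a ^+ 2 * (k%:R + 7) / 2)).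
Proof.
rewrite lawE_size_bias !lawE_run run_meanE !mulr_suml -!sumrB [leRHS]mulrCA.
apply: (@sum_places (fun l => E (fun w => (r l w)%:R * dh (cnt (predC1 l) w)) -
    pr l * E (fun w => dh (S w)))).
- exact: le_trans (normr_ge0 _) (decouple_run hk1 hk2 hp hmn hD 0).
- by rewrite run0E isrun0E mul0r subrr.
- by move=> l; exact: decouple_run.
Qed.

End Bounds.

Lemma run_mean_sub_var : mu - v <= m%:R * (a ^+ 2 * (k%:R + 3) / 2).
Proof.
rewrite run_varE big_ord_recl /= [X in X + _](_ : _ = 0) ?add0r; last first.
  exact: place0.
apply: le_trans (_ : _ <= \sum_(i < m) a ^+ 2 * (k%:R + 3) / 2) _; last first.
  by rewrite sumr_const card_ord mulr_natl.
apply: ler_sum => i _; set l := bump 0 i.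
have e0 : 0 <= \sum_(j < m.+1 | (j != l :> nat) && near l j)
      E (fun w => (r l w)%:R * (r j w)%:R).
  by apply: sumr_ge0 => j _; apply: flipE_ge0 => // w; rewrite mulr_ge0.
apply: le_trans (_ : _ <= \sum_(j < m.+1 | near l j) pr l * pr j) _.
  by rewrite gerBl.
rewrite -mulr_sumr -(E_cnt1 p k1 k2 m n (near l)).
have := ler_pM (flipE_ge0 hp' _ _ _) (flipE_ge0 hp' _ _ _)
  (E_run hk1 hk2 hp hmn l) (E_cnt_near_le hk1 hk2 hp hmn l).
move=> /(_ (fun=> ler0n _ _) (fun=> ler0n _ _)) H; apply: le_trans H _.
by rewrite -/a -/k le_eqVlt; apply/orP; left; apply/eqP; field.
Qed.

Lemma run_mean_gt0 : (2 <= m)%N -> 0 < mu.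
Proof.
move=> m2; rewrite run_meanE (bigD1 (Ordinal (_ : (2 < m.+1)%N))) //=.
apply: ltr_wpDr; first by apply: sumr_ge0 => j _; exact: flipE_ge0.
rewrite (E_run_interior hk1 hk2 hp hmn) //.
by case/andP: hp => p0 p1; rewrite !mulr_gt0 ?exprn_gt0 ?subr_gt0.
Qed.

End RunLaw.

(** * The constants of the bound *)

Section Constants.
Variables (R : realType) (p : R) (k1 k2 n : nat).
Hypotheses (hk1 : (1 <= k1)%N) (hk2 : (1 <= k2)%N) (hp : 0 < p < 1).
Let k := (k1 + k2)%N.
Hypothesis hn : (5 * k <= n)%N.

Lemma delta_star_ge1 : 1 <= delta_star p.
Proof.
rewrite /delta_star; case/andP: hp => p0 p1.
have : 0 <= (1 - p) * p by rewrite mulr_ge0 // ?subr_ge0 ltW.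
by move=> ?; lra.
Qed.

Lemma kR_ge2 : 2 <= k%:R :> R.
Proof. by rewrite ler_nat /k; lia. Qed.

Lemma nR_ge5k : 5 * k%:R <= n%:R :> R.
Proof. by rewrite -natrM ler_nat. Qed.

Lemma c1_ge0 : 0 <= c1 R n k.
Proof.
have hk := kR_ge2; have hn' := nR_ge5k.
have hkn : 0 <= (n%:R - 5 * k%:R) * k%:R :> R by rewrite mulr_ge0 // subr_ge0.
have hkk : 0 <= (k%:R - 2) * k%:R :> R by rewrite mulr_ge0 // subr_ge0.
have k0 : 0 <= k%:R + 1 :> R by lra.
have k00 : 0 <= k%:R + 2 :> R by lra.
rewrite /c1; apply: addr_ge0; first by nra.
by rewrite divr_ge0 ?exprn_ge0.
Qed.

Lemma c2_ge0 : 0 <= c2 R n k.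
Proof.
have hk := kR_ge2; have hn' := nR_ge5k.
have hkn : 0 <= (n%:R - 5 * k%:R) * k%:R :> R by rewrite mulr_ge0 // subr_ge0.
have hkk : 0 <= (k%:R - 2) * k%:R :> R by rewrite mulr_ge0 // subr_ge0.
have k0 : 0 <= k%:R + 1 :> R by lra.
have k00 : 0 <= k%:R + 2 :> R by lra.
rewrite /c2; apply: addr_ge0; first by nra.
by rewrite mulr_ge0 ?exprn_ge0 ?divr_ge0.
Qed.

Lemma c3_ge0 : 0 <= c3 R n k.
Proof.
have hk := kR_ge2; have hn' := nR_ge5k.
have hkn : 0 <= (n%:R - 5 * k%:R) * k%:R :> R by rewrite mulr_ge0 // subr_ge0.
have hkk : 0 <= (k%:R - 2) * k%:R :> R by rewrite mulr_ge0 // subr_ge0.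
have k0 : 0 <= k%:R + 1 :> R by lra.
have k00 : 0 <= k%:R + 2 :> R by lra.
rewrite /c3; apply: addr_ge0; first by nra.
apply: mulr_ge0; last by rewrite divr_ge0 ?exprn_ge0.
by apply: mulr_ge0 => //; nra.
Qed.

Lemma c4_ge0 : 0 <= c4 R n k.
Proof.
have hk := kR_ge2; have hn' := nR_ge5k.
have hkn : 0 <= (n%:R - 5 * k%:R) * k%:R :> R by rewrite mulr_ge0 // subr_ge0.
have hkk : 0 <= (k%:R - 2) * k%:R :> R by rewrite mulr_ge0 // subr_ge0.
have k0 : 0 <= k%:R + 1 :> R by lra.
have k00 : 0 <= k%:R + 2 :> R by lra.
rewrite /c4; apply: addr_ge0; first by nra.
apply: mulr_ge0; last by rewrite exprn_ge0 ?divr_ge0.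
by nra.
Qed.

Lemma c5_ge0 : 0 <= c5 R n k.
Proof.
have hk := kR_ge2; have hn' := nR_ge5k.
have hkn : 0 <= (n%:R - 5 * k%:R) * k%:R :> R by rewrite mulr_ge0 // subr_ge0.
have hkk : 0 <= (k%:R - 2) * k%:R :> R by rewrite mulr_ge0 // subr_ge0.
have k0 : 0 <= k%:R + 1 :> R by lra.
have k00 : 0 <= k%:R + 2 :> R by lra.
rewrite /c5; apply: addr_ge0; first by nra.
apply: mulr_ge0; last by rewrite divr_ge0 ?exprn_ge0.
by nra.
Qed.

Lemma delta_ge : k%:R + 4 <= delta k p.
Proof. by rewrite /delta; have := delta_star_ge1; have := kR_ge2; nra. Qed.

Lemma delta1_ge :
  5 * k%:R + 6 + (3 * k%:R ^+ 2 + 11 * k%:R + 10) / 2 <= delta1 k p.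
Proof.
have d1 := delta_star_ge1; have k2' := kR_ge2.
have : 0 <= (3 * k%:R ^+ 2 + 11 * k%:R + 10) / 2 :> R by nra.
rewrite /delta1; set x := _ / 2 => x0.
have xd : x <= x * delta_star p by rewrite ler_peMr.
apply: le_trans (_ : _ <= 1 * (5 * k%:R + 6 + x * delta_star p)) _.
  by rewrite mul1r lerD2l.
by apply: ler_wpM2r => //; lra.
Qed.

Lemma delta2_ge0 : 0 <= delta2 k p.
Proof. by rewrite /delta2; have := delta_star_ge1; have := kR_ge2; nra. Qed.

(** The first summand of h1 already exceeds the constant of the expansion. *)
Lemma h1_ge : ((n - k)%N)%:R * kappa1 R k1 k2 <= 2 * h1 n k p.
Proof.
have k2' := kR_ge2; have nk := nR_ge5k; have d1 := delta1_ge; have ds := delta_star_ge1.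
have kn : (k <= n)%N by move: hn; lia.
rewrite natrB // /h1.
have t1 : 0 <= delta2 k p * c1 R n k by rewrite mulr_ge0 ?delta2_ge0 ?c1_ge0.
have t2 : 0 <= delta k p * c2 R n k.
  by rewrite mulr_ge0 ?c2_ge0 //; have := delta_ge; lra.
have t3 := c3_ge0.
have t4 : 0 <= delta_star p * c4 R n k by rewrite mulr_ge0 ?c4_ge0 //; lra.
have t5 : 0 <= delta_star p ^+ 2 / 2 * c5 R n k.
  by rewrite mulr_ge0 ?c5_ge0 ?divr_ge0 ?exprn_ge0 //; lra.
have : (n%:R - k%:R) * kappa1 R k1 k2 <= 2 * ((n%:R - k%:R) * (4 + delta1 k p)).
  rewrite mulrCA ler_wpM2l; [by [] | by lra |].
  by rewrite /kappa1 -/k; nra.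
move=> ?; lra.
Qed.

Lemma h2_ge : ((n - k)%N)%:R * (2 * k%:R + 8) <= 2 * h2 n k p.
Proof.
have k2' := kR_ge2; have nk := nR_ge5k; have d1 := delta_ge; have ds := delta_star_ge1.
have kn : (k <= n)%N by move: hn; lia.
rewrite natrB // /h2.
have t1 : 0 <= delta_star p * c1 R n k by rewrite mulr_ge0 ?c1_ge0 //; lra.
have t2 := c2_ge0.
have : (n%:R - k%:R) * (2 * k%:R + 8) <= 2 * ((n%:R - k%:R) * delta k p).
  by rewrite mulrCA ler_wpM2l //; lra.
move=> ?; lra.
Qed.

End Constants.

(** * Stein operators with linear rates *)

Section LawE.
Variables (R : realType) (N : nat) (s : nat -> R).
Hypothesis s0 : forall j, 0 <= s j.
Local Notation L := (lawE N s).

Lemma eq_lawE g h : g =1 h -> L g = L h.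
Proof. by move=> gh; apply: eq_bigr => j _; rewrite gh. Qed.

Lemma lawED g h : L (fun j => g j + h j) = L g + L h.
Proof. by rewrite /lawE -big_split; apply: eq_bigr => j _; rewrite mulrDl. Qed.

Lemma lawEZ c g : L (fun j => c * g j) = c * L g.
Proof. by rewrite /lawE mulr_sumr; apply: eq_bigr => j _; rewrite mulrA. Qed.

Lemma lawEN g : L (fun j => - g j) = - L g.
Proof. by rewrite /lawE -sumrN; apply: eq_bigr => j _; rewrite mulNr. Qed.

Lemma lawEB g h : L (fun j => g j - h j) = L g - L h.
Proof. by rewrite lawED lawEN. Qed.

Lemma ler_lawE g h : (forall j, g j <= h j) -> L g <= L h.
Proof. by move=> gh; apply: ler_sum => j _; apply: ler_wpM2r. Qed.

Hypothesis s1 : \sum_(j < N) s j = 1.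

Lemma lawE_cst c : L (fun=> c) = c.
Proof. by rewrite /lawE -mulr_sumr s1 mulr1. Qed.

Lemma ler_norm_lawE g c : (forall j, `|g j| <= c) -> `|L g| <= c.
Proof.
move=> gc; rewrite ler_norml -{1}(lawE_cst c) -lawEN -{2}(lawE_cst c).
by apply/andP; split; apply: ler_lawE => j; move: (gc j); rewrite ler_norml => /andP[].
Qed.

(** All that Stein's method uses of the law s: the two expansions that hold for
    the run count. *)
Definition expandable (K1 K2 : R) : Prop :=
  forall (f : nat -> R) D2,
  (forall i, `|f i.+3 - 2 * f i.+2 + f i.+1| <= D2) ->
  `|L (fun j => law_mean N s * f j.+1 - j%:R * f j) -
    (law_mean N s - law_var N s) * L (fun j => f j.+2 - f j.+1)| <= D2 * K1 /\
  `|L (fun j => j%:R * (f j.+1 - f j)) -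
    law_mean N s * L (fun j => f j.+2 - f j.+1)| <= D2 * K2.

Lemma second_difference (f : nat -> R) M :
  (forall i, `|f i.+2 - f i.+1| <= M) ->
  forall i, `|f i.+3 - 2 * f i.+2 + f i.+1| <= 2 * M.
Proof.
move=> fM i.
have -> : f i.+3 - 2 * f i.+2 + f i.+1 = (f i.+3 - f i.+2) - (f i.+2 - f i.+1) by ring.
by apply: le_trans (ler_normB _ _) _; rewrite mulr_natl mulr2n lerD.
Qed.

(** With birth rate A + B j and death rate j, the operator splits as (1 - B)
    times the Poisson operator plus B times a size-biased difference. *)
Lemma linear_stein_bound K1 K2 A B M (f : nat -> R) :
  expandable K1 K2 -> 0 <= B <= 1 -> A = (1 - B) * law_mean N s ->
  (forall i, `|f i.+2 - f i.+1| <= M) ->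
  `|L (fun j => (A + B * j%:R) * f j.+1 - j%:R * f j)| <=
  M * (`|law_mean N s - (1 - B) * law_var N s| + 2 * ((1 - B) * K1 + B * K2)).
Proof.
move=> HE /andP[B0 B1] AE fM; have [e1 e2] := HE f _ (second_difference fM).
set mu := law_mean N s in AE e1 e2 *; set v := law_var N s in e1 *.
set G := L (fun j => f j.+2 - f j.+1) in e1 e2.
have GM : `|G| <= M by exact: ler_norm_lawE.
rewrite (@eq_lawE _ (fun j => (1 - B) * (mu * f j.+1 - j%:R * f j) +
   B * (j%:R * (f j.+1 - f j)))); last by move=> j; rewrite AE; ring.
rewrite lawED !lawEZ.
set U := L _ in e1 *; set V := L _ in e2 *.
have -> : (1 - B) * U + B * V = (mu - (1 - B) * v) * G +
   ((1 - B) * (U - (mu - v) * G) + B * (V - mu * G)) by ring.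
have B1' : 0 <= 1 - B by lra.
apply: le_trans (ler_normD _ _) _; rewrite [leRHS]mulrDr; apply: lerD.
  by rewrite normrM mulrC ler_wpM2r.
apply: le_trans (ler_normD _ _) _.
rewrite !normrM (ger0_norm B0) (ger0_norm B1').
have h1 := ler_wpM2l B1' e1; have h2 := ler_wpM2l B0 e2.
apply: le_trans (lerD h1 h2) _.
by rewrite le_eqVlt; apply/orP; left; apply/eqP; ring.
Qed.

End LawE.

(** * Stein equations of birth-death chains *)

Section BirthDeath.
Variables (R : realType) (Q b d : nat -> R).
Local Notation below n := (\sum_(i < n) Q i).

(** Induction on n: the increment of the right side is the death rate times the
    new mass, which is the birth rate times the previous one. *)
Lemma below_rate n : d 0 = 0 -> (forall i, (i < n)%N -> 0 <= Q i) ->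
  (forall i, (i < n)%N -> b i * Q i = d i.+1 * Q i.+1) ->
  (forall i, (i < n)%N -> b i.+1 - b i <= d i.+1 - d i) ->
  b n * below n <= d n * below n.+1.
Proof.
move=> d0; elim: n => [|n IH] Q0 rel conc.
  by rewrite big_ord0 mulr0 d0 mul0r.
have {}IH := IH (fun i ni => Q0 i (ltnW ni)) (fun i ni => rel i (ltnW ni))
  (fun i ni => conc i (ltnW ni)).
have F0 : 0 <= below n.+1 by apply: sumr_ge0 => i _; exact: Q0.
have rn := rel n (ltnSn n); have cn := conc n (ltnSn n).
rewrite (big_ord_recr n.+1) /= mulrDr -rn.
have -> : Q n = below n.+1 - below n by rewrite big_ord_recr /= addrAC subrr add0r.
have := ler_wpM2r F0 cn; move: IH; set x := below n.+1; set y := below n.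
lra.
Qed.

(** Each mass in the tail is compared with its predecessor. *)
Lemma above_rate m K : (m <= K)%N -> (forall i, 0 < d i.+1) -> (forall i, 0 <= Q i) ->
  (forall i, (m <= i < K)%N -> b i * Q i = d i.+1 * Q i.+1) ->
  (forall i, (m <= i < K)%N -> d m * b i <= b m * d i.+1) ->
  d m * (below K.+1 - below m.+1) <= b m * (below K - below m).
Proof.
move=> mK dp Q0 rel rat.
have -> : K = (m + (K - m))%N by rewrite subnKC.
have : forall t, (t <= K - m)%N ->
    d m * (below (m + t).+1 - below m.+1) <= b m * (below (m + t) - below m).
  elim=> [|t IH] tK; first by rewrite addn0 !subrr !mulr0.
  rewrite addnS !(big_ord_recr (m + t).+1) (big_ord_recr (m + t)) /=.
  have := IH (ltnW tK); rewrite (big_ord_recr (m + t)) /=.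
  set x := below (m + t); set y := below m.+1 => IH'.
  have ti : (m <= m + t < K)%N by rewrite leq_addr /= -ltn_subRL.
  have := rel _ ti; have := rat _ ti.
  have Qt := Q0 (m + t)%N; have dt := dp (m + t)%N => rt et.
  suff : d m * Q (m + t).+1 <= b m * Q (m + t)%N by move: IH'; rewrite !mulrBr !mulrDr; lra.
  rewrite -(ler_pM2l dt) mulrCA -et.
  by rewrite mulrA [leRHS]mulrA; apply: ler_wpM2r => //; rewrite [leRHS]mulrC.
exact.
Qed.

(** The difference of the solution is a combination of the masses of A below,
    at and above the state; the two rate inequalities fix the signs of its
    coefficients, so that only the mass at the state can make it positive. *)
Lemma bd_difference (u v c q0 G F bm dm : R) :
  0 <= u <= F -> 0 <= v <= G -> 0 <= c <= 1 -> 0 <= q0 -> F + q0 + G = 1 ->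
  0 < bm -> 0 < dm -> dm * G <= bm * (G + q0) -> bm * F <= dm * (F + q0) ->
  let pi := u + c * q0 + v in
  `|(u + c * q0 - pi * (F + q0)) / bm - (u - pi * F) / dm| <=
    q0 * (G / bm + F / dm) /\
  ((G / bm + F / dm) * bm <= 1 /\ (G / bm + F / dm) * dm <= 1).
Proof.
move=> /andP[u0 uF] /andP[v0 vG] /andP[c0 c1] q00 tot b0 d0 HG HF pi.
have x1 : G / bm <= (G + q0) / dm.
  by rewrite ler_pdivrMr // mulrAC ler_pdivlMr // [leLHS]mulrC [leRHS]mulrC.
have y1 : F / dm <= (F + q0) / bm.
  by rewrite ler_pdivrMr // mulrAC ler_pdivlMr // [leLHS]mulrC [leRHS]mulrC.
have x0 : 0 <= G / bm by apply: divr_ge0; lra.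
have y0 : 0 <= F / dm by apply: divr_ge0; lra.
have gE : u + c * q0 - pi * (F + q0) = (u + c * q0) * G - v * (F + q0).
  have -> : G = 1 - F - q0 by lra.
  by rewrite /pi; ring.
have gE' : u - pi * F = u * (G + q0) - (v + c * q0) * F.
  have -> : G = 1 - F - q0 by lra.
  by rewrite /pi; ring.
have -> : (u + c * q0 - pi * (F + q0)) / bm - (u - pi * F) / dm =
  c * q0 * (G / bm + F / dm) - u * ((G + q0) / dm - G / bm)
   - v * ((F + q0) / bm - F / dm).
  by rewrite gE gE'; field; lra.
set x := G / bm in x1 x0 *; set y := F / dm in y1 y0 *.
set X := (G + q0) / dm - x; set Y := (F + q0) / bm - y.
have X0 : 0 <= X by rewrite subr_ge0.
have Y0 : 0 <= Y by rewrite subr_ge0.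
have xyq : 0 <= q0 * (x + y) by rewrite mulr_ge0 // addr_ge0.
have XY : F * X + G * Y = q0 * (x + y).
  by rewrite /X /Y /x /y; field; lra.
have cq : 0 <= c * q0 * (x + y) <= q0 * (x + y).
  rewrite -mulrA; apply/andP; split; first by rewrite mulr_ge0.
  by rewrite ler_piMl.
have uX : 0 <= u * X <= F * X by rewrite mulr_ge0 //= ler_wpM2r.
have vY : 0 <= v * Y <= G * Y by rewrite mulr_ge0 //= ler_wpM2r.
split; first by rewrite ler_norml; move: cq uX vY XY; lra.
have Gb : x * bm = G by rewrite divfK // gt_eqF.
have Fd : y * dm = F by rewrite divfK // gt_eqF.
have Gd : x * dm <= G + q0 by rewrite -ler_pdivlMr.
have Fb : y * bm <= F + q0 by rewrite -ler_pdivlMr.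
by rewrite !mulrDl; split; lra.
Qed.

Definition partial_mass (A : pred nat) n : R := \sum_(i < n) (A i)%:R * Q i.

Lemma partial_mass_le A n : (forall i, 0 <= Q i) ->
  0 <= partial_mass A n <= below n.
Proof.
move=> Q0; apply/andP; split; first by apply: sumr_ge0 => i _; rewrite mulr_ge0.
by apply: ler_sum => i _; case: (A i); rewrite ?mul1r ?mul0r.
Qed.

(** [pi] stands for the mass of A; all that matters is that it is compatible
    with the partial masses. *)
Definition stein_solution (A : pred nat) (pi : R) (j : nat) : R :=
  if j is m.+1 then (partial_mass A m.+1 - pi * below m.+1) / (b m * Q m) else 0.

Lemma stein_solutionS A pi m : b m != 0 -> Q m != 0 -> d m.+1 != 0 -> Q m.+1 != 0 ->
  b m * Q m = d m.+1 * Q m.+1 -> b m.+1 != 0 ->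
  b m.+1 * stein_solution A pi m.+2 - d m.+1 * stein_solution A pi m.+1 =
  (A m.+1)%:R - pi.
Proof.
move=> bm Qm dm Qm1 rel bm1; rewrite /stein_solution rel.
rewrite /partial_mass !(big_ord_recr m.+1) /=.
by field; rewrite bm1 Qm1 dm.
Qed.

Lemma stein_solution0 A pi : b 0 != 0 -> Q 0 != 0 ->
  b 0 * stein_solution A pi 1 = (A 0%N)%:R - pi.
Proof.
by move=> b0 Q0; rewrite /stein_solution /partial_mass !big_ord1; field; rewrite b0 Q0.
Qed.

Lemma stein_solution_lipschitz A pi m M : (forall i, 0 <= Q i) ->
  0 < Q m.+1 -> 0 < b m.+1 -> 0 < d m.+1 ->
  b m * Q m = d m.+1 * Q m.+1 ->
  partial_mass A m.+2 <= pi <= partial_mass A m.+2 + (1 - below m.+2) ->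
  d m.+1 * (1 - below m.+2) <= b m.+1 * (1 - below m.+1) ->
  b m.+1 * below m.+1 <= d m.+1 * below m.+2 ->
  (forall x, 0 <= x -> x * b m.+1 <= 1 -> x * d m.+1 <= 1 -> x <= M) ->
  `|stein_solution A pi m.+2 - stein_solution A pi m.+1| <= M.
Proof.
move=> Q0 Qm bm dm rel /andP[pi0 pi1] HG HF HM.
have /andP[u0 uF] := @partial_mass_le A m.+1 Q0.
rewrite /stein_solution rel.
move: pi0 pi1 HG HF; rewrite /partial_mass !(big_ord_recr m.+1) /=.
set F := below m.+1 in uF *; rewrite -/(partial_mass A m.+1).
set u := partial_mass A m.+1 in u0 uF *; set q0 := Q m.+1 in Qm *.
set c := (A m.+1)%:R => pi0 pi1 HG HF.
have c01 : 0 <= c <= 1 by rewrite /c; case: (A _); rewrite ?lexx ler01.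
have u01 : 0 <= u <= F by rewrite u0.
have v01 : 0 <= pi - (u + c * q0) <= 1 - (F + q0) by apply/andP; split; lra.
have tot : F + q0 + (1 - (F + q0)) = 1 by ring.
have HG' : d m.+1 * (1 - (F + q0)) <= b m.+1 * (1 - (F + q0) + q0).
  by rewrite (_ : 1 - (F + q0) + q0 = 1 - F) //; ring.
have [h1 [h2 h3]] := bd_difference u01 v01 c01 (ltW Qm) tot bm dm HG' HF.
have xy : (1 - (F + q0)) / b m.+1 + F / d m.+1 <= M.
  apply: HM => //; apply: addr_ge0; apply: divr_ge0; try exact: ltW.
    by case/andP: v01; lra.
  by lra.
have piE : u + c * q0 + (pi - (u + c * q0)) = pi by ring.
rewrite piE in h1.
have -> : (u + c * q0 - pi * (F + q0)) / (b m.+1 * q0) - (u - pi * F) / (d m.+1 * q0) =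
  q0^-1 * ((u + c * q0 - pi * (F + q0)) / b m.+1 - (u - pi * F) / d m.+1).
  by field; rewrite !gt_eqF.
rewrite normrM ger0_norm ?invr_ge0 ?(ltW Qm) // mulrC ler_pdivrMr //.
by apply: le_trans h1 _; rewrite [leRHS]mulrC ler_wpM2l // ltW.
Qed.

End BirthDeath.

Lemma birth_death_stein (R : realType) (Q b d : nat -> R) (A : pred nat) (pi M : R) :
  (forall i, 0 < Q i) -> (forall i, 0 < b i) -> d 0 = 0 -> (forall i, 0 < d i.+1) ->
  (forall i, b i * Q i = d i.+1 * Q i.+1) ->
  (forall i, b i.+1 - b i <= d i.+1 - d i) ->
  (forall m i, (m <= i)%N -> d m * b i <= b m * d i.+1) ->
  (fun n => \sum_(i < n) Q i) @ \oo --> (1 : R) ->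
  (forall n, partial_mass Q A n <= pi <=
     partial_mass Q A n + (1 - \sum_(i < n) Q i)) ->
  (forall m (x : R), 0 <= x -> x * b m.+1 <= 1 -> x * d m.+1 <= 1 -> x <= M) ->
  exists f : nat -> R,
    (forall j, b j * f j.+1 - d j * f j = (A j)%:R - pi) /\
    (forall j, `|f j.+2 - f j.+1| <= M).
Proof.
move=> Qp bp d0 dp rel conc rat cvgQ Hpi HM.
have Q0 i : 0 <= Q i := ltW (Qp i).
have nz x : 0 < x -> x != 0 :> R by move=> x0; rewrite gt_eqF.
exists (stein_solution Q b A pi); split=> [[|j]|j].
- by rewrite d0 mul0r subr0 stein_solution0 ?nz.
- by rewrite stein_solutionS ?nz.
apply: (@stein_solution_lipschitz _ Q b d) => //.
- have Hn (n : nat) : \sum_(i < n) Q i <= 1.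
    by have /andP[h1 h2] := Hpi n; have := le_trans h1 h2; rewrite lerDl subr_ge0.
  have H : \forall n \near \oo, d j.+1 * (\sum_(i < n) Q i - \sum_(i < j.+2) Q i) <=
      b j.+1 * (1 - \sum_(i < j.+1) Q i).
    exists j.+2 => // n /= jn.
    have jn' : (j.+1 <= n.-1)%N by case: n jn.
    have := @above_rate _ Q b d j.+1 n.-1 jn' dp Q0 (fun i _ => rel i)
      (fun i ij => rat j.+1 i (proj1 (andP ij))).
    rewrite prednK; last by case: n jn {jn'}.
    move=> H; apply: le_trans H _; rewrite ler_wpM2l ?(ltW (bp _)) // lerB //.
  have C : (fun n => d j.+1 * (\sum_(i < n) Q i - \sum_(i < j.+2) Q i)) @ \oo -->
      d j.+1 * (1 - \sum_(i < j.+2) Q i).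
    by apply: cvgMr; apply: cvgB => //; exact: cvg_cst.
  rewrite -(cvg_lim _ C) //; apply: limr_le H; exact: cvgP C.
- by apply: below_rate => // i _.
- exact: HM.
Qed.

(** * The Stein equation of the pseudo-binomial law *)

Section PseudoBinomial.
Variables (R : realType) (N : nat) (alpha p : R) (Q : nat -> R).
Let q : R := 1 - p.
Let eps := alpha - N%:R.
Let e := eps * p * Q N.
Hypotheses (hp : 0 < p < 1) (hN : (0 < N)%N) (ha : N%:R <= alpha < N%:R + 1).
Hypotheses (Qp : forall i, (i <= N)%N -> 0 < Q i).
Hypotheses (Qz : forall i, (N < i)%N -> Q i = 0).
Hypotheses (Q1 : \sum_(i < N.+1) Q i = 1).
Hypothesis rel : forall i, (i < N)%N ->
  (alpha - i%:R) * p * Q i = i.+1%:R * q * Q i.+1.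
Let mu := \sum_(i < N.+1) i%:R * Q i.
Let V := \sum_(i < N.+1) i%:R ^+ 2 * Q i - mu ^+ 2.
Let p0 : 0 < p. Proof. by case/andP: hp. Qed.
Let q0 : 0 < q. Proof. by rewrite subr_gt0; case/andP: hp. Qed.
Let Q0 i : 0 <= Q i.
Proof. by case: (leqP i N) => [/Qp/ltW|/Qz ->]. Qed.
Let eps0 : 0 <= eps. Proof. by rewrite subr_ge0; case/andP: ha. Qed.
Let eps1 : eps < 1. Proof. by case/andP: ha => _; rewrite /eps; lra. Qed.
Let N1 : 1 <= N%:R :> R. Proof. by rewrite (ler_nat R 1 N). Qed.
Let a0 : 0 < alpha. Proof. by case/andP: ha; move: N1; lra. Qed.
Let e0 : 0 <= e. Proof. by rewrite mulr_ge0 // mulr_ge0 // ltW. Qed.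

(** Summation by parts against the rates; the boundary term vanishes only for
    integer alpha. *)
Lemma pb_sum g : \sum_(i < N.+1) ((alpha - i%:R) * p * g i.+1 - i%:R * q * g i) * Q i =
  e * g N.+1.
Proof.
have -> : e * g N.+1 = (alpha - N%:R) * p * g N.+1 * Q N by rewrite /e /eps; ring.
suff H n : (n <= N)%N ->
   \sum_(i < n.+1) ((alpha - i%:R) * p * g i.+1 - i%:R * q * g i) * Q i =
   (alpha - n%:R) * p * g n.+1 * Q n by exact: H.
elim: n => [_|n IH nN]; first by rewrite big_ord1 /=; ring.
rewrite big_ord_recr /= IH ?(ltnW nN) //.
have := rel nN; set A := (alpha - n%:R) * p.
have -> : A * g n.+1 * Q n = A * Q n * g n.+1 by ring.
by move=> ->; ring.
Qed.

Lemma pb_cst c : c = \sum_(i < N.+1) c * Q i.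
Proof. by rewrite -mulr_sumr Q1 mulr1. Qed.

Lemma pb_mean : alpha * p = mu + e.
Proof.
have := pb_sum (fun=> 1); rewrite mulr1 => <-.
rewrite (pb_cst (alpha * p)) /mu -big_split /=.
by apply: eq_bigr => i _; rewrite /q; ring.
Qed.

Lemma pb_var : V = q * mu - e * (N%:R - mu).
Proof.
have := pb_sum (fun i => i%:R).
have -> : \sum_(i < N.+1) ((alpha - i%:R) * p * (i.+1%:R) - i%:R * q * i%:R) * Q i =
   (alpha * p - p) * mu + alpha * p - \sum_(i < N.+1) i%:R ^+ 2 * Q i.
  rewrite [X in _ + X - _]pb_cst /mu mulr_sumr -big_split -sumrB /=.
  by apply: eq_bigr => i _; rewrite -natr1 /q; ring.
by rewrite -natr1 pb_mean /V /q => ?; nra.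
Qed.

Lemma pb_mu_ge0 : 0 <= mu.
Proof. by apply: sumr_ge0 => i _; rewrite mulr_ge0. Qed.

Lemma pb_mu_leN : mu <= N%:R.
Proof.
rewrite [leRHS]pb_cst; apply: ler_sum => i _.
by rewrite ler_wpM2r // ler_nat -ltnS.
Qed.

(** At the top state the second factorial moment controls the mass. *)
Lemma pb_top : (2 <= N)%N -> N%:R * Q N <= 2 * p * mu.
Proof.
move=> N2; have N2' : 2 <= N%:R :> R by rewrite (ler_nat R 2 N).
have top : N%:R * (N%:R - 1) * Q N <= \sum_(i < N.+1) i%:R * (i%:R - 1) * Q i.
  rewrite big_ord_recr /= lerDr; apply: sumr_ge0 => -[[|i] lti] _ /=.
    by rewrite !mul0r.
  by rewrite !mulr_ge0 // subr_ge0 (ler_nat R 1).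
have fact2 : \sum_(i < N.+1) i%:R * (i%:R - 1) * Q i = V + mu ^+ 2 - mu.
  rewrite /V subrK /mu -sumrB; apply: eq_bigr => i _; ring.
have mu0 := pb_mu_ge0; have muN := pb_mu_leN; have m1 := pb_mean; have v1 := pb_var.
have H : V + mu ^+ 2 - mu <= p * mu * N%:R.
  rewrite v1 /q; case/andP: ha => _ a1.
  have : 0 <= mu * p * (N%:R + 1 - alpha) by apply: mulr_ge0; [exact: mulr_ge0 (ltW _) | lra].
  have : mu * (alpha * p) = mu * (mu + e) by rewrite m1.
  have : 0 <= e * N%:R by rewrite mulr_ge0.
  nra.
have H2 : (N%:R - 1) * Q N <= p * mu.
  rewrite -(ler_pM2r (_ : 0 < N%:R)); last by rewrite ltr0n.
  move: top; rewrite fact2 => top; apply: le_trans H; apply: le_trans top.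
  by rewrite le_eqVlt; apply/orP; left; apply/eqP; ring.
have := Q0 N; nra.
Qed.

Section Solution.
Variable A : pred nat.
Hypotheses (Atail : forall i, (N < i)%N -> A i) (ph : p <= 1 / 2).
Let b (i : nat) : R := (alpha - i%:R) * p.
Let d (i : nat) : R := i%:R * q.
Let pi := partial_mass Q A N.+1.
Let M := (alpha * p * q)^-1.
Let y : R := (1 - pi) / ((N%:R + 1) * q).

(** Beyond N the solution decreases at the maximal rate, so that it stays below
    the line of slope - M through its value at N + 1. *)
Definition pb_solution (i : nat) : R :=
  if (i <= N)%N then stein_solution Q b A pi i else - y - M * (i - N.+1)%N%:R.

Let M0 : 0 < M. Proof. by rewrite invr_gt0 !mulr_gt0. Qed.

Lemma pb_pi01 : 0 <= pi <= 1.
Proof. by rewrite -Q1; exact: partial_mass_le. Qed.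

Lemma pb_y : 0 <= y <= ((N%:R + 1) * q)^-1.
Proof.
case/andP: pb_pi01 => h0 h1; have n0 : 0 < (N%:R + 1) * q.
  by rewrite mulr_gt0 //; lra.
apply/andP; split; first by apply: divr_ge0; [lra | exact: ltW].
by rewrite -[leRHS]mul1r ler_wpM2r ?invr_ge0 ?(ltW n0) //; lra.
Qed.

Lemma pb_b_gt0 i : (i < N)%N -> 0 < b i.
Proof.
move=> iN; rewrite mulr_gt0 // subr_gt0; apply: lt_le_trans (_ : N%:R <= _).
  by rewrite ltr_nat.
by case/andP: ha.
Qed.

Lemma pb_solution_top : N%:R * q * pb_solution N = pi - (A N)%:R.
Proof.
rewrite /pb_solution leqnn; case: N hN Qp rel Q1 @pi => // N' _ Qp' rel' Q1' pi'.
have Qn : Q N'.+1 != 0 by rewrite gt_eqF // Qp'.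
have rn := rel' N' (ltnSn N').
have bQ : b N' * Q N' = N'.+1%:R * q * Q N'.+1 by rewrite /b.
have nq : N'.+1%:R * q != 0 by rewrite mulf_neq0 ?pnatr_eq0 // gt_eqF.
have piE : pi' = partial_mass Q A N'.+1 + (A N'.+1)%:R * Q N'.+1.
  by rewrite /pi' /partial_mass big_ord_recr.
have bE : \sum_(i < N'.+1) Q i = 1 - Q N'.+1.
  by rewrite -Q1' [in RHS]big_ord_recr /= addrK.
rewrite /stein_solution bQ bE.
have -> : partial_mass Q A N'.+1 = pi' - (A N'.+1)%:R * Q N'.+1.
  by rewrite piE addrK.
by field; rewrite Qn nat1r pnatr_eq0 gt_eqF.
Qed.

(** Only an inequality is needed beyond N, where A is the whole half-line; at N
    the value - y of the solution at N + 1 leaves a defect. *)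
Lemma pb_stein i : (A i)%:R - pi <=
  (alpha - i%:R) * p * pb_solution i.+1 - i%:R * q * pb_solution i
  + eps * p * y * (i == N)%:R.
Proof.
case/andP: pb_y => y0 y1; case/andP: pb_pi01 => pi0 pi1.
case: (ltngtP i N) => [iN|iN|->]; rewrite ?mulr0 ?addr0.
- rewrite /pb_solution iN (ltnW iN).
  have nzb j : (j < N)%N -> b j != 0 by move=> /pb_b_gt0/gt_eqF ->.
  have nzQ j : (j <= N)%N -> Q j != 0 by move=> /Qp/gt_eqF ->.
  case: i iN => [|i] iN.
    by rewrite !mul0r subr0 -/(b 0) stein_solution0 ?nzb ?nzQ.
  rewrite -(@stein_solutionS R Q b d A pi i) ?nzb ?nzQ ?(ltnW iN) ?(ltnW (ltnW iN)) //.
    by rewrite mulf_neq0 ?pnatr_eq0 // gt_eqF.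
  by rewrite /b /d rel // ltnW.
- rewrite /pb_solution ltnNge (ltnW iN) /= leqNgt iN /= Atail //.
  have iN' : N%:R + 1 <= i%:R :> R by rewrite natr1 ler_nat.
  set z := (i.+1 - _)%N%:R; set z' := (i - _)%N%:R.
  have z0 : 0 <= z :> R by []. have z0' : 0 <= z' :> R by [].
  have h1 : 0 <= (alpha - i%:R) * p * (- y - M * z).
    rewrite -mulrNN mulr_ge0 //; last by rewrite -opprD opprK addr_ge0 // mulr_ge0 // ltW.
    rewrite -mulNr mulr_ge0 ?(ltW p0) // oppr_ge0 subr_le0.
    by case/andP: ha => _ /ltW/le_trans; apply.
  have h2 : (N%:R + 1) * q * y = 1 - pi.
    rewrite /y mulrC divfK // mulf_neq0 ?gt_eqF // natr1 //.
  have h3 : (N%:R + 1) * q * y <= i%:R * q * y by rewrite !ler_wpM2r // ltW.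
  have h4 : 0 <= i%:R * q * (M * z') by rewrite !mulr_ge0 // ltW.
  have -> : i%:R * q * (- y - M * z') = - (i%:R * q * y) - i%:R * q * (M * z') by ring.
  by rewrite /=; move: h1 h2 h3 h4; lra.
- rewrite /= mulr1 pb_solution_top /pb_solution ltnn subnn mulr0 subr0.
  by rewrite -/eps; lra.
Qed.

Lemma pb_lipschitz i : `|pb_solution i.+2 - pb_solution i.+1| <= M.
Proof.
case: (ltngtP i.+1 N) => [iN|iN|iN].
- rewrite /pb_solution iN (ltnW iN).
  apply: (@stein_solution_lipschitz _ Q b d) => //.
  + by apply: Qp; exact: ltnW.
  + exact: pb_b_gt0.
  + by rewrite mulr_gt0.
  + by rewrite /b /d rel // ltnW.
  + have -> : 1 - \sum_(j < i.+2) Q j = \sum_(i.+2 <= j < N.+1) Q j.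
      rewrite -Q1 -!(big_mkord xpredT Q) (@big_cat_nat _ _ _ i.+2 0 N.+1) //=;
        last exact: ltnW.
      by rewrite addrAC subrr add0r.
    have -> : pi = partial_mass Q A i.+2 + \sum_(i.+2 <= j < N.+1) (A j)%:R * Q j.
      rewrite /pi /partial_mass -!(big_mkord xpredT (fun j => (A j)%:R * Q j)).
      by rewrite (@big_cat_nat _ _ _ i.+2 0 N.+1) //=; exact: ltnW.
    rewrite lerDl lerD2l; apply/andP; split.
      by apply: sumr_ge0 => j _; rewrite mulr_ge0.
    by apply: ler_sum => j _; case: (A j); rewrite ?mul1r ?mul0r.
  + apply: le_trans (_ : _ <= d i.+1 * (\sum_(j < N.+1) Q j - \sum_(j < i.+2) Q j)) _.
      by rewrite Q1.
    apply: le_trans (@above_rate _ Q b d i.+1 N _ _ _ _ _) _ => //.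
    * exact: ltnW.
    * by move=> j; rewrite mulr_gt0.
    * by move=> j /andP[_ jN]; rewrite /b /d rel.
    * move=> j /andP[ij jN]; rewrite /b /d.
      have h1 : 0 < alpha - j%:R by have := pb_b_gt0 jN; rewrite pmulr_lgt0.
      have h2 : alpha - j%:R <= alpha - i.+1%:R by rewrite lerB // ler_nat.
      have h3 : i.+1%:R <= j.+1%:R :> R by rewrite ler_nat ltnW.
      have pq : 0 < p * q by rewrite mulr_gt0.
      have -> : i.+1%:R * q * ((alpha - j%:R) * p) =
         i.+1%:R * (alpha - j%:R) * (p * q) by ring.
      have -> : (alpha - i.+1%:R) * p * (j.+1%:R * q) =
         j.+1%:R * (alpha - i.+1%:R) * (p * q) by ring.
      by rewrite ler_pM2r // ler_pM // ltW.
    * rewrite ler_wpM2l ?(ltW (pb_b_gt0 iN)) // lerB //.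
      by rewrite -[leRHS]Q1 [leRHS]big_ord_recr /= lerDl.
  + apply: below_rate => [|j jn|j jn|j jn].
    * by rewrite /d mul0r.
    * exact: Q0.
    * by rewrite /b /d rel //; apply: ltn_trans jn iN.
    * rewrite /b /d -natr1 /q; lra.
  + move=> x x0 xb xd; rewrite /M -[_^-1]mul1r ler_pdivlMr ?mulr_gt0 //.
    have -> : x * (alpha * p * q) = q * (x * b i.+1) + p * (x * d i.+1).
      by rewrite /b /d /q; ring.
    apply: le_trans (lerD (ler_wpM2l (ltW q0) xb) (ler_wpM2l (ltW p0) xd)) _.
    by rewrite /q; lra.
- have i1 : (i.+1 <= N)%N = false by rewrite leqNgt iN.
  have i2 : (i.+2 <= N)%N = false by rewrite leqNgt ltnS (ltnW iN).
  rewrite /pb_solution i1 i2 subSn // -[_.+1%:R]natr1.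
  have -> : - y - M * ((i.+1 - N.+1)%:R + 1) - (- y - M * (i.+1 - N.+1)%:R) = - M by ring.
  by rewrite normrN ger0_norm // ltW.
- have topE := pb_solution_top; rewrite iN {1}/pb_solution ltnn subnn mulr0 subr0.
  set g := pb_solution N in topE *.
  have Nq : 0 < N%:R * q by rewrite mulr_gt0 // ltr0n.
  have gE : g = (pi - (A N)%:R) / (N%:R * q) by rewrite -topE mulrC mulKf // gt_eqF.
  have NM : (N%:R * q)^-1 <= M.
    have apq : 0 < alpha * p * q by rewrite !mulr_gt0.
    rewrite /M lef_pV2 ?posrE // ler_pM2r //.
    by case/andP: ha => _ ha1; move: N1 (ler_wpM2l (ltW a0) ph); lra.
  apply: le_trans NM; case/andP: pb_pi01 => pi0 pi1.
  set z := (N%:R * q)^-1 in gE *; have z0 : 0 < z by rewrite invr_gt0.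
  have yz : y <= (1 - pi) * z.
    have Nq1 : 0 < (N%:R + 1) * q by rewrite mulr_gt0 //; lra.
    rewrite /y ler_wpM2l ?subr_ge0 // lef_pV2 ?posrE // ler_pM2r //; lra.
  case/andP: pb_y => y0 _.
  have pz : 0 <= pi * z by rewrite mulr_ge0 // ltW.
  rewrite gE ler_norml; move: yz; rewrite mulrBl mul1r mulrBl.
  by case: (A N); rewrite ?mul1r ?mul0r; lra.
Qed.

Lemma pb_below_line m : pb_solution m.+1 <= M * (N%:R - m%:R) - y.
Proof.
case: (leqP N m) => [Nm|mN].
  rewrite /pb_solution leqNgt ltnS Nm /= subSS natrB //.
  by rewrite le_eqVlt; apply/orP; left; apply/eqP; ring.
have topE : pb_solution N.+1 = - y by rewrite /pb_solution ltnn subnn mulr0 subr0.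
have H t : pb_solution m.+1 <= pb_solution (m + t).+1 + M * t%:R.
  elim: t => [|t IH]; first by rewrite addn0 mulr0 addr0.
  apply: le_trans IH _; rewrite addnS -natr1 mulrDr mulr1.
  by have := pb_lipschitz (m + t); rewrite ler_norml => /andP[h _]; lra.
have := H (N - m)%N; rewrite subnKC ?(ltnW mN) // topE natrB ?(ltnW mN) //; lra.
Qed.

Variables (n : nat) (s : nat -> R).
Hypotheses (s0 : forall j, 0 <= s j) (s1 : \sum_(j < n) s j = 1).
Local Notation L := (lawE n s).
Local Notation v := (law_var n s).
Hypothesis smu : law_mean n s = mu.
Variables (K1 K2 : R).
Hypothesis HE : expandable n s K1 K2.

(** The contribution of the defect at N is eps p y P(S = N), and the bound
    on e E[f(S+1)] contains - e y = - eps p y Q(N). *)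
Lemma pb_one_sided : exists2 c, 0 <= c <= eps * p / ((N%:R + 1) * q) &
  L (fun j => (A j)%:R) - pi <=
  M * (`|q * mu - v| + e * (N%:R - mu) + 2 * (K1 + p * K2)) +
  c * (L (fun j => (j == N)%:R) - Q N).
Proof.
case/andP: pb_y => y0 y1; have ep0 : 0 <= eps * p by rewrite mulr_ge0 // ltW.
exists (eps * p * y); first by rewrite mulr_ge0 //= ler_wpM2l.
have [e1 e2] := HE (second_difference pb_lipschitz).
move: e1 e2; rewrite smu; set f := pb_solution.
set G := L (fun j => f j.+2 - f j.+1) => e1 e2.
have GM : `|G| <= M by apply: ler_norm_lawE => // j; exact: pb_lipschitz.
set U := L _ in e1; set W := L _ in e2.
have step : L (fun j => (A j)%:R - pi) <=
   U - p * W + e * L (fun j => f j.+1) + eps * p * y * L (fun j => (j == N)%:R).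
  rewrite /U /W -!lawEZ -lawEB -!lawED; apply: ler_lawE => // j.
  apply: le_trans (pb_stein j) _; rewrite lerD2r -/f.
  have -> : (alpha - j%:R) * p * f j.+1 = (alpha * p - j%:R * p) * f j.+1 by ring.
  by rewrite pb_mean /q le_eqVlt; apply/orP; left; apply/eqP; ring.
rewrite lawEB (lawE_cst s1) in step; apply: le_trans step _.
have Lf : L (fun j => f j.+1) <= M * (N%:R - mu) - y.
  have <- : L (fun j => M * (N%:R - j%:R) - y) = M * (N%:R - mu) - y.
    by rewrite lawEB lawEZ lawEB !(lawE_cst s1) -smu.
  by apply: ler_lawE => // j; exact: pb_below_line.
have eLf := ler_wpM2l e0 Lf.
have h1 : U - p * W = (q * mu - v) * G + ((U - (mu - v) * G) - p * (W - mu * G)).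
  by rewrite /q; ring.
have h2 : (q * mu - v) * G <= M * `|q * mu - v|.
  apply: le_trans (ler_norm _) _; rewrite normrM mulrC.
  by rewrite ler_wpM2r.
have h3 : (U - (mu - v) * G) - p * (W - mu * G) <= M * (2 * (K1 + p * K2)).
  apply: le_trans (ler_norm _) _; apply: le_trans (ler_normB _ _) _.
  rewrite normrM (ger0_norm (ltW p0)).
  apply: le_trans (lerD e1 (ler_wpM2l (ltW p0) e2)) _.
  by rewrite le_eqVlt; apply/orP; left; apply/eqP; ring.
have -> : eps * p * y * (L (fun j => (j == N)%:R) - Q N) =
   eps * p * y * L (fun j => (j == N)%:R) - e * y by rewrite /e; ring.
by rewrite h1; move: eLf h2 h3; rewrite mulrBr !mulrDr; lra.
Qed.

End Solution.
End PseudoBinomial.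

(** * The distance to the pseudo-binomial law *)

Section PseudoBinomialBound.
Variables (R : realType) (N : nat) (alpha p : R) (Q : nat -> R).
Let q : R := 1 - p.
Let eps : R := alpha - N%:R.
Let e : R := eps * p * Q N.
Hypotheses (hp : 0 < p < 1) (hN : (0 < N)%N) (ha : N%:R <= alpha < N%:R + 1).
Hypotheses (Qp : forall i, (i <= N)%N -> 0 < Q i).
Hypotheses (Qz : forall i, (N < i)%N -> Q i = 0).
Hypotheses (Q1 : \sum_(i < N.+1) Q i = 1).
Hypothesis rel : forall i, (i < N)%N ->
  (alpha - i%:R) * p * Q i = i.+1%:R * q * Q i.+1.
Let mu : R := \sum_(i < N.+1) i%:R * Q i.
Let V : R := \sum_(i < N.+1) i%:R ^+ 2 * Q i - mu ^+ 2.
Let p0 : 0 < p. Proof. by case/andP: hp. Qed.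
Let q0 : 0 < q. Proof. by rewrite subr_gt0; case/andP: hp. Qed.
Let Q0 i : 0 <= Q i.
Proof. by case: (leqP i N) => [/Qp/ltW|/Qz ->]. Qed.
Let eps0 : 0 <= eps. Proof. by rewrite subr_ge0; case/andP: ha. Qed.
Let eps1 : eps < 1. Proof. by case/andP: ha => _; rewrite /eps; lra. Qed.
Let N1 : 1 <= N%:R :> R. Proof. by rewrite (ler_nat R 1 N). Qed.
Let a0 : 0 < alpha. Proof. by case/andP: ha; move: N1; lra. Qed.
Let e0 : 0 <= e. Proof. by rewrite mulr_ge0 // mulr_ge0 // ltW. Qed.
Let mu0 : 0 <= mu. Proof. by apply: sumr_ge0 => i _; rewrite mulr_ge0. Qed.
Let muN : mu <= N%:R. Proof. exact: (pb_mu_leN Qp Qz Q1). Qed.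

Variables (n : nat) (s : nat -> R).
Hypotheses (s0 : forall j, 0 <= s j) (s1 : \sum_(j < n) s j = 1).
Local Notation L := (lawE n s).
Local Notation v := (law_var n s).
Hypothesis smu : law_mean n s = mu.
Variables (K1 K2 Theta K2' : R).
Hypotheses (K10 : 0 <= K1) (K20 : 0 <= K2) (Th0 : 0 <= Theta).
Hypothesis HE : expandable n s K1 K2.
Hypotheses (HTheta : mu - v <= Theta) (HK2' : K2 + 2 * Theta <= K2').
Local Notation M1 := ((N%:R * p * q)^-1).

(** The defect at the state N is at most the distance to be bounded, so it can
    be absorbed: the room is the factor alpha / N between the two constants. *)
Lemma pb_tail_bound (A : pred nat) : p <= 1 / 2 -> (forall i, (N < i)%N -> A i) ->
  L (fun j => (A j)%:R) - partial_mass Q A N.+1 <=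
  M1 * (`|q * mu - v| + e * (N%:R - mu) + 2 * (K1 + p * K2)).
Proof.
move=> ph At; set X := _ + _ + _.
have X0 : 0 <= X.
  have h1 : 0 <= K1 + p * K2 by rewrite addr_ge0 // mulr_ge0 // ltW.
  have h2 : 0 <= e * (N%:R - mu) by rewrite mulr_ge0 // subr_ge0.
  by rewrite /X; apply: addr_ge0; [exact: addr_ge0 | exact: mulr_ge0].
have N0 : 0 < N%:R :> R by rewrite ltr0n.
(* the defect itself is estimated by taking for A the states from N on *)
pose A0 : pred nat := [pred i | (N <= i)%N].
have At0 i : (N < i)%N -> A0 i by exact: ltnW.
have [c /andP[c0 c1] Hc] := pb_one_sided hp hN ha Qp Qz Q1 rel At ph s0 s1 smu HE.
have [c' /andP[c0' c1'] Hc'] := pb_one_sided hp hN ha Qp Qz Q1 rel At0 ph s0 s1 smu HE.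
move: Hc Hc' c1 c1'; rewrite -/q -/eps -/e -/mu -/X.
set cm := eps * p / _; set D := L (fun j => (j == N)%:R) - Q N.
set M := (alpha * p * q)^-1 => Hc Hc' c1 c1'.
have pi0 : partial_mass Q A0 N.+1 = Q N.
  rewrite /partial_mass /A0 big_ord_recr /= leqnn mul1r big1 ?add0r // => i _ /=.
  by rewrite leqNgt ltn_ord mul0r.
have DA0 : D <= L (fun j => (A0 j)%:R) - partial_mass Q A0 N.+1.
  rewrite pi0 lerD2r; apply: (ler_lawE n s0) => j.
  by rewrite /A0 /=; case: eqP => [->|_]; rewrite ?leqnn.
have HD := le_trans DA0 Hc'.
have M0 : 0 < M by rewrite invr_gt0 !mulr_gt0.
have cm0 : 0 <= cm by apply: le_trans c0' c1'.
have cme : cm <= eps / (N%:R + 1).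
  rewrite /cm; have -> : eps * p / ((N%:R + 1) * q) = eps / (N%:R + 1) * (p / q).
    by field; rewrite gt_eqF //= gt_eqF //; lra.
  rewrite ler_piMr //; first by rewrite divr_ge0 // addr_ge0.
  by rewrite ler_pdivrMr // mul1r /q; lra.
have aN : N%:R <= alpha * (1 - cm).
  have -> : alpha = N%:R + eps by rewrite /eps; ring.
  have e1 : eps / (N%:R + 1) * (N%:R + 1) = eps by rewrite divfK // gt_eqF //; lra.
  move: cme e1; set z := eps / _ => cme e1.
  have : (N%:R + eps) * cm <= (N%:R + eps) * z by rewrite ler_wpM2l // addr_ge0.
  have : (N%:R + eps) * z <= (N%:R + 1) * z.
    by rewrite ler_wpM2r ?lerD2l ?(ltW eps1) // divr_ge0 // addr_ge0.
  lra.
have cm1 : 0 < 1 - cm by rewrite -(pmulr_rgt0 _ a0); apply: lt_le_trans aN.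
have MM1 : M <= M1 * (1 - cm).
  rewrite mulrC /M ler_pdivlMr ?mulr_gt0 // mulrC ler_pdivrMr ?mulr_gt0 //.
  have -> : (1 - cm) * (alpha * p * q) = alpha * (1 - cm) * (p * q) by ring.
  by rewrite -mulrA ler_pM2r // mulr_gt0.
rewrite -(ler_pM2r cm1).
have MX : M * X <= M1 * X * (1 - cm) by rewrite mulrAC ler_wpM2r.
apply: le_trans MX.
have [D0|D0] := leP D 0.
  have h1 : c * D <= 0 by rewrite mulr_ge0_le0.
  have h2 : L (fun j => (A j)%:R) - partial_mass Q A N.+1 <= M * X by lra.
  apply: le_trans (ler_wpM2r (ltW cm1) h2) _.
  by rewrite ler_piMr ?mulr_ge0 // ?(ltW M0) //; lra.
have h1 : c * D <= cm * D by rewrite ler_wpM2r // ltW.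
have h2 : c' * D <= cm * D by rewrite ler_wpM2r // ltW.
have h3 : L (fun j => (A j)%:R) - partial_mass Q A N.+1 <= M * X + cm * D by lra.
apply: le_trans (ler_wpM2r (ltW cm1) h3) _.
have h4 : D * (1 - cm) <= M * X by lra.
have := ler_wpM2l cm0 h4; lra.
Qed.

Lemma pb_complement (A : pred nat) :
  L (fun j => (~~ A j)%:R) - partial_mass Q (predC A) N.+1 =
  - (L (fun j => (A j)%:R) - partial_mass Q A N.+1).
Proof.
have -> : L (fun j => (~~ A j)%:R) = 1 - L (fun j => (A j)%:R).
  rewrite -[X in X - _](lawE_cst s1) -lawEB; apply: eq_lawE => j.
  by case: (A j) => /=; rewrite ?subrr ?subr0.
have -> : partial_mass Q (predC A) N.+1 = 1 - partial_mass Q A N.+1.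
  rewrite -[X in X - _]Q1 -sumrB; apply: eq_bigr => i _ /=.
  by case: (A i); rewrite ?mul1r ?mul0r ?subrr ?subr0.
ring.
Qed.

(** Adding to A the states beyond N does not change its mass, and the opposite
    inequality is the one for the complement. *)
Lemma pb_two_sided (B : R) :
  (forall A : pred nat, (forall i, (N < i)%N -> A i) ->
     L (fun j => (A j)%:R) - partial_mass Q A N.+1 <= B) ->
  forall A : pred nat, `|L (fun j => (A j)%:R) - partial_mass Q A N.+1| <= B.
Proof.
move=> H A.
have up (C : pred nat) : L (fun j => (C j)%:R) - partial_mass Q C N.+1 <= B.
  apply: le_trans (H [pred i | (N < i)%N || C i] _); last by move=> i /= ->.
  apply: lerB; first by apply: (ler_lawE n s0) => j /=; case: (C j); rewrite ?orbT.
  rewrite le_eqVlt; apply/orP; left; apply/eqP; apply: eq_bigr => i _ /=.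
  by rewrite ltnNge -ltnS ltn_ord.
by rewrite ler_norml up andbT lerNl -pb_complement; exact: (up (predC A)).
Qed.

(** For N = 1 the law Q is a Bernoulli law; the affine function that agrees with
    the indicator of A on 0 and 1 differs from it at j by at most j (j - 1). *)
Lemma pb_bernoulli (A : pred nat) : N = 1%N ->
  `|L (fun j => (A j)%:R) - partial_mass Q A N.+1| <= v - V.
Proof.
move=> NE; have Q1' := Q1; have muE : mu = Q 1%N.
  by rewrite /mu NE big_ord_recl big_ord1 /= mul0r add0r mul1r.
rewrite NE big_ord_recl big_ord1 /= in Q1'.
have VE : v - V = L (fun j => j%:R ^+ 2 - j%:R).
  have -> : V = mu - mu ^+ 2.
    congr (_ - _); apply: eq_bigr => -[[|[|i]] lti] _ /=; rewrite ?expr0n ?expr1n //.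
    by exfalso; rewrite NE in lti.
  rewrite lawEB /law_var -/(law_mean n s) smu; ring.
pose x : R := (A 0%N)%:R; pose y : R := (A 1%N)%:R.
have -> : L (fun j => (A j)%:R) - partial_mass Q A N.+1 =
    L (fun j => (A j)%:R - (x + (y - x) * j%:R)).
  rewrite lawEB lawED lawEZ (lawE_cst s1) -/(law_mean n s) smu.
  congr (_ - _); rewrite /partial_mass NE big_ord_recl big_ord1 /= -/x -/y muE.
  have -> : Q 0%N = 1 - Q 1%N by move: Q1'; lra.
  ring.
have j1 j : (2 <= j)%N -> `|(A j)%:R - (x + (y - x) * j%:R)| <= j%:R ^+ 2 - j%:R.
  move=> j2; have j2' : 2 <= j%:R :> R by rewrite (ler_nat R 2 j).
  rewrite ler_norml /x /y expr2.
  by case: (A j); case: (A 0%N); case: (A 1%N) => /=; apply/andP; split; nra.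
rewrite VE ler_norml -lawEN; apply/andP; split; apply: (ler_lawE n s0) => -[|[|j]].
- by rewrite -/x; lra.
- by rewrite -/y; lra.
- by have := j1 j.+2 isT; rewrite ler_norml => /andP[].
- by rewrite -/x; lra.
- by rewrite -/y; lra.
- by have := j1 j.+2 isT; rewrite ler_norml => /andP[].
Qed.

(** A parameter p above 1/2 makes the bound exceed 1: the variance of Q is then
    too small compared with v. *)
Lemma pb_large_p : 1 / 2 < p ->
  1 <= M1 * (2 * (K1 + p * K2') + `|V - v|).
Proof.
move=> ph; have m1 := pb_mean Q1 rel; have v1 := pb_var Q1 rel.
have N0 : 0 < N%:R :> R by rewrite ltr0n.
have Npq : 0 < N%:R * p * q by rewrite !mulr_gt0.
rewrite mulrC ler_pdivlMr // mul1r.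
have h1 : v - V <= `|V - v| by rewrite distrC ler_norm.
have h2 : 2 * Theta <= 2 * (K1 + p * K2').
  have K2'0 : 0 <= K2' by move: K20 Th0 HK2'; lra.
  have := ler_wpM2r K2'0 (ltW ph); move: K10 K20 HK2'; lra.
move: m1 v1; rewrite -/q -/eps -/e -/mu -/V => m1 v1.
have eN : 0 <= e * (N%:R - mu) by rewrite mulr_ge0 // subr_ge0.
suff : N%:R * p * q <= p * mu + e * (N%:R - mu) by move: v1 h1 h2 HTheta Th0; rewrite /q; lra.
have [le_p|le_p] := leP p (N%:R - mu).
  have h3 : e * p <= e * (N%:R - mu) by rewrite ler_wpM2l.
  have h4 : p * mu = p * (alpha * p) - e * p by rewrite m1; ring.
  have h5 : N%:R * p * q <= p * (alpha * p).
    have -> : p * (alpha * p) = alpha * p * p by ring.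
    apply: ler_pM; rewrite ?mulr_ge0 ?(ltW p0) ?(ltW q0) //.
      by rewrite ler_wpM2r ?(ltW p0) //; case/andP: ha.
    by rewrite /q; lra.
  lra.
have h3 : p * (N%:R - p) <= p * mu by rewrite ler_wpM2l ?(ltW p0) //; lra.
have h4 : 0 <= p * p * (N%:R - 1) by rewrite !mulr_ge0 ?subr_ge0 // ltW.
by rewrite /q; lra.
Qed.

Lemma pb_bound (A : pred nat) :
  `|L (fun j => (A j)%:R) - partial_mass Q A N.+1| <=
  M1 * (2 * (K1 + p * K2') + `|V - v|).
Proof.
have N0 : 0 < N%:R :> R by rewrite ltr0n.
have Npq : 0 < N%:R * p * q by rewrite !mulr_gt0.
have m1 := pb_mean Q1 rel; have v1 := pb_var Q1 rel.
move: m1 v1; rewrite -/q -/eps -/e -/mu -/V => m1 v1.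
have K2'0 : 0 <= K2' by move: K20 Th0 HK2'; lra.
have B0 : 0 <= 2 * (K1 + p * K2').
  by rewrite mulr_ge0 // addr_ge0 // mulr_ge0 // ltW.
have [ph|ph] := ltP (1 / 2) p.
  apply: le_trans (pb_large_p ph); apply: pb_two_sided A => A _.
  have h0 : 0 <= partial_mass Q A N.+1 by case/andP: (@partial_mass_le _ Q A N.+1 Q0).
  have h1 : L (fun j => (A j)%:R) <= 1.
    by rewrite -[leRHS](lawE_cst s1); apply: (ler_lawE n s0) => j; case: (A j).
  lra.
have [N2|N2] := ltnP 1 N; last first.
  have NE : N = 1%N by apply/eqP; rewrite eqn_leq N2.
  apply: le_trans (pb_bernoulli A NE) _.
  have h1 : v - V <= `|V - v| by rewrite distrC ler_norm.
  have h2 : 0 <= 2 * (K1 + p * K2') + `|V - v| by rewrite addr_ge0.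
  have h3 : 1 <= M1.
    rewrite -[leRHS]mul1r ler_pdivlMr // mul1r NE /q; have := sqr_ge0 p.
    by case/andP: hp; lra.
  have := ler_wpM2r h2 h3; lra.
apply: pb_two_sided A => A At; apply: le_trans (pb_tail_bound ph At) _.
apply: ler_wpM2l; first by rewrite invr_ge0 ltW.
have K22 : p * (K2 + 2 * Theta) <= p * K2' by rewrite ler_wpM2l // ltW.
have [f0|f0] := leP (q * mu - v) 0.
  have -> : `|V - v| = - (q * mu - v) + e * (N%:R - mu).
    have h1 : 0 <= e * (N%:R - mu) by rewrite mulr_ge0 // subr_ge0.
    by rewrite ler0_norm v1; lra.
  rewrite ler0_norm //.
  have : 0 <= p * (2 * Theta) by rewrite !mulr_ge0 // ltW.
  lra.
have h1 : q * mu - v <= `|V - v| + e * (N%:R - mu).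
  by have := ler_norm (V - v); rewrite v1; lra.
have top := pb_top hp hN ha Qp Qz Q1 rel N2.
have h2 : e * (N%:R - mu) <= 2 * (p * Theta).
  apply: le_trans (_ : _ <= p * (N%:R * Q N)) _.
    apply: le_trans (_ : _ <= e * N%:R) _; first by rewrite ler_wpM2l // gerBl.
    have -> : e * N%:R = eps * (p * (N%:R * Q N)) by rewrite /e; ring.
    by rewrite ler_piMl ?(ltW eps1) // mulr_ge0 ?(ltW p0) // mulr_ge0.
  apply: le_trans (ler_wpM2l (ltW p0) top) _; rewrite -/mu.
  have : p * mu <= Theta by move: f0 HTheta; rewrite /q; lra.
  by move=> /(ler_wpM2l (ltW p0)); lra.
by rewrite gtr0_norm //; lra.
Qed.

End PseudoBinomialBound.

(** * Variables with values in the natural numbers *)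

Lemma nneseriesP (R : realType) (u : nat -> R) (l : R) : (forall i, 0 <= u i) ->
  (\sum_(0 <= i <oo) (u i)%:E)%E = l%:E <->
  (fun n => \sum_(i < n) u i) @ \oo --> l.
Proof.
move=> u0; have c : cvgn (fun n => (\sum_(0 <= i < n) (u i)%:E)%E).
  by apply: is_cvg_nneseries => i _ _; rewrite lee_fin.
have e : (fun n => (\sum_(0 <= i < n) (u i)%:E)%E) = EFin \o (fun n => \sum_(i < n) u i).
  by apply/funext => n; rewrite sumEFin big_mkord.
split=> [H|H].
  have : (EFin \o (fun n => \sum_(i < n) u i)) @ \oo --> l%:E by rewrite -e -H.
  by move=> /fine_cvg.
by rewrite e; apply/cvg_lim => //; apply: cvg_EFin => //; exact: nearW.
Qed.

Lemma cvg_sum_finite (R : realType) (u : nat -> R) N :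
  (forall i, (N <= i)%N -> u i = 0) ->
  (fun n => \sum_(i < n) u i) @ \oo --> \sum_(i < N) u i.
Proof.
move=> uN; apply: cvg_near_cst; exists N => // n /= Nn.
rewrite -!(big_mkord xpredT u) (big_cat_nat (leq0n N) Nn) //=.
rewrite -[RHS]addr0; congr (_ + _); rewrite big_nat_cond big1 // => i /andP[/andP[Ni _] _].
exact: uN.
Qed.

Definition has_mass1 (R : realType) (Q : nat -> R) : Prop :=
  (forall m, 0 <= Q m) /\ (fun n => \sum_(i < n) Q i) @ \oo --> (1 : R).

Section NatValued.
Variables (R : realType) (d : measure_display) (T : measurableType d).
Variables (P : probability T R) (Y : T -> R) (Q : nat -> R).
Hypotheses (mY : measurable_fun setT Y) (Q1 : has_mass1 Q).
Hypothesis pmfY : forall m : nat, P (Y @^-1` [set m%:R]) = (Q m)%:E.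

Lemma measurable_fiber (m : nat) : measurable (Y @^-1` [set (m%:R : R)]).
Proof. by rewrite -[X in measurable X]setTI; exact: mY. Qed.

Lemma integral_nat (g : R -> R) : measurable_fun setT g -> (forall x, 0 <= g x) ->
  (\int[P]_t (g (Y t))%:E)%E = (\sum_(0 <= m <oo) (g m%:R * Q m)%:E)%E.
Proof.
move=> mg g0; have [Q0 Qcvg] := Q1.
pose F (m : nat) := Y @^-1` [set (m%:R : R)].
have mF m : measurable (F m) by exact: measurable_fiber.
have tF : trivIset setT F.
  apply/trivIsetP => i j _ _ ij; apply/seteqP; split => // t.
  by rewrite /F /= => -[-> /eqP]; rewrite eqr_nat (negbTE ij).
pose D := \bigcup_m F m.
have mD : measurable D by exact: bigcup_measurable.
have PD : P D = 1%E.
  rewrite measure_bigcup //; transitivity (\sum_(0 <= m <oo) (Q m)%:E)%E.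
    rewrite (@eq_eseriesl _ _ xpredT) => [|m]; last by rewrite mem_set.
    by apply: eq_eseriesr => m _; exact: pmfY.
  by apply/nneseriesP.
have mgY : measurable_fun setT (g \o Y) by exact: measurableT_comp.
have {}mgY : measurable_fun setT (EFin \o (g \o Y)) by apply/measurable_EFinP.
have PDc : P (~` D) = 0%E by rewrite probability_setC // PD subee.
have gY0 t : [set: T] t -> (0 <= (EFin \o (g \o Y)) t)%E by move=> _; rewrite /= lee_fin.
rewrite (ge0_negligible_integral (measurableC mD) measurableT mgY gY0 PDc).
rewrite setTD setCK ge0_integral_bigcup //; last 2 first.
- exact: measurable_funTS.
- by move=> t _; rewrite /= lee_fin.
apply: eq_eseriesr => m _; rewrite EFinM -pmfY -integral_cst; last exact: measurable_fiber.
by apply: eq_integral => t; rewrite inE => /= ->.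
Qed.

Lemma expectation_nat : 'E_P[Y]%E = (\sum_(0 <= m <oo) (m%:R * Q m)%:E)%E.
Proof.
have [Q0 _] := Q1.
rewrite unlock integralE.
have -> : (\int[P]_x (fun x => (Y x)%:E)^\+ x)%E =
    (\sum_(0 <= m <oo) (m%:R * Q m)%:E)%E.
  transitivity (\int[P]_t (Num.max (Y t) 0)%:E)%E.
    by apply: eq_integral => t _; rewrite funeposE -EFin_max.
  rewrite (@integral_nat (fun x => Num.max x 0)).
  - by apply: eq_eseriesr => m _; rewrite max_l.
  - by apply: measurable_maxr => //; exact: measurable_cst.
  - by move=> x; rewrite le_max lexx orbT.
have -> : (\int[P]_x (fun x => (Y x)%:E)^\- x)%E = 0%E.
  transitivity (\int[P]_t (Num.max (- Y t) 0)%:E)%E.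
    by apply: eq_integral => t _; rewrite funenegE -EFin_max.
  rewrite (@integral_nat (fun x => Num.max (- x) 0)).
  - by rewrite eseries0 // => m _ _; rewrite max_r ?mul0r // oppr_le0.
  - by apply: measurable_maxr.
  - by move=> x; rewrite le_max lexx orbT.
by rewrite sube0.
Qed.

Lemma variance_nat mu : 'E_P[Y]%E = mu%:E ->
  'V_P[Y]%E = (\sum_(0 <= m <oo) ((m%:R - mu) ^+ 2 * Q m)%:E)%E.
Proof.
move=> Emu; rewrite /variance unlock Emu /= [X in expectation.body X]/= unlock.
rewrite -(@integral_nat (fun x => (x - mu) ^+ 2)).
- by apply: eq_integral => t _; rewrite expr2.
- by apply: measurable_funX; apply: measurable_funB.
- by move=> x; exact: sqr_ge0.
Qed.

Definition intset_pred (A : set int) : pred nat := fun m => `[< A m%:Z >].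

Lemma measurable_intset (A : set int) :
  measurable ([set z%:~R | z in A] : set R).
Proof.
apply: countable_measurable; first exact: measurable_set1.
exact: card_le_trans (card_image_le _ _) (countableP _).
Qed.

Lemma fin_num_prob E : measurable E -> P E = (fine (P E))%:E.
Proof. by move=> mE; rewrite fineK // fin_num_measure. Qed.

Lemma probability_nat (A : set int) :
  (fun n => partial_mass Q (intset_pred A) n) @ \oo -->
  fine (P (Y @^-1` [set z%:~R | z in A])).
Proof.
have [Q0 _] := Q1; set B := [set _ | _ in A].
have mB : measurable B by exact: measurable_intset.
have mYB : measurable (Y @^-1` B) by rewrite -[X in measurable X]setTI; exact: mY.
rewrite /partial_mass.
apply: (proj1 (@nneseriesP R (fun i => (intset_pred A i)%:R * Q i) _ _)) => [i|].
  by rewrite mulr_ge0.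
have -> : (\sum_(0 <= i <oo) ((intset_pred A i)%:R * Q i)%:E)%E =
    (\sum_(0 <= m <oo) (\1_B m%:R * Q m)%:E)%E.
  apply: eq_eseriesr => m _; congr (_ * _)%:E; rewrite indicE; congr (_%:R).
  congr nat_of_bool; apply/idP/idP => [/asboolP Am|].
    by apply/mem_set; exists m%:Z.
  move=> /set_mem[z Az zm]; apply/asboolP.
  suff <- : z = m%:Z by [].
  by apply/eqP; rewrite -(eqr_int R) zm.
rewrite -integral_nat //.
transitivity (\int[P]_t (\1_(Y @^-1` B) t)%:E)%E; first by [].
by rewrite integral_indic // setIT -fin_num_prob.
Qed.

End NatValued.

(** * The law of the number of runs *)

Lemma word_nseq (R : comPzSemiRingType) w l k b :
  (word w l (nseq k b))%:R = \prod_(0 <= i < k) (w (l + i)%N == b)%:R :> R.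
Proof.
elim: k l => [|k IH] l; first by rewrite big_geq.
rewrite big_nat_recl //= -mulnb natrM addn0 IH; congr (_ * _).
by apply: eq_bigr => i _; rewrite addSnnS.
Qed.

Lemma probability_split (R : realType) d (T : measurableType d) (P : probability T R)
    (p : R) (A1 A0 C : set T) : measurable A1 -> measurable A0 -> measurable C ->
  A1 `&` A0 = set0 -> P A1 = p%:E -> P A0 = (1 - p)%:E ->
  P C = (P (C `&` A1) + P (C `&` A0))%E.
Proof.
move=> m1 m0 mC disj p1 p0.
have mU : measurable (A1 `|` A0) by exact: measurableU.
have PU : P (~` (A1 `|` A0)) = 0%E.
  rewrite probability_setC // measureU // [X in (1 - X)%E](_ : _ = 1%E) ?subee //.
  transitivity (p%:E + (1 - p)%:E)%E; last by rewrite -EFinD addrC subrK.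
  by congr (_ + _)%E.
have -> : P C = (P (C `\` (A1 `|` A0)) + P (C `&` (A1 `|` A0)))%E by exact: measureDI.
have -> : P (C `\` (A1 `|` A0)) = 0%E.
  have mD : measurable (C `\` (A1 `|` A0)) by exact: measurableD.
  have mU' : measurable (~` (A1 `|` A0)) by exact: measurableC.
  by apply: (subset_measure0 mD mU' _ PU) => t [].
rewrite add0e setIUr measureU //; try exact: measurableI.
by rewrite setIACA disj setI0.
Qed.

Section RunCountLaw.
Variables (R : realType) (d : measure_display) (T : measurableType d).
Variables (P : probability T R) (k1 k2 n : nat) (p : R) (eta : nat -> {RV P >-> R}).
Hypotheses (hp : 0 < p < 1) (heta : bernoulli_trials n p eta).
Hypothesis hkn : (k1 + k2 <= n)%N.
Let m := (n - (k1 + k2))%N.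
Local Notation S := (run_count k1 k2 n (fun i => eta i : T -> R)).

Lemma measurable_run_count : measurable_fun setT S.
Proof.
apply: measurable_sum => l; apply: measurable_funM; last first.
  by apply: measurable_funB => //; exact: measurable_cst.
apply: measurable_funM => //; apply: measurable_funM.
  by apply: measurable_prod => i _; apply: measurable_funB.
by apply: measurable_prod.
Qed.

Lemma run_indicator_word (w : nat -> bool) l t : (1 <= l <= m)%N -> w 0%N ->
  (forall i, (i <= n)%N -> eta i t = (w i)%:R) ->
  run_indicator k1 k2 (fun i => eta i : T -> R) l t = (isrun k1 k2 m l w)%:R.
Proof.
move=> lm w0 wt; rewrite /isrun lm /= /run_indicator.
rewrite -cats1 word_cat size_core /core_word word_cat size_nseq /= andbT.
rewrite -!mulnb !natrM !word_nseq prednK; last by case/andP: lm.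
rewrite mulrA; congr (_ * _ * _).
- rewrite wt; last by lia.
  by rewrite subn1; case: (w _).
- rewrite big_add1 /=; congr (_ * _).
    apply: eq_big_nat => i ik; rewrite wt; last by lia.
    by rewrite addnS subn1 /=; case: (w _); rewrite ?subrr ?subr0.
  rewrite big_add1 /=; apply: eq_big_nat => i ik; rewrite wt; last by lia.
  by rewrite addnS subn1 /=; case: (w _).
- by rewrite wt; [case: (w _); rewrite ?subrr ?subr0 | lia].
Qed.

Lemma run_count_cnt (w : nat -> bool) t : w 0%N ->
  (forall i, (i <= n)%N -> eta i t = (w i)%:R) ->
  S t = (run_cnt k1 k2 m predT w)%:R.
Proof.
move=> w0 wt; rewrite /run_count -/m /run_cnt big_ord_recl isrun0 add0n.
rewrite big_add1 /= big_mkord natr_sum; apply: eq_bigr => i _.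
by rewrite /= /bump /= add1n -(@run_indicator_word w _ t) //= ltnS ltn_ord.
Qed.

Let fiber (i : nat) (b : bool) : set T := eta i @^-1` [set (b%:R : R)].
Let cyl (r : seq nat) (w : nat -> bool) : set T := \bigcap_(i in [set` r]) fiber i (w i).

Lemma measurable_cyl_fiber i b : measurable (fiber i b).
Proof. by rewrite -[X in measurable X]setTI; exact: (measurable_funPT (eta i)). Qed.

Lemma probability_fiber i b : (1 <= i <= n)%N -> P (fiber i b) = (bweight p b)%:E.
Proof. by case: heta => _ H _ /H[h1 h0]; rewrite /fiber; case: b. Qed.

Lemma measurable_cyl r w : measurable (cyl r w).
Proof.
apply: fin_bigcap_measurable => // i _; exact: measurable_cyl_fiber.
Qed.

Lemma probability_cyl r w : uniq r -> (forall i, i \in r -> (1 <= i <= n)%N) ->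
  P (cyl r w) = (\prod_(i <- r) bweight p (w i))%:E.
Proof.
move=> ur hr; case: heta => _ _ ind.
rewrite /cyl /fiber (ind r (fun i => [set ((w i)%:R : R)])) //.
  rewrite -prodEFin; apply: eq_big_seq => i /hr ir.
  exact: probability_fiber.
Qed.

Lemma cyl_cons i r w b : i \notin r ->
  cyl r w `&` fiber i b = cyl (i :: r) (upd w i b).
Proof.
move=> ir; apply/seteqP; split=> t.
  move=> [rt it] j /=; rewrite inE => /orP[/eqP ->|jr]; first by rewrite /upd eqxx.
  rewrite /upd; case: eqP => [ji|_]; first by rewrite ji (negbTE ir) in jr.
  exact: rt.
move=> H; split=> [j /= jr|].
  have := H j; rewrite /= inE jr orbT => /(_ isT); rewrite /upd; case: eqP => // ji.
  by rewrite ji (negbTE ir) in jr.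
by have := H i; rewrite /= inE eqxx => /(_ isT); rewrite /upd eqxx.
Qed.

(** Conditioning on the coins one at a time turns the probability of an event
    into the iterated average [flipE]. *)
Lemma run_count_cyl (j : nat) (s r : seq nat) (w : nat -> bool) :
  w 0%N -> perm_eq (r ++ s) (iota 1 n) ->
  P (S @^-1` [set (j%:R : R)] `&` cyl r w) =
  (\prod_(i <- r) bweight p (w i) *
   flipE p s (fun w => (run_cnt k1 k2 m predT w == j)%:R) w)%:E.
Proof.
have mS : measurable (S @^-1` [set (j%:R : R)]).
  by rewrite -[X in measurable X]setTI; exact: measurable_run_count.
have range r' s' : perm_eq (r' ++ s') (iota 1 n) ->
    [/\ uniq (r' ++ s') & forall i, (i \in r' ++ s') = (1 <= i <= n)%N].
  move=> Hp; split; first by rewrite (perm_uniq Hp) iota_uniq.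
  by move=> i; rewrite (perm_mem Hp) mem_iota add1n ltnS.
elim: s r w => [|i s IH] r w w0 Hp.
  have [] := range _ _ Hp; rewrite cats0 => ur rn /=.
  have Sw t : cyl r w t -> S t = (run_cnt k1 k2 m predT w)%:R.
    move=> rt; apply: run_count_cnt => // i ni; case: i ni => [_|i ni].
      by case: heta => -> _ _; rewrite w0.
    by apply: rt; rewrite /= rn.
  case: eqP => [cj|cj].
    rewrite mulr1 setIidr; first by apply: probability_cyl => // i; rewrite rn.
    by move=> t /Sw; rewrite cj.
  rewrite mulr0 (_ : _ `&` _ = set0) ?measure0 //.
  apply/seteqP; split=> // t [/= Sj /Sw]; rewrite Sj => /eqP.
  by rewrite eqr_nat => /eqP jc; case: cj.
have [urs rn] := range _ _ Hp.
have ir : i \notin r.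
  by move: urs; rewrite cat_uniq /= negb_or => /and3P[_ /andP[]].
have i1 : (1 <= i <= n)%N by rewrite -rn mem_cat inE eqxx orbT.
have Hp' : perm_eq ((i :: r) ++ s) (iota 1 n).
  by rewrite -(permPr Hp) /= perm_sym -cat1s perm_catCA.
have step b : P (S @^-1` [set (j%:R : R)] `&` cyl r w `&` fiber i b) =
    (bweight p b * \prod_(i <- r) bweight p (w i) *
     flipE p s (fun w => (run_cnt k1 k2 m predT w == j)%:R) (upd w i b))%:E.
  rewrite -setIA cyl_cons // IH //; last first.
    by rewrite /upd; case: eqP i1 => // <-.
  congr (_%:E); congr (_ * _).
  rewrite big_cons /upd eqxx; congr (_ * _); apply: eq_big_seq => i' i'r.
  by case: eqP => // ii; rewrite ii (negbTE ir) in i'r.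
rewrite (@probability_split _ _ _ P p (fiber i true) (fiber i false)).
- rewrite !step -EFinD /= /bweight; congr (_%:E); ring.
- exact: measurable_cyl_fiber.
- exact: measurable_cyl_fiber.
- by apply: measurableI => //; exact: measurable_cyl.
- apply/seteqP; split=> // t; rewrite /fiber /= => -[-> /eqP].
  by rewrite (eqr_nat R 1 0).
- exact: (probability_fiber true).
- exact: (probability_fiber false).
Qed.

Lemma run_count_pmf (j : nat) :
  P (S @^-1` [set (j%:R : R)]) = (run_law p k1 k2 n j)%:E.
Proof.
have := @run_count_cyl j (iota 1 n) [::] (fun=> true) isT (perm_refl _).
rewrite big_nil mul1r => <-; congr (P _).
apply/seteqP; split=> t; last by case.
by move=> St; split.
Qed.

End RunCountLaw.

(** * The three approximating laws *)

Lemma natr_fact_neq0 (R : numFieldType) m : m`!%:R != 0 :> R.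
Proof. by rewrite pnatr_eq0 -lt0n fact_gt0. Qed.

Lemma poisson_pmf_gt0 (R : realType) (l : R) m : 0 < l -> 0 < poisson_pmf l m.
Proof.
by move=> l0; rewrite /poisson_pmf l0 !mulr_gt0 ?expR_gt0 ?exprn_gt0.
Qed.

Lemma poisson_pmfS (R : realType) (l : R) m : 0 < l ->
  l * poisson_pmf l m = m.+1%:R * poisson_pmf l m.+1.
Proof.
move=> l0; rewrite /poisson_pmf l0 factS natrM exprS.
by field; rewrite natr_fact_neq0 nat1r pnatr_eq0.
Qed.

Lemma poisson_mass1 (R : realType) (l : R) : 0 < l -> has_mass1 (poisson_pmf l).
Proof.
move=> l0; split=> [m|]; first exact: poisson_pmf_ge0.
have -> : (fun n => \sum_(i < n) poisson_pmf l i) =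
    (fun n => expR (- l) * series (exp_coeff l) n).
  apply/funext => n; rewrite /series /= big_mkord mulr_sumr.
  by apply: eq_bigr => i _; rewrite /poisson_pmf l0 /exp_coeff /= mulrC.
have -> : (1 : R) = expR (- l) * expR l by rewrite -expRD addNr expR0.
by apply: cvgMr; exact: is_cvg_series_exp_coeff.
Qed.

Section NegativeBinomial.
Variable R : realType.

(** The coefficients of the binomial series of (1 - x) to the power - al. *)
Definition nb_coef (al : R) (m : nat) : R := gbinom (al + m%:R - 1) m.

Lemma nb_coefE al m : nb_coef al m = (\prod_(j < m) (al + j%:R)) / m`!%:R.
Proof.
rewrite /nb_coef /gbinom; congr (_ / _).
rewrite [RHS](reindex_inj rev_ord_inj) /=; apply: eq_bigr => i _.
rewrite natrB; last exact: ltn_ord.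
by rewrite -(natr1 i); ring.
Qed.

Lemma nb_coefS al m : m.+1%:R * nb_coef al m.+1 = (al + m%:R) * nb_coef al m.
Proof.
rewrite !nb_coefE big_ord_recr /= factS natrM.
by field; rewrite natr_fact_neq0 nat1r pnatr_eq0.
Qed.

(** Absorbs the factor produced by the derivative into the parameter. *)
Lemma nb_coef_shift al m : m.+1%:R * nb_coef al m.+1 = al * nb_coef (al + 1) m.
Proof.
rewrite !nb_coefE big_ord_recl /= factS natrM addr0.
have -> : \prod_(i < m) (al + (bump 0 i)%:R) = \prod_(j < m) (al + 1 + j%:R).
  by apply: eq_bigr => i _; rewrite /bump /= natrD addrA.
by field; rewrite natr_fact_neq0 nat1r pnatr_eq0.
Qed.

Lemma nb_coef_gt0 al m : 0 < al -> 0 < nb_coef al m.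
Proof.
move=> al0; rewrite nb_coefE divr_gt0 ?ltr0n ?fact_gt0 //.
by apply: prodr_gt0 => j _; rewrite ltr_wpDr.
Qed.

Definition nb_poly (al : R) (n : nat) (x : R) : R := \sum_(i < n) nb_coef al i * x ^+ i.

Definition nb_dpoly (al : R) (n : nat) (x : R) : R :=
  \sum_(i < n) nb_coef al i * (i%:R * x ^+ i.-1).

Lemma is_derive_nb_poly al n (x : R) :
  is_derive x 1 (nb_poly al n) (nb_dpoly al n x).
Proof.
have -> : nb_poly al n = \sum_(i < n) (nb_coef al i \*: (@id R ^+ i)).
  apply/funext => y; rewrite /nb_poly fct_sumE; apply: eq_bigr => i _.
  by rewrite /=; congr (_ * _); elim: (nat_of_ord i) => [//|j IH]; rewrite !exprS IH.
apply: is_derive_sum => i; apply: is_deriveZ.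
have := is_deriveX i (is_derive_id x (1 : R)).
by rewrite /= [_ *: _]mulr1.
Qed.

(** The recursion on the coefficients is the differential equation of the
    series, up to its last term. *)
Lemma nb_ode al n x : (1 - x) * nb_dpoly al n x - al * nb_poly al n x =
  - (n%:R * nb_coef al n * x ^+ n.-1).
Proof.
elim: n => [|n IH]; first by rewrite /nb_dpoly /nb_poly !big_ord0; ring.
have rec := nb_coefS al n.
rewrite /nb_dpoly /nb_poly !big_ord_recr /= -/(nb_dpoly al n x) -/(nb_poly al n x).
have xn : n%:R * x ^+ n = n%:R * (x * x ^+ n.-1).
  by case: n {IH rec} => [|n]; rewrite ?mul0r // -exprS.
rewrite rec.
have -> : (1 - x) * (nb_dpoly al n x + nb_coef al n * (n%:R * x ^+ n.-1)) -
   al * (nb_poly al n x + nb_coef al n * x ^+ n) =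
   ((1 - x) * nb_dpoly al n x - al * nb_poly al n x) +
   nb_coef al n * (n%:R * x ^+ n.-1) - nb_coef al n * (n%:R * (x * x ^+ n.-1))
   - al * nb_coef al n * x ^+ n by ring.
by rewrite IH -xn; ring.
Qed.

(** The partial sums of the negative binomial masses, for 1 - p = x. *)
Definition nb_partial (al : R) (n : nat) (x : R) : R :=
  nb_poly al n x * (1 - x) `^ al.

Lemma is_derive_nb_partial al n (x : R) : x < 1 ->
  is_derive x 1 (nb_partial al n)
    (- (n%:R * nb_coef al n * x ^+ n.-1) * (1 - x) `^ (al - 1)).
Proof.
move=> x1; have x0 : 0 < 1 - x by rewrite subr_gt0.
have d1 : is_derive x 1 (fun y : R => 1 - y) (-1).
  have := is_deriveB (is_derive_cst (1 : R) x 1) (is_derive_id x (1 : R)).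
  by rewrite sub0r.
have d2 := @is_derive1_comp R (@powR R ^~ al) (fun y => 1 - y) x _ _
  (is_derive1_powR al x0) d1.
have d3 := is_deriveM (is_derive_nb_poly al n x) d2.
have sc (u v : R) : u *: v = u * v by [].
apply: (is_derive_eq d3); rewrite /= !sc -nb_ode.
have -> : (1 - x) `^ al = (1 - x) * (1 - x) `^ (al - 1).
  have -> : (1 - x) `^ al = (1 - x) `^ (1 + (al - 1)) by congr (_ `^ _); ring.
  rewrite (@powRD _ (1 - x) 1 (al - 1)) ?powRr1 ?(ltW x0) //.
  by rewrite (gt_eqF x0) implybT.
ring.
Qed.

Lemma nb_partial0 al n : nb_partial al n.+1 0 = 1.
Proof.
rewrite /nb_partial subr0 powR1 mulr1 /nb_poly big_ord_recl /= big1 => [|i _].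
  by rewrite nb_coefE big_ord0 expr0 fact0 divr1 addr0 mulr1.
by rewrite expr0n mulr0.
Qed.

(** The derivative of the partial sum is minus one explicit term, by [nb_ode]. *)
Lemma nb_partial_bounds al n x : 0 < al -> 0 < x < 1 ->
  0 <= 1 - nb_partial al n.+1 x <= n.+1%:R * nb_coef al n.+1 * x ^+ n.+1 / (1 - x).
Proof.
move=> al0 /andP[x0 x1].
have [c||] := @MVT R (nb_partial al n.+1)
  (fun x => - (n.+1%:R * nb_coef al n.+1 * x ^+ n.+1.-1) * (1 - x) `^ (al - 1)) 0 x x0.
- by rewrite in_itv /= => /andP[_ cx]; apply: is_derive_nb_partial; exact: lt_trans x1.
- apply: derivable_within_continuous => c; rewrite in_itv /= => /andP[_ cx].
  by apply: ex_derive; apply: is_derive_nb_partial; exact: le_lt_trans x1.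
move=> c; rewrite in_itv /= => /andP[c0 cx]; rewrite nb_partial0 subr0 => E.
have c1 : 0 < 1 - c by rewrite subr_gt0 (lt_trans cx).
set K := n.+1%:R * nb_coef al n.+1 in E *.
have K0 : 0 <= K by rewrite mulr_ge0 // ltW // nb_coef_gt0.
clearbody K.
have -> : 1 - nb_partial al n.+1 x = K * c ^+ n * (1 - c) `^ (al - 1) * x.
  have -> : 1 - nb_partial al n.+1 x = - (nb_partial al n.+1 x - 1) by ring.
  by rewrite E; ring.
have pw : 0 <= (1 - c) `^ (al - 1) <= (1 - x)^-1.
  have -> : (1 - c) `^ (al - 1) = (1 - c) `^ al / (1 - c).
    by rewrite (@powRB _ (1 - c) al 1) ?powRr1 ?(ltW c1) // (gt_eqF c1) implybT.
  rewrite divr_ge0 ?powR_ge0 ?(ltW c1) //=.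
  have h1 : (1 - c) `^ al <= 1.
    rewrite -[leRHS](_ : 1 `^ al = 1); last by rewrite powR1.
    apply: ge0_ler_powR; [exact: ltW | by rewrite nnegrE ltW | by rewrite nnegrE|].
    by rewrite gerBl ltW.
  apply: le_trans (_ : _ <= 1 * (1 - c)^-1) _; first by rewrite ler_wpM2r // invr_ge0 ltW.
  by rewrite mul1r lef_pV2 ?posrE ?c1 ?subr_gt0 ?(lt_trans cx) // lerD2l lerN2 ltW.
case/andP: pw => pw0 pw1; apply/andP; split.
  by rewrite !mulr_ge0 ?exprn_ge0 ?(ltW c0) ?(ltW x0).
have -> : K * x ^+ n.+1 / (1 - x) = K * x ^+ n * (1 - x)^-1 * x by rewrite exprSr; ring.
rewrite ler_wpM2r ?(ltW x0) // ler_pM // ?mulr_ge0 ?exprn_ge0 ?(ltW c0) //.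
by rewrite ler_wpM2l // lerXn2r ?nnegrE ?ltW.
Qed.

Lemma nb_coef_expr_le al n x : 0 < al -> 0 < x < 1 ->
  nb_coef al n * x ^+ n <= ((1 - x) `^ al)^-1.
Proof.
move=> al0 x01; case/andP: (x01) => x0 x1.
have w0 : 0 < (1 - x) `^ al by rewrite powR_gt0 // subr_gt0.
have /andP[h _] := nb_partial_bounds n al0 x01.
rewrite -[leRHS]mul1r ler_pdivlMr //; rewrite subr_ge0 in h; apply: le_trans h.
rewrite ler_wpM2r ?(ltW w0) // /nb_poly big_ord_recr /= lerDr.
by apply: sumr_ge0 => i _; rewrite mulr_ge0 ?exprn_ge0 // ltW // nb_coef_gt0.
Qed.

Lemma nb_partial_cvg al x : 0 < al -> 0 < x < 1 ->
  nb_partial al ^~ x @ \oo --> (1 : R).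
Proof.
move=> al0 x01; case/andP: (x01) => x0 x1.
(* any point between x and 1 gives a geometric rate x / y *)
pose y := (1 + x) / 2; have y01 : 0 < y < 1 by rewrite /y; apply/andP; split; lra.
case/andP: (y01) => y0 y1.
have xy : x / y < 1 by rewrite ltr_pdivrMr // mul1r /y; lra.
have t0 : 0 <= x / y by rewrite divr_ge0 ?ltW.
clearbody y.
pose C := al * x * ((1 - y) `^ (al + 1))^-1 / (1 - x).
rewrite -cvg_shiftS.
have lim0 : (fun n => 1 - geometric C (x / y) n) @ \oo --> (1 : R).
  have xy' : `|x / y| < 1 by rewrite ger0_norm.
  have := cvgB (cvg_cst (1 : R)) (@cvg_geometric R C (x / y) xy').
  by rewrite subr0; apply.
apply: (squeeze_cvgr _ lim0 (cvg_cst (1 : R))).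
apply: nearW => n /=.
have /andP[h0 h1] := nb_partial_bounds n al0 x01.
have al1 : 0 < al + 1 by rewrite addr_gt0.
have hc := nb_coef_expr_le n al1 y01.
suff : n.+1%:R * nb_coef al n.+1 * x ^+ n.+1 / (1 - x) <= C * (x / y) ^+ n.
  by move=> h2; apply/andP; split; lra.
rewrite nb_coef_shift /C.
have -> : al * nb_coef (al + 1) n * x ^+ n.+1 / (1 - x) =
   al * x * (nb_coef (al + 1) n * y ^+ n) / (1 - x) * (x / y) ^+ n.
  have yn : y ^+ n != 0 by rewrite expf_neq0 // gt_eqF.
  rewrite exprS expr_div_n; move: (nb_coef _ _) (y ^+ n) (x ^+ n) yn => w u v u0; field.
  by rewrite u0 /= subr_eq0 eq_sym lt_eqF.
rewrite ler_wpM2r ?exprn_ge0 // ler_wpM2r ?invr_ge0 ?subr_ge0 ?(ltW x1) //.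
by rewrite ler_wpM2l // mulr_ge0 // ltW.
Qed.

Variables (al p : R).
Hypotheses (al0 : 0 < al) (hp : 0 < p < 1).

Lemma negative_binomial_pmf_gt0 m : 0 < negative_binomial_pmf al p m.
Proof.
case/andP: hp => p0 p1.
apply: mulr_gt0; last by rewrite exprn_gt0 // subr_gt0.
by apply: mulr_gt0; [exact: nb_coef_gt0 | exact: powR_gt0].
Qed.

Lemma negative_binomial_pmfS m : (1 - p) * (al + m%:R) * negative_binomial_pmf al p m =
  m.+1%:R * negative_binomial_pmf al p m.+1.
Proof.
rewrite /negative_binomial_pmf -!/(nb_coef _ _) exprS.
have := nb_coefS al m; set x := nb_coef al m.+1; set y := nb_coef al m => e.
have -> : m.+1%:R * (x * p `^ al * ((1 - p) * (1 - p) ^+ m)) =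
  m.+1%:R * x * p `^ al * ((1 - p) * (1 - p) ^+ m) by ring.
by rewrite e; ring.
Qed.

Lemma negative_binomial_mass1 : has_mass1 (negative_binomial_pmf al p).
Proof.
split=> [m|]; first exact: ltW (negative_binomial_pmf_gt0 m).
case/andP: hp => p0 p1.
have q01 : 0 < 1 - p < 1 by apply/andP; split; lra.
have := nb_partial_cvg al0 q01.
rewrite (_ : nb_partial al ^~ (1 - p) =
  (fun n => \sum_(i < n) negative_binomial_pmf al p i)) //.
have e : 1 - (1 - p) = p by ring.
apply/funext => n; rewrite /nb_partial /nb_poly e mulr_suml.
by apply: eq_bigr => i _; rewrite /negative_binomial_pmf -/(nb_coef _ _); ring.
Qed.

End NegativeBinomial.

(** The recursion m Q m = (A + B (m - 1)) Q (m - 1) gives linear equations for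
    the first two moments. *)
Section LinearRates.
Variables (R : realType) (Q : nat -> R) (A B mu : R).
Hypothesis Q1 : has_mass1 Q.
Hypothesis rel : forall m, (A + B * m%:R) * Q m = m.+1%:R * Q m.+1.
Hypothesis Qmu : (fun n => \sum_(i < n) i%:R * Q i) @ \oo --> mu.

Lemma cvg_uniqueR (u : nat -> R) (x y : R) :
  u @ \oo --> x -> u @ \oo --> y -> x = y.
Proof. by move=> ux uy; rewrite -(cvg_lim _ ux) // -(cvg_lim _ uy). Qed.

Lemma linear_rate_mean : mu = A + B * mu.
Proof.
have [_ cQ] := Q1.
have h : (fun n => \sum_(i < n.+1) i%:R * Q i) @ \oo --> mu.
  by move: Qmu; rewrite -cvg_shiftS.
apply: cvg_uniqueR h _.
have -> : (fun n => \sum_(i < n.+1) i%:R * Q i) =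
    (fun n => A * \sum_(i < n) Q i + B * \sum_(i < n) i%:R * Q i).
  apply/funext => n; rewrite big_ord_recl mul0r add0r !mulr_sumr -big_split /=.
  by apply: eq_bigr => i _; rewrite /bump /= add1n -rel; ring.
rewrite -{2}[A]mulr1; apply: cvgD; exact: cvgMr.
Qed.

Lemma linear_rate_var (V : R) :
  (fun n => \sum_(i < n) (i%:R - mu) ^+ 2 * Q i) @ \oo --> V -> V * (1 - B) = mu.
Proof.
move=> cV; have [_ cQ] := Q1; have m1 := linear_rate_mean.
have cS : (fun n => \sum_(i < n) i%:R ^+ 2 * Q i) @ \oo -->
    V + 2 * mu * mu - mu ^+ 2 * 1.
  have -> : (fun n => \sum_(i < n) i%:R ^+ 2 * Q i) =
      (fun n => \sum_(i < n) (i%:R - mu) ^+ 2 * Q i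
         + 2 * mu * (\sum_(i < n) i%:R * Q i) - mu ^+ 2 * \sum_(i < n) Q i).
    apply/funext => n; rewrite !mulr_sumr -big_split -sumrB /=.
    by apply: eq_bigr => i _; ring.
  by apply: cvgB; [apply: cvgD => //; exact: cvgMr | exact: cvgMr].
have h : (fun n => \sum_(i < n.+1) i%:R ^+ 2 * Q i) @ \oo -->
    V + 2 * mu * mu - mu ^+ 2 * 1.
  by move: cS; rewrite -cvg_shiftS.
have h' : (fun n => \sum_(i < n.+1) i%:R ^+ 2 * Q i) @ \oo -->
    B * (V + 2 * mu * mu - mu ^+ 2 * 1) + (A + B) * mu + A * 1.
  have -> : (fun n => \sum_(i < n.+1) i%:R ^+ 2 * Q i) =
    (fun n => B * (\sum_(i < n) i%:R ^+ 2 * Q i) + (A + B) * (\sum_(i < n) i%:R * Q i)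
       + A * \sum_(i < n) Q i).
    apply/funext => n; rewrite big_ord_recl expr0n mul0r add0r !mulr_sumr -!big_split /=.
    apply: eq_bigr => i _; rewrite /bump /= add1n expr2 -mulrA -rel -natr1; ring.
  by apply: cvgD; [apply: cvgD; exact: cvgMr | exact: cvgMr].
have := cvg_uniqueR h h' => e1.
have muA : mu * (1 - B) = A by move: m1; lra.
have : mu * (mu * (1 - B)) = mu * A by rewrite muA.
by move: e1 m1; lra.
Qed.

End LinearRates.

Section PseudoBinomialPmf.
Variables (R : realType) (al p : R).
Hypotheses (al0 : 0 < al) (hp : 0 < p < 1).
Let N := Num.truncn al.
Local Notation W := (pseudo_binomial_weight al p).
Local Notation Q := (pseudo_binomial_pmf al p).

Lemma trunc_bounds : N%:R <= al < N%:R + 1.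
Proof. by rewrite natr1; apply: truncn_itv; exact: ltW. Qed.

Lemma pb_weight_gt0 i : (i <= N)%N -> 0 < W i.
Proof.
case/andP: hp => p0 p1 iN.
apply: mulr_gt0; last by rewrite powR_gt0 // subr_gt0.
apply: mulr_gt0; last exact: exprn_gt0.
rewrite /gbinom divr_gt0 ?ltr0n ?fact_gt0 //; apply: prodr_gt0 => j _.
rewrite subr_gt0; apply: lt_le_trans (_ : i%:R <= _); first by rewrite ltr_nat.
by case/andP: trunc_bounds => h _; apply: le_trans h; rewrite ler_nat.
Qed.

Lemma pb_weightS i : (al - i%:R) * p * W i = i.+1%:R * (1 - p) * W i.+1.
Proof.
case/andP: hp => p0 p1; have q0 : 0 < 1 - p by rewrite subr_gt0.
rewrite /pseudo_binomial_weight /gbinom big_ord_recr /= factS natrM exprS.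
have -> : (1 - p) `^ (al - i%:R) = (1 - p) * (1 - p) `^ (al - i.+1%:R).
  rewrite -{2}[1 - p]powRr1 ?(ltW q0) // -powRD ?(gt_eqF q0) ?implybT //.
  by congr (_ `^ _); rewrite -natr1; ring.
by field; rewrite natr_fact_neq0 nat1r pnatr_eq0.
Qed.

Lemma pb_norm_gt0 : 0 < \sum_(0 <= j < N.+1) W j.
Proof.
rewrite big_mkord (bigD1 ord0) //= ltr_wpDr ?pb_weight_gt0 //.
by apply: sumr_ge0 => j _; rewrite ltW // pb_weight_gt0 // -ltnS.
Qed.

Lemma pb_pmf_gt0 i : (i <= N)%N -> 0 < Q i.
Proof.
move=> iN; rewrite /pseudo_binomial_pmf iN.
by apply: divr_gt0; [exact: pb_weight_gt0 | exact: pb_norm_gt0].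
Qed.

Lemma pb_pmf_gtN i : (N < i)%N -> Q i = 0.
Proof. by move=> Ni; rewrite /pseudo_binomial_pmf leqNgt Ni. Qed.

Lemma pb_pmf_sum : \sum_(i < N.+1) Q i = 1.
Proof.
have z := pb_norm_gt0; rewrite big_mkord in z.
rewrite -[RHS](divff (lt0r_neq0 z)) mulr_suml; apply: eq_bigr => i _.
by rewrite /pseudo_binomial_pmf -ltnS ltn_ord big_mkord.
Qed.

Lemma pb_pmfS i : (i < N)%N -> (al - i%:R) * p * Q i = i.+1%:R * (1 - p) * Q i.+1.
Proof.
move=> iN; rewrite /pseudo_binomial_pmf iN (ltnW iN).
by rewrite [LHS]mulrA [RHS]mulrA pb_weightS.
Qed.

Lemma pb_pmf_mass1 : has_mass1 Q.
Proof.
split=> [m|].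
  by case: (leqP m N) => [/pb_pmf_gt0/ltW //|/pb_pmf_gtN ->].
by rewrite -pb_pmf_sum; apply: cvg_sum_finite => i Ni; exact: pb_pmf_gtN.
Qed.

End PseudoBinomialPmf.

(** * The three distance bounds *)

Lemma dTV_le (R : realType) (d1 d2 : measure_display) (T1 : measurableType d1)
    (T2 : measurableType d2) (P1 : probability T1 R) (P2 : probability T2 R)
    (X : T1 -> R) (Y : T2 -> R) (B : R) :
  measurable_fun setT X -> measurable_fun setT Y ->
  (forall A : set int, `|fine (P2 (Y @^-1` [set z%:~R | z in A])) -
     fine (P1 (X @^-1` [set z%:~R | z in A]))| <= B) ->
  (dTV P1 P2 X Y <= B%:E)%E.
Proof.
move=> mX mY H; apply: ge_ereal_sup => _ [A _ <-].
have mA : measurable ([set z%:~R | z in A] : set R) by exact: measurable_intset.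
have m1 : measurable (X @^-1` [set z%:~R | z in A]).
  by rewrite -[X in measurable X]setTI; exact: mX.
have m2 : measurable (Y @^-1` [set z%:~R | z in A]).
  by rewrite -[X in measurable X]setTI; exact: mY.
by rewrite (fin_num_prob P1 m1) (fin_num_prob P2 m2) -EFinB abse_EFin lee_fin distrC.
Qed.

(** An infinite variance makes the right side infinite. *)
Lemma le_variance_bound (R : realType) (x V : \bar R) (v c b t : R) :
  (0 <= V)%E -> 0 < c -> 0 < t ->
  (forall w : R, V = w%:E -> (x <= (c * (b + t * `|w - v|))%:E)%E) ->
  (x <= c%:E * (b%:E + t%:E * `|V - v%:E|))%E.
Proof.
case: V => [w| |] // _ c0 t0 H.
  by rewrite -EFinB abse_EFin -EFinM; exact: H.
by rewrite /= gt0_muley ?lte_fin // addey // gt0_muley ?lte_fin // leey.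
Qed.

Lemma partial_mass_sandwich (R : realType) (Q : nat -> R) (A : pred nat) (pi : R) n :
  has_mass1 Q -> partial_mass Q A @ \oo --> pi ->
  partial_mass Q A n <= pi <= partial_mass Q A n + (1 - \sum_(i < n) Q i).
Proof.
move=> [Q0 Q1] Hpi; apply/andP; split.
  rewrite -(cvg_lim _ Hpi) //; apply: limr_ge; first exact: cvgP Hpi.
  exists n => // n' /= nn'.
  rewrite /partial_mass -!(big_mkord xpredT (fun i => (A i)%:R * Q i)).
  rewrite (big_cat_nat (leq0n n) nn') //= lerDl.
  by apply: sumr_ge0 => i _; rewrite mulr_ge0.
have C : (fun n' => partial_mass Q A n + (\sum_(i < n') Q i - \sum_(i < n) Q i)) @ \oo
    --> partial_mass Q A n + (1 - \sum_(i < n) Q i).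
  apply: cvgD; first exact: cvg_cst.
  by apply: cvgB => //; exact: cvg_cst.
apply: (ler_cvg_to Hpi C); exists n => // n' /= nn'.
rewrite /partial_mass -!(big_mkord xpredT (fun i => (A i)%:R * Q i)).
rewrite -!(big_mkord xpredT Q) !(big_cat_nat (leq0n n) nn') //= lerD2l addrAC subrr add0r.
by apply: ler_sum => i _; case: (A i); rewrite ?mul1r ?mul0r.
Qed.

Section Assembly.
Variables (R : realType) (d : measure_display) (T : measurableType d).
Variables (P : probability T R) (k1 k2 n : nat) (p : R) (eta : nat -> {RV P >-> R}).
Hypotheses (hk1 : (1 <= k1)%N) (hk2 : (1 <= k2)%N) (hp : 0 < p < 1).
Hypotheses (heta : bernoulli_trials n p eta) (hn : (5 * (k1 + k2) <= n)%N).
Let k := (k1 + k2)%N.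
Let q : R := 1 - p.
Let a : R := a_run k1 k2 p.
Let m := (n - k)%N.
Let s := run_law p k1 k2 n.
Local Notation S := (run_count k1 k2 n (fun i => eta i : T -> R)).
Local Notation L := (lawE m.+1 s).
Local Notation mu := (law_mean m.+1 s).
Local Notation v := (law_var m.+1 s).
Let hkn : (k1 + k2 <= n)%N. Proof. by apply: leq_trans hn; rewrite leq_pmull. Qed.
Let s0 : forall j, 0 <= s j := run_law_ge0 k1 k2 n hp.
Let s1 : \sum_(j < m.+1) s j = 1 := sum_run_law p k1 k2 n.
Let a0 : 0 < a := a_gt0 k1 k2 hp.
Let mS : measurable_fun setT S. Proof. exact: measurable_run_count. Qed.

Let sz j : (m.+1 <= j)%N -> s j = 0.
Proof.
move=> mj; rewrite /s /run_law (@eq_flipE _ _ _ _ (fun=> 0)) ?flipE_cst // => w.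
have := run_cnt_lt k1 k2 n w; case: eqP => // -> jm.
by move: mj; rewrite leqNgt jm.
Qed.

Let s_mass1 : has_mass1 s.
Proof. by split=> //; rewrite -s1; exact: cvg_sum_finite. Qed.

Let pmfS : forall j : nat, P (S @^-1` [set j%:R]) = (s j)%:E.
Proof. exact: run_count_pmf. Qed.

Let cvg_law (g : nat -> R) : (fun n => \sum_(i < n) g i * s i) @ \oo --> L g.
Proof.
rewrite /lawE; apply: (@cvg_sum_finite R (fun i => g i * s i) m.+1) => i /sz ->.
by rewrite mulr0.
Qed.

Lemma run_expectation : 'E_P[S]%E = mu%:E.
Proof.
rewrite (expectation_nat mS s_mass1 pmfS); apply/nneseriesP => [i|].
  by rewrite mulr_ge0.
exact: cvg_law.
Qed.

Lemma run_variance : 'V_P[S]%E = v%:E.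
Proof.
rewrite (variance_nat mS s_mass1 pmfS run_expectation); apply/nneseriesP => [i|].
  by rewrite mulr_ge0 ?sqr_ge0.
have -> : v = L (fun i => (i%:R - mu) ^+ 2).
  have -> : L (fun i => (i%:R - mu) ^+ 2) =
     L (fun i => i%:R ^+ 2 - 2 * mu * i%:R + mu ^+ 2).
    by apply: eq_lawE => i; ring.
  rewrite lawED lawEB lawEZ (lawE_cst s1) -/(law_mean _ _) /law_var; ring.
exact: cvg_law.
Qed.

Lemma run_probability (A : set int) :
  fine (P (S @^-1` [set z%:~R | z in A])) = L (fun j => (intset_pred A j)%:R).
Proof.
apply: cvg_uniqueR (@probability_nat _ _ _ _ _ _ mS s_mass1 pmfS A) _.
exact: (@cvg_law (fun j => (intset_pred A j)%:R)).
Qed.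

Let K1 : R := m%:R * (kappa1 R k1 k2 * a ^+ 3).
Let K2 : R := m%:R * (a ^+ 2 * (k%:R + 7) / 2).
Let Theta : R := m%:R * (a ^+ 2 * (k%:R + 3) / 2).
Let H1 : R := (2 + q * p) * h1 n k p * a ^+ 3.
Let H2 : R := (2 + q * p) * h2 n k p * a ^+ 2.

Lemma run_expandable : expandable m.+1 s K1 K2.
Proof.
move=> f D2 fD.
have e (j : nat) : j%:R * f j.-1.+1 = j%:R * f j by case: j => [|j]; rewrite ?mul0r.
split.
  have := run_stein_expansion hk1 hk2 hp hkn (h := fun i => f i.+1) fD.
  by rewrite -lawEZ -lawEB (eq_lawE _ _ (h := fun j => mu * f j.+1 - j%:R * f j)) // => j;
    rewrite e.
have := run_size_bias_expansion hk1 hk2 hp hkn (h := fun i => f i.+1) fD.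
rewrite (eq_lawE _ _ (h := fun j => j%:R * (f j.+1 - f j))) // => j.
by rewrite !mulrBr e; case: j => [|j]; rewrite ?mul0r.
Qed.

Let qp0 : 0 <= q * p.
Proof. by case/andP: hp => p0 p1; rewrite mulr_ge0 ?subr_ge0 // ltW. Qed.

Lemma K1_ge0 : 0 <= K1.
Proof.
rewrite /K1 mulr_ge0 // mulr_ge0 ?exprn_ge0 ?(ltW a0) // /kappa1.
by rewrite !addr_ge0 ?divr_ge0 ?mulr_ge0 ?exprn_ge0 ?addr_ge0 ?mulr_ge0.
Qed.

Lemma K1_le : 2 * K1 <= 2 * H1.
Proof.
have h := h1_ge hk1 hk2 hp hn.
have a3 : 0 <= a ^+ 3 by rewrite exprn_ge0 // ltW.
have h0 : 0 <= h1 n k p.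
  have : 0 <= m%:R * kappa1 R k1 k2.
    rewrite mulr_ge0 // /kappa1.
    by rewrite !addr_ge0 ?divr_ge0 ?mulr_ge0 ?exprn_ge0 ?addr_ge0 ?mulr_ge0.
  by move: h; rewrite -/k -/m; lra.
rewrite ler_wpM2l // /K1 /H1 mulrA ler_wpM2r //; apply: le_trans h _.
by rewrite ler_wpM2r // lerDl.
Qed.

Lemma K2_le : K2 + 2 * Theta <= H2.
Proof.
have h := h2_ge hk1 hk2 hp hn; rewrite -/k -/m in h.
have a2 : 0 <= a ^+ 2 by rewrite exprn_ge0 // ltW.
have h0 : 0 <= h2 n k p.
  have : 0 <= m%:R * (2 * k%:R + 8) :> R by rewrite mulr_ge0 // addr_ge0 // mulr_ge0.
  by move: h; lra.
apply: le_trans (_ : _ <= m%:R * (2 * k%:R + 8) * a ^+ 2) _.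
  have : 0 <= m%:R * a ^+ 2 * (k%:R / 2 + 3 / 2) :> R.
    by apply: mulr_ge0; [exact: mulr_ge0 | apply: addr_ge0; exact: divr_ge0].
  rewrite /K2 /Theta; lra.
rewrite /H2 ler_wpM2r //; apply: le_trans h _.
by rewrite ler_wpM2r // lerDl.
Qed.

Lemma Theta_ge0 : 0 <= Theta.
Proof. by rewrite /Theta mulr_ge0 // divr_ge0 // mulr_ge0 ?addr_ge0 // exprn_ge0 // ltW. Qed.

Lemma K2_ge0 : 0 <= K2.
Proof. by rewrite /K2 mulr_ge0 // divr_ge0 // mulr_ge0 ?addr_ge0 // exprn_ge0 // ltW. Qed.

Lemma run_mean_pos : 0 < mu.
Proof.
apply: run_mean_gt0 => //; rewrite -/k -/m /m leq_subRL; last exact: hkn.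
by move: hn hk1 hk2; rewrite -/k /k; lia.
Qed.

(** B = 0 is the Poisson law and B = 1 - p3, A = alpha B the negative binomial
    law. *)
Lemma linear_rate_bound (d1 : measure_display) (T1 : measurableType d1)
    (P1 : probability T1 R) (X : {RV P1 >-> R}) (Q : nat -> R) (A B M : R) :
  has_pmf X Q -> has_mass1 Q -> (forall i, 0 < Q i) -> 0 <= B < 1 -> 0 < A ->
  (forall i, (A + B * i%:R) * Q i = i.+1%:R * Q i.+1) ->
  (forall (i : nat) (x : R), 0 <= x -> x * (A + B * i.+1%:R) <= 1 ->
     x * i.+1%:R <= 1 -> x <= M) ->
  0 < M -> 'E_P1[X]%E = 'E_P[S]%E ->
  (dTV P1 P X S <=
     M%:E * ((2 * ((1 - B) * H1 + B * H2))%:E +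
             (1 - B)%:E * `|'V_P1[X] - 'V_P[S]|))%E.
Proof.
move=> pmfX mass Qp /andP[B0 B1] A0 rel HM M0 EX.
have mX : measurable_fun setT X by [].
rewrite run_expectation in EX; rewrite run_variance.
have cmu : (fun n => \sum_(i < n) i%:R * Q i) @ \oo --> mu.
  apply: (proj1 (@nneseriesP R (fun i => i%:R * Q i) mu _)) => [i|].
    by rewrite mulr_ge0 // ltW.
  by rewrite -(expectation_nat mX mass pmfX).
have muE := linear_rate_mean mass rel cmu.
apply: le_variance_bound; [exact: variance_ge0 | by [] | by rewrite subr_gt0 |].
move=> V VX; have cV : (fun n => \sum_(i < n) (i%:R - mu) ^+ 2 * Q i) @ \oo --> V.
  apply: (proj1 (@nneseriesP R (fun i => (i%:R - mu) ^+ 2 * Q i) V _)) => [i|].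
    by rewrite mulr_ge0 ?sqr_ge0 // ltW.
  by rewrite -(variance_nat mX mass pmfX EX).
have VE := linear_rate_var mass rel cmu cV.
apply: dTV_le => // C; rewrite run_probability.
set pi := fine _.
have Hpi : partial_mass Q (intset_pred C) @ \oo --> pi.
  exact: probability_nat mX mass pmfX C.
have [f [fE fM]] : exists f : nat -> R,
    (forall j, (A + B * j%:R) * f j.+1 - j%:R * f j = (intset_pred C j)%:R - pi) /\
    (forall j, `|f j.+2 - f j.+1| <= M).
  apply: (@birth_death_stein R Q (fun i => A + B * i%:R) (fun i => i%:R)) => //.
  - by move=> i; rewrite ltr_pwDl // mulr_ge0.
  - by move=> i; rewrite -natr1; lra.
  - move=> j i ij; have ij' : j%:R <= i%:R :> R by rewrite ler_nat.
    have h1 : A * j%:R <= A * i%:R by rewrite ler_wpM2l // ltW.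
    have h2 : 0 <= B * j%:R by rewrite mulr_ge0.
    by rewrite -natr1; nra.
  - by case: mass.
  - by move=> j; exact: partial_mass_sandwich.
have B01 : 0 <= B <= 1 by rewrite B0 ltW.
have AE : A = (1 - B) * mu by move: muE; lra.
have := linear_stein_bound s0 s1 run_expandable B01 AE fM.
rewrite (@eq_lawE _ _ _ _ (fun j => (intset_pred C j)%:R - pi)); last exact: fE.
rewrite lawEB (lawE_cst s1) => H; apply: le_trans H _.
apply: ler_wpM2l; first exact: ltW.
have -> : mu - (1 - B) * v = (1 - B) * (V - v) by rewrite -{1}VE; ring.
have B1' : 0 <= 1 - B by lra.
rewrite normrM (ger0_norm B1') addrC lerD2r.
have h1 := K1_le; have h2 := K2_le; have h3 := Theta_ge0.
have h4 : (1 - B) * K1 <= (1 - B) * H1 by rewrite ler_wpM2l //; lra.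
have h5 : B * K2 <= B * H2 by rewrite ler_wpM2l //; lra.
lra.
Qed.

Lemma poisson_bound (d1 : measure_display) (T1 : measurableType d1)
    (P1 : probability T1 R) (X : {RV P1 >-> R}) (l : R) :
  0 < l -> has_pmf X (poisson_pmf l) -> 'E_P1[X]%E = 'E_P[S]%E ->
  (dTV P1 P X S <= ((Num.max 1 l)^-1)%:E *
     ((2 * H1)%:E + `|'V_P1[X] - 'V_P[S]|))%E.
Proof.
move=> l0 pmfX EX.
have := @linear_rate_bound _ _ _ X (poisson_pmf l) l 0 (Num.max 1 l)^-1 pmfX
  (poisson_mass1 l0) (fun i => poisson_pmf_gt0 i l0).
rewrite subr0 mul1r mul0r addr0 mul1e; apply => //.
- by rewrite lexx ltr01.
- by move=> i; rewrite mul0r addr0 poisson_pmfS.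
- move=> i x x0; rewrite mul0r addr0 => xl xi.
  rewrite -[_^-1]mul1r ler_pdivlMr; last by rewrite lt_max ltr01.
  case: (leP 1 l) => _ //; rewrite mulr1; apply: le_trans xi.
  by rewrite ler_peMr // (ler_nat R 1).
- by rewrite invr_gt0 lt_max ltr01.
Qed.

Lemma negative_binomial_bound (d3 : measure_display) (T3 : measurableType d3)
    (P3 : probability T3 R) (X : {RV P3 >-> R}) (al p3 : R) :
  0 < al -> 0 < p3 < 1 -> has_pmf X (negative_binomial_pmf al p3) ->
  'E_P3[X]%E = 'E_P[S]%E ->
  (dTV P3 P X S <= ((al * (1 - p3))^-1)%:E *
     ((2 * (p3 * H1 + (1 - p3) * H2))%:E + p3%:E * `|'V_P3[X] - 'V_P[S]|))%E.
Proof.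
move=> al0 hp3 pmfX EX; case/andP: (hp3) => p30 p31.
have q30 : 0 < 1 - p3 by rewrite subr_gt0.
have q3 : 1 - (1 - p3) = p3 by ring.
have := @linear_rate_bound _ _ _ X (negative_binomial_pmf al p3)
  (al * (1 - p3)) (1 - p3) (al * (1 - p3))^-1 pmfX
  (negative_binomial_mass1 al0 hp3) (negative_binomial_pmf_gt0 al0 hp3).
rewrite q3; apply => //.
- by apply/andP; split; lra.
- exact: mulr_gt0.
- move=> i; rewrite -negative_binomial_pmfS //; ring.
- move=> i x x0 xb _; rewrite -[_^-1]mul1r ler_pdivlMr ?mulr_gt0 //.
  apply: le_trans xb; rewrite ler_wpM2l // lerDl mulr_ge0 //; exact: ltW.
- by rewrite invr_gt0 mulr_gt0.
Qed.

Lemma pseudo_binomial_bound (d2 : measure_display) (T2 : measurableType d2)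
    (P2 : probability T2 R) (X : {RV P2 >-> R}) (al p2 : R) :
  0 < al -> 0 < p2 < 1 -> has_pmf X (pseudo_binomial_pmf al p2) ->
  'E_P2[X]%E = 'E_P[S]%E ->
  (dTV P2 P X S <= (((Num.truncn al)%:R * p2 * (1 - p2))^-1)%:E *
     ((2 * (H1 + p2 * H2))%:E + `|'V_P2[X] - 'V_P[S]|))%E.
Proof.
move=> al0 hp2 pmfX EX; set N := Num.truncn al; set Q := pseudo_binomial_pmf al p2 in pmfX *.
have mX : measurable_fun setT X by [].
have mass : has_mass1 Q by exact: pb_pmf_mass1.
have Q0 := mass.1; have QN i : (N < i)%N -> Q i = 0 by exact: pb_pmf_gtN.
rewrite run_expectation in EX; rewrite run_variance.
have muE : mu = \sum_(i < N.+1) i%:R * Q i.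
  have h : (fun n => \sum_(i < n) i%:R * Q i) @ \oo --> mu.
    apply: (proj1 (@nneseriesP R (fun i => i%:R * Q i) mu _)) => [i|].
      by rewrite mulr_ge0.
    by rewrite -(expectation_nat mX mass pmfX).
  apply: cvg_uniqueR h _.
  by apply: (@cvg_sum_finite R (fun i => i%:R * Q i)) => i /QN ->; rewrite mulr0.
have VE : 'V_P2[X]%E = (\sum_(i < N.+1) i%:R ^+ 2 * Q i - mu ^+ 2)%:E.
  rewrite (variance_nat mX mass pmfX EX).
  apply/(@nneseriesP R (fun i => (i%:R - mu) ^+ 2 * Q i)) => [i|].
    by rewrite mulr_ge0 ?sqr_ge0.
  have -> : \sum_(i < N.+1) i%:R ^+ 2 * Q i - mu ^+ 2 =
      \sum_(i < N.+1) (i%:R - mu) ^+ 2 * Q i.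
    have e c : \sum_(i < N.+1) (i%:R - c) ^+ 2 * Q i =
       \sum_(i < N.+1) i%:R ^+ 2 * Q i - 2 * c * (\sum_(i < N.+1) i%:R * Q i)
       + c ^+ 2 * (\sum_(i < N.+1) Q i).
      rewrite !mulr_sumr -sumrB -big_split /=; apply: eq_bigr => i _; ring.
    by rewrite e -muE pb_pmf_sum //; ring.
  by apply: (@cvg_sum_finite R (fun i => (i%:R - mu) ^+ 2 * Q i)) => i /QN ->;
    rewrite mulr0.
have N0 : (0 < N)%N.
  rewrite lt0n; apply/eqP => NE; have := run_mean_pos.
  by rewrite muE NE big_ord1 mul0r ltxx.
rewrite VE -EFinB abse_EFin -EFinD -EFinM.
apply: dTV_le => // C; rewrite run_probability.
have -> : fine (P2 (X @^-1` [set z%:~R | z in C])) =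
    partial_mass Q (intset_pred C) N.+1.
  apply: cvg_uniqueR (@probability_nat _ _ _ _ _ _ mX mass pmfX C) _.
  rewrite /partial_mass.
  by apply: (@cvg_sum_finite R (fun i => (intset_pred C i)%:R * Q i)) => i /QN ->;
    rewrite mulr0.
have HTheta : \sum_(i < N.+1) i%:R * Q i - v <= Theta.
  by rewrite -muE; exact: run_mean_sub_var.
have := @pb_bound R N al p2 Q hp2 N0 (trunc_bounds al0)
  (@pb_pmf_gt0 R al p2 al0 hp2) QN (pb_pmf_sum al0 hp2) (@pb_pmfS R al p2 hp2)
  m.+1 s s0 s1 muE K1 K2 Theta H2 K1_ge0 K2_ge0 Theta_ge0 run_expandable HTheta K2_le
  (intset_pred C).
rewrite -muE => H; apply: le_trans H _; apply: ler_wpM2l.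
  by case/andP: hp2 => p20 p21; rewrite invr_ge0 !mulr_ge0 ?subr_ge0 // ltW.
by rewrite lerD2r ler_wpM2l // lerD2r; have := K1_le; lra.
Qed.

End Assembly.

Theorem corollary3p1 (R : realType) (d : measure_display)
    (T : measurableType d) (P : probability T R)
    (k1 k2 n : nat) (p : R) (eta : nat -> {RV P >-> R})
    (hk1 : (1 <= k1)%N) (hk2 : (1 <= k2)%N) (hp : 0 < p < 1)
    (heta : bernoulli_trials n p eta)
    (hn : (5 * (k1 + k2) <= n)%N) :
  let k := (k1 + k2)%N in
  let q := 1 - p in
  let a := a_run k1 k2 p in
  let S := run_count k1 k2 n (fun i => eta i : T -> R) in
  [/\ forall (d1 : measure_display) (T1 : measurableType d1)
        (P1 : probability T1 R) (X1 : {RV P1 >-> R}) (lambda : R),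
        0 < lambda ->
        has_pmf X1 (poisson_pmf lambda) ->
        'E_P1[X1]%E = 'E_P[S]%E ->
        let phi := ('V_P1[X1] - 'V_P[S])%E in
        (dTV P1 P X1 S <=
          ((Num.max 1 lambda)^-1)%:E *
          ((2 * (2 + q * p) * h1 n k p * a ^+ 3)%:E + `|phi|))%E,
      forall (d2 : measure_display) (T2 : measurableType d2)
        (P2 : probability T2 R) (X2 : {RV P2 >-> R}) (alpha2 p2 : R),
        0 < alpha2 -> 0 < p2 < 1 ->
        has_pmf X2 (pseudo_binomial_pmf alpha2 p2) ->
        'E_P2[X2]%E = 'E_P[S]%E ->
        let q2 := 1 - p2 in
        let phi := ('V_P2[X2] - 'V_P[S])%E in
        (dTV P2 P X2 S <=
          (((Num.truncn alpha2)%:R * p2 * q2)^-1)%:E *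
          ((2 * (2 + q * p) * a ^+ 2 * (h1 n k p * a + p2 * h2 n k p))%:E
           + `|phi|))%E
    & forall (d3 : measure_display) (T3 : measurableType d3)
        (P3 : probability T3 R) (X3 : {RV P3 >-> R}) (alpha3 p3 : R),
        0 < alpha3 -> 0 < p3 < 1 ->
        has_pmf X3 (negative_binomial_pmf alpha3 p3) ->
        'E_P3[X3]%E = 'E_P[S]%E ->
        let q3 := 1 - p3 in
        let phi := ('V_P3[X3] - 'V_P[S])%E in
        (dTV P3 P X3 S <=
          ((alpha3 * q3)^-1)%:E *
          ((2 * (2 + q * p) * a ^+ 2 * (p3 * h1 n k p * a + q3 * h2 n k p))%:E
           + p3%:E * `|phi|))%E].
Proof.
move=> k q a S; split.
- move=> d1 T1 P1 X1 l l0 pmfX EX.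
  have := poisson_bound hk1 hk2 hp heta hn l0 pmfX EX.
  rewrite -/k -/q -/a (_ : 2 * ((2 + q * p) * h1 n k p * a ^+ 3) =
    2 * (2 + q * p) * h1 n k p * a ^+ 3) //.
  ring.
- move=> d2 T2 P2 X2 al p2 al0 hp2 pmfX EX.
  have := pseudo_binomial_bound hk1 hk2 hp heta hn al0 hp2 pmfX EX.
  rewrite -/k -/q -/a (_ : 2 * ((2 + q * p) * h1 n k p * a ^+ 3 +
      p2 * ((2 + q * p) * h2 n k p * a ^+ 2)) =
    2 * (2 + q * p) * a ^+ 2 * (h1 n k p * a + p2 * h2 n k p)) //.
  ring.
- move=> d3 T3 P3 X3 al p3 al0 hp3 pmfX EX.
  have := negative_binomial_bound hk1 hk2 hp heta hn al0 hp3 pmfX EX.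
  rewrite -/k -/q -/a (_ : 2 * (p3 * ((2 + q * p) * h1 n k p * a ^+ 3) +
      (1 - p3) * ((2 + q * p) * h2 n k p * a ^+ 2)) =
    2 * (2 + q * p) * a ^+ 2 * (p3 * h1 n k p * a + (1 - p3) * h2 n k p)) //.
  ring.
Qed.
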